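(* Consider the model $y_t=x_t'\beta_{T,t}+\varepsilon_t$, $t=1,\dots,T$, let $-1<\underline\gamma\le\gamma_2\le\gamma_1<0$, $h_1=T^{\gamma_1}$, $h_2=T^{\gamma_2}$, and let $\hat\beta_t(\gamma_1)$ and the bootstrap estimator $\hat\beta_t^*(\gamma_1,\gamma_2)$ be as defined in the context. Suppose that the kernel condition (K), the data condition (D') and the eigenvalue condition (E) of the context hold, that for each $t=\lfloor Tr\rfloor$, $r\in(0,1)$, the uniform negligibility property $$\max_{-\lfloor Th_2\rfloor\le j\le\lfloor Th_2\rfloor}\Big\|\frac1{Th_1}\sum_{i=1}^TK\big(\tfrac{t+j-i}{Th_1}\big)x_ix_i'(\beta_{T,i}-\beta_{T,t+j})\Big\|=o_p(1/\sqrt{Th_2})$$ holds, and that $\beta_{T,t}$ belongs to type-a $\mathrm{TVP}(\alpha)$ for some $\alpha>0$. If $\gamma_1\in\Gamma(\alpha)=(-1,-(2\alpha+1)^{-1})$, then for each $r\in(0,1)$, $t=\lfloor Tr\rfloor$, and for $\gamma_2\in[\underline\gamma,\gamma_1]$, there are random vectors $R^*_{T,t}$ such that, as $T\to\infty$, $$\sup_{x\in\mathbb R^p}\Big|P^*\Big(\sqrt{Th_2}\big(\hat\beta_t^*(\gamma_1,\gamma_2)-\hat\beta_t(\gamma_1)-R^*_{T,t}\big)\le x\Big)-P(Z\le x)\Big|\stackrel{p}{\to}0,$$ where $Z\sim N(0,\Omega(r)^{-1}\Sigma(r)\Omega(r)^{-1})$, inequalities between vectors are componentwise, and $$R^*_{T,t}=\begin{cases}O_{p^*}(1/\sqrt{Th_2})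 & \text{if }\gamma_2=\gamma_1,\\ o_{p^*}(1/\sqrt{Th_2}) & \text{if }\gamma_2<\gamma_1,\end{cases}$$ with arbitrarily high probability for sufficiently large $T$.
   Context: **Model and estimators.** $x_t$ is a random $p\times1$ vector, $\varepsilon_t$ a scalar random variable, $\beta_{T,t}$ ($1\le t\le T$) a triangular array of (deterministic or random) $p\times1$ vectors. $\hat\beta_t(\gamma_1)=\big(\sum_{i=1}^TK(\frac{t-i}{Th_1})x_ix_i'\big)^{-1}\sum_{i=1}^TK(\frac{t-i}{Th_1})x_iy_i$, with residuals $\hat\varepsilon_t(\gamma_1)=y_t-x_t'\hat\beta_t(\gamma_1)$. (Inverses are defined arbitrarily on events where the matrix is singular.) $\|A\|=\mathrm{tr}(A'A)^{1/2}$. **Fixed-design wild bootstrap.** $\eta_t\sim$ i.i.d. $N(0,1)$, independent of the data; $\varepsilon^*_t(\gamma_1)=\eta_t\hat\varepsilon_t(\gamma_1)$; $y_t^*(\gamma_1)=x_t'\hat\beta_t(\gamma_1)+\varepsilon_t^*(\gamma_1)$; and $$\hat\beta_t^*(\gamma_1,\gamma_2)=\Big(\sum_{i=t-\lfloor Th_2\rfloor}^{t+\lfloor Th_2\rfloor}K\big(\tfrac{t-i}{Th_2}\big)x_ix_i'\Big)^{-1}\sum_{i=t-\lfloor Th_2\rfloor}^{t+\lfloor Th_2\rfloor}K\big(\tfrac{t-i}{Th_2}\big)x_iy_i^*(\gamma_1).$$ $P^*$ is the bootstrap probability measure, i.e. the conditional probability given the original sample (all of $x_t,\varepsilon_t,\beta_{T,t}$),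 with only the $\eta_t$ random. ''$R^*=O_{p^*}(b_T)$ with arbitrarily high probability for sufficiently large $T$'' means: for all $\epsilon,\delta>0$ there are $M,T_0$ such that for $T\ge T_0$, with $P$-probability at least $1-\epsilon$, $P^*(\|R^*\|>Mb_T)\le\delta$. ''$o_{p^*}(b_T)$ with arbitrarily high probability for sufficiently large $T$'' means: for all $\epsilon,\delta,M>0$ there is $T_0$ such that the same holds for $T\ge T_0$. **Class type-a $\mathrm{TVP}(\alpha)$.** $\beta_{T,t}=O_p(1)$ for all $t$, and for any sequence $\{a_T\}$ of positive integers with $a_T\to\infty$, $a_T=o(T)$, and any $t$, $\max_{j:|t-j|\le a_T}\|\beta_{T,t}-\beta_{T,j}\|=O_p((a_T/T)^\alpha)$ as $T\to\infty$ ($j$ ranges over $\{1,\dots,T\}$; $t=t_T$ may depend on $T$, e.g. $t=\lfloor Tr\rfloor$). **(K)** $K:\mathbb R\to[0,\infty)$ is Lipschitz continuous with compact support $[-1,1]$, and $\int_{-1}^1K(x)\,dx=1$. **(D')** (a') For some $q>2$, $\{(x_t',\varepsilon_t)\}_t$ is $L_2$-NED of size $-2(q-1)/(q-2)$ on an $\alpha$-mixing sequence of size $-2q/(q-2)$, with respect to positive constants $d_t$ with $\sup_td_t<\infty$; moreover $\sup_tE\|x_t\|^{2q}+\sup_tE|\varepsilon_t|^{2q}<\infty$. (b) $\{x_t\varepsilon_t\}_t$ has mean zero and is serially uncorrelated. (c) For each $r\in(0,1)$ there exist nonrandom symmetric positive definite matrices $\Omega(r)$, $\Sigma(r)$ such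 that, with $t=\lfloor Tr\rfloor$ and for $h$ with $h\to0$, $Th\to\infty$, $\frac1{Th}\sum_{i=1}^TK(\frac{t-i}{Th})E[x_ix_i']\to\Omega(r)$ and $\mathrm{Var}\big(\frac1{\sqrt{Th}}\sum_{i=1}^TK(\frac{t-i}{Th})x_i\varepsilon_i\big)\to\Sigma(r)$. **(E)** There is $\rho>0$ such that $\inf_{t\ge1}\lambda'E[x_tx_t']\lambda\ge\rho\|\lambda\|^2$ for any $\lambda\ne0$. **NED and mixing.** $\{z_t\}$ is $L_2$-near-epoch dependent ($L_2$-NED) of size $-a$ on $\{V_t\}$ with respect to constants $d_t$ if $(E\|z_t-E[z_t\mid\sigma(V_{t-m},\dots,V_{t+m})]\|^2)^{1/2}\le d_t\nu_m$ for all $t$ and $m\ge0$, where $\nu_m=O(m^{-a-\delta})$ for some $\delta>0$. $\{V_t\}$ is $\alpha$-mixing of size $-b$ if its strong mixing coefficients are $O(m^{-b-\delta})$ for some $\delta>0$. *)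

(* Defs.v *)
From HB Require Import structures.
From mathcomp Require Import all_boot all_order all_algebra.
From mathcomp Require Import all_classical all_reals all_analysis.

Set Implicit Arguments.
Unset Strict Implicit.
Unset Printing Implicit Defensive.

Import Order.TTheory GRing.Theory Num.Theory.
Import numFieldNormedType.Exports.

Local Open Scope classical_set_scope.
Local Open Scope ring_scope.

Section Matrices.
Context {R : realType}.

Definition frob (m n : nat) (A : 'M[R]_(m, n)) : R := Num.sqrt (\tr (A^T *m A)).

Definition posdef (p : nat) (S : 'M[R]_p) : Prop :=
  S^T = S /\ forall v : 'cV[R]_p, v != 0 -> 0 < (v^T *m S *m v) 0 0.

Definition vle (p : nat) (u v : 'cV[R]_p) : Prop := forall i, u i 0 <= v i 0.

End Matrices.

Section RandomVectors.
Context {d : measure_display} {W : measurableType d} {R : realType}.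
Variable P : probability W R.

Definition random_vector (p : nat) (X : W -> 'cV[R]_p) : Prop :=
  forall i, measurable_fun setT (fun w => X w i 0).

Definition mean_mx (m n : nat) (M : W -> 'M[R]_(m, n)) : 'M[R]_(m, n) :=
  \matrix_(i, j) fine 'E_P[fun w => M w i j].

Definition var_mx (p : nat) (X : W -> 'cV[R]_p) : 'M[R]_p :=
  \matrix_(i, j) fine (covariance P (fun w => X w i 0) (fun w => X w j 0)).

(* [normal_prob m s] takes the standard deviation [s], and it is the uniform law
   on [0, 1] when [s = 0]; hence the separate degenerate case. *)
Definition normal_law (m v : R) (B : set R) : \bar R :=
  if v == 0 then dirac m B else normal_prob m (Num.sqrt v) B.

(* [Z] has the p-variate law N(0, S): every linear form l'Z has the univariate
   law N(0, l'Sl). *)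
Definition gaussian_vector (p : nat) (Z : W -> 'cV[R]_p) (S : 'M[R]_p) : Prop :=
  random_vector Z /\
  forall (l : 'cV[R]_p) (B : set R), measurable B ->
    P [set w | B ((l^T *m Z w) 0 0)] = normal_law 0 ((l^T *m S *m l) 0 0) B.

Definition iid_std_normal (eta : nat -> {RV P >-> R}) : Prop :=
  (forall t B, measurable B -> distribution P (eta t) B = normal_prob 0 1 B) /\
  (forall (s : seq nat) (B : nat -> set R), uniq s ->
    (forall t, measurable (B t)) ->
    P (\bigcap_(t in [set` s]) (eta t @^-1` B t)) =
      (\prod_(t <- s) P (eta t @^-1` B t))%E).

Definition cvg_prob0 (Y : nat -> W -> R) : Prop :=
  forall e : R, 0 < e -> P [set w | e < `|Y T w|] @[T --> \oo] --> 0%E.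

Definition is_Op (Y : nat -> W -> R) (b : nat -> R) : Prop :=
  forall e : R, 0 < e -> exists M : R, 0 < M /\
    \forall T \near \oo, (P [set w | (M * b T < `|Y T w|)%R] <= e%:E)%E.

Definition is_op (Y : nat -> W -> R) (b : nat -> R) : Prop :=
  forall M : R, 0 < M -> P [set w | M * b T < `|Y T w|] @[T --> \oo] --> 0%E.

End RandomVectors.

Section Dependence.
Context {d : measure_display} {W : measurableType d} {R : realType}.
Variable P : probability W R.

Definition of_size (a : R) (nu : nat -> R) : Prop :=
  exists delta : R, 0 < delta /\
    (nu : nat -> R^o) =O_\oo (fun m => m%:R `^ (- a - delta) : R^o).

Definition sigma_of {dV : measure_display} {SV : measurableType dV}
    (V : int -> {RV P >-> SV}) (J : set int) : set (set W) :=
  <<s \bigcup_(i in J) preimage_set_system setT (V i) measurable >>.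

Definition mixing_coef {dV : measure_display} {SV : measurableType dV}
    (V : int -> {RV P >-> SV}) (m : nat) : R :=
  sup [set a : R | exists (t : int) (A B : set W),
    [/\ sigma_of V [set i | i <= t] A, sigma_of V [set i | t + m%:Z <= i] B &
        a = `|fine (P (A `&` B)) - fine (P A) * fine (P B)| ] ].

(* [Y] is a version of the conditional expectation E[X | G]; [G] is meant to be
   a sub-sigma-algebra. *)
Definition cond_exp_version (G : set (set W)) (X Y : W -> R) : Prop :=
  [/\ forall B : set R, measurable B -> G (Y @^-1` B),
      P.-integrable setT (EFin \o Y) &
      forall A, G A -> (\int[P]_(w in A) (Y w)%:E = \int[P]_(w in A) (X w)%:E)%E ].

(* {z_t}, t >= 1, is L2-NED of size -a on {V_t}, t in Z, with constants d_t. *)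
Definition L2_NED {dV : measure_display} {SV : measurableType dV} (k : nat)
    (z : nat -> W -> 'cV[R]_k) (V : int -> {RV P >-> SV}) (dc : nat -> R) (a : R) :
    Prop :=
  exists nu : nat -> R, of_size a nu /\
  forall t m : nat, (1 <= t)%N -> exists Y : W -> 'cV[R]_k,
    (forall i, cond_exp_version
       (sigma_of V [set j | t%:Z - m%:Z <= j <= t%:Z + m%:Z])
       (fun w => z t w i 0) (fun w => Y w i 0)) /\
    (Lnorm P 2%:E (fun w => (frob (z t w - Y w))%:E) <= (dc t * nu m)%:E)%E.

End Dependence.

Section Estimators.
Context {R : realType} {p : nat}.
Variables (K : R -> R) (T : nat).
Implicit Types (x : nat -> 'cV[R]_p) (y eta : nat -> R) (b : R) (t n : nat).

(* The indices i with |i - t| <= n, restricted to the sample {1, ..., T}; the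
   subtraction [t - n] is truncated at 0, which the filter makes harmless. *)
Definition window t n : seq nat :=
  [seq i <- index_iota (t - n) (t + n).+1 | (1 <= i <= T)%N].

Definition kw b t (i : nat) : R := K ((t%:R - i%:R) / b).

(* [b] stands for the bandwidth Th. *)
Definition bhat b x y t : 'cV[R]_p :=
  invmx (\sum_(1 <= i < T.+1) kw b t i *: (x i *m (x i)^T)) *m
  (\sum_(1 <= i < T.+1) kw b t i *: (y i *: x i)).

Definition resid b x y t : R := y t - ((x t)^T *m bhat b x y t) 0 0.

Definition ystar b1 x y eta t : R :=
  ((x t)^T *m bhat b1 x y t) 0 0 + eta t * resid b1 x y t.

Definition bstar b1 b2 x y eta t : 'cV[R]_p :=
  invmx (\sum_(i <- window t (Num.truncn b2)) kw b2 t i *: (x i *m (x i)^T)) *m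
  (\sum_(i <- window t (Num.truncn b2)) kw b2 t i *: (ystar b1 x y eta i *: x i)).

End Estimators.

(* T h with h = T^gamma *)
Definition bandwidth {R : realType} (gamma : R) (T : nat) : R :=
  T%:R * T%:R `^ gamma.

Definition fracpt {R : realType} (r : R) (T : nat) : nat := Num.truncn (T%:R * r).

Section Conditions.
Context {d : measure_display} {W : measurableType d} {R : realType}.
Variables (P : probability W R) (p : nat).
Implicit Types (x : nat -> W -> 'cV[R]_p) (eps : nat -> {RV P >-> R}).
Implicit Types (beta : nat -> nat -> W -> 'cV[R]_p) (K : R -> R).

(* Time points may depend on T; [t T] has to lie in the sample for large T only, so
   that t_T = floor(T r) is allowed. *)
Definition in_sample (t : nat -> nat) : Prop :=
  \forall T \near \oo, (1 <= t T <= T)%N.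

Definition TVP_a beta (alpha : R) : Prop :=
  (forall t : nat -> nat, in_sample t ->
    is_Op P (fun T w => frob (beta T (t T) w)) (fun=> 1)) /\
  (forall a t : nat -> nat, (forall T, (0 < a T)%N) ->
    a T @[T --> \oo] --> \oo ->
    ((a T)%:R / T%:R : R) @[T --> \oo] --> (0 : R) -> in_sample t ->
    is_Op P
      (fun T w => \big[Num.max/0]_(j <- window T (t T) (a T))
                    frob (beta T (t T) w - beta T j w))
      (fun T => ((a T)%:R / T%:R) `^ alpha)).

(* The support is only required to be contained in [-1, 1]. *)
Definition cond_K K : Prop :=
  [/\ forall u, 0 <= K u, lipschitz (K : R^o -> R^o),
      forall u, 1 < `|u| -> K u = 0 &
      (\int[lebesgue_measure]_(u in `[(-1)%R, 1%R]) (K u)%:E = 1)%E ].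

Definition cond_Da x eps : Prop :=
  exists q : R, [/\ 2 < q,
    (exists (dV : measure_display) (SV : measurableType dV)
       (V : int -> {RV P >-> SV}) (dc : nat -> R),
       [/\ of_size (2 * q / (q - 2)) (mixing_coef V),
           forall t, (1 <= t)%N -> 0 < dc t,
           exists D : R, forall t, (1 <= t)%N -> dc t <= D &
           L2_NED (fun t w => col_mx (x t w) (eps t w)%:M) V dc
             (2 * (q - 1) / (q - 2)) ]),
    (exists C : R, forall t, (1 <= t)%N ->
       ('E_P[fun w => (frob (x t w) `^ (2 * q))%R] <= C%:E)%E) &
    (exists C : R, forall t, (1 <= t)%N ->
       ('E_P[fun w => (`|eps t w| `^ (2 * q))%R] <= C%:E)%E) ].

Definition cond_Db x eps : Prop :=
  (forall t i, (1 <= t)%N -> ('E_P[fun w => (eps t w * x t w i 0)%R] = 0)%E) /\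
  (forall s t i j, (1 <= s)%N -> (1 <= t)%N -> s <> t ->
    (covariance P (fun w => (eps s w * x s w i 0)%R)
                  (fun w => (eps t w * x t w j 0)%R) = 0)%E).

Definition cond_Dc K x eps (Om Sg : R -> 'M[R]_p) : Prop :=
  forall r : R, 0 < r < 1 ->
  [/\ posdef (Om r), posdef (Sg r) &
  forall h : nat -> R, h T @[T --> \oo] --> (0 : R) ->
    T%:R * h T @[T --> \oo] --> +oo ->
    (T%:R * h T)^-1 *:
      (\sum_(1 <= i < T.+1) kw K (T%:R * h T) (fracpt r T) i *:
          mean_mx P (fun w => x i w *m (x i w)^T))
      @[T --> \oo] --> Om r /\
    var_mx P (fun w => (Num.sqrt (T%:R * h T))^-1 *:
      (\sum_(1 <= i < T.+1) kw K (T%:R * h T) (fracpt r T) i *: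
          (eps i w *: x i w)))
      @[T --> \oo] --> Sg r ].

Definition cond_E x : Prop :=
  exists rho : R, 0 < rho /\
  forall t (l : 'cV[R]_p), (1 <= t)%N -> l != 0 ->
    rho * frob l ^+ 2 <= (l^T *m mean_mx P (fun w => x t w *m (x t w)^T) *m l) 0 0.

Definition negligible_bias K (gamma1 gamma2 : R) x beta (t : nat -> nat) : Prop :=
  is_op P
    (fun T w => \big[Num.max/0]_(k <- window T (t T) (Num.truncn (bandwidth gamma2 T)))
       frob ((bandwidth gamma1 T)^-1 *:
         (\sum_(1 <= i < T.+1) kw K (bandwidth gamma1 T) k i *:
            (x i w *m (x i w)^T *m (beta T i w - beta T k w)))))
    (fun T => (Num.sqrt (bandwidth gamma2 T))^-1).

End Conditions.

(* The data live on (W, P) and the multipliers on a second probability space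
   (W', P'), so that on the product space the multipliers are independent of the
   data.  The bootstrap probability P* of an event E of the product is then the
   random variable w |-> P' {w' | (w, w') in E}, which is a version of the
   conditional probability of E given the sample when E depends on w through the
   sample only. *)
Section Bootstrap.
Context {d d' : measure_display} {W : measurableType d} {W' : measurableType d'}.
Context {R : realType}.
Variables (P : probability W R) (P' : probability W' R) (p : nat).

Definition Pstar (E : W -> W' -> Prop) (w : W) : R := fine (P' [set w' | E w w']).

Definition sigma_sample (x : nat -> W -> 'cV[R]_p) (eps : nat -> {RV P >-> R})
    (beta : nat -> nat -> W -> 'cV[R]_p) (T : nat) : set (set W) :=
  <<s \bigcup_(t in [set t | (1 <= t <= T)%N])
      (preimage_set_system setT (eps t) measurable `|`
       \bigcup_(i in [set: 'I_p])
         (preimage_set_system setT (fun w => x t w i 0) measurable `|`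
          preimage_set_system setT (fun w => beta T t w i 0) measurable)) >>.

(* A random vector that is a function of the sample and of the multipliers'
   probability space. *)
Definition bootstrap_vector (G : set (set W)) (X : W -> W' -> 'cV[R]_p) : Prop :=
  forall i (B : set R), measurable B ->
    <<s [set A `*` C | A in G & C in measurable] >>
      [set ww : W * W' | B (X ww.1 ww.2 i 0)].

(* [is_Op_star] and [is_op_star]: O_{p*}(b_T) and o_{p*}(b_T) with arbitrarily high
   P-probability for sufficiently large T. *)
Definition is_Op_star (X : nat -> W -> W' -> 'cV[R]_p) (b : nat -> R) : Prop :=
  forall e dl : R, 0 < e -> 0 < dl -> exists M : R, 0 < M /\
    \forall T \near \oo,
      ((1 - e)%:E <=
        P [set w | (Pstar (fun w w' => M * b T < frob (X T w w')) w <= dl)%R])%E.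

Definition is_op_star (X : nat -> W -> W' -> 'cV[R]_p) (b : nat -> R) : Prop :=
  forall e dl M : R, 0 < e -> 0 < dl -> 0 < M ->
    \forall T \near \oo,
      ((1 - e)%:E <=
        P [set w | (Pstar (fun w w' => M * b T < frob (X T w w')) w <= dl)%R])%E.

End Bootstrap.

(* Main.v *)
(* The remainder R* is at our disposal, so the bootstrap law can be made exact.
   Given the data, the multiplier sum b2^(-1/2) sum_k K_k x_k resid_k eta_k is
   Gaussian with a covariance A A' close to Sg = L L'.  Adding finitely many fresh
   multipliers with covariance L (s I - E) L', where E = L^(-1) (A A' - Sg) L^(-T)
   and s is the entrywise norm of E, and dividing by sqrt (1 + s) gives a vector
   with covariance exactly Sg, hence a vector Z* with the law of Z for every sample.
   With R* := bootstrap error - b2^(-1/2) Z*, the supremum vanishes identically, and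
   what remains is the size of R*.
   Two Gaussian combinations with the same covariance have the same orthant
   probabilities because their trigonometric moments agree and orthants are limits
   of trigonometric polynomials.
   sqrt(b2) R* is the sum of a centre and a conditionally Gaussian vector.  The
   variance of the latter is small once A A' and the Gram matrices are close to
   their limits, which follows from an L1 law of large numbers for truncated
   near-epoch dependent products (uniformly over the window by a grid argument).
   The centre averages sqrt(b2) (bhat_i - bhat_t): the bias and the parameter drift
   are o(1) by assumption, and the averaged estimation noise has mean at most
   C sqrt(b2 / b1), which is O(1) if gamma2 = gamma1 and o(1) if gamma2 < gamma1. *)
Require Import Defs.
From HB Require Import structures.
From mathcomp Require Import all_boot all_order all_algebra.
From mathcomp Require Import all_classical all_reals all_analysis.
From mathcomp Require Import measurable_realfun.
From mathcomp Require Import ring lra zify.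

Set Implicit Arguments.
Unset Strict Implicit.
Unset Printing Implicit Defensive.

Import Order.TTheory GRing.Theory Num.Theory.
Import numFieldNormedType.Exports.

Local Open Scope classical_set_scope.
Local Open Scope ring_scope.


(** * Expectations *)

(** Adding independent terms can only enlarge a covariance, while A A' may exceed Sg in some
    directions. The fresh multipliers therefore aim at (1 + s) Sg, which dominates A A' because s
    bounds the operator norm of E; the division by sqrt (1 + s) then removes the excess. Every
    ingredient is an explicit function of the data, so R* is measurable for the sample and the
    multipliers. Up to estimation error, the entries of A A' average products of four coordinates of
    (x, eps), which have only q / 2 > 1 moments. This forces laws of large numbers in L1, reached by
    truncation, rather than variance bounds for the products themselves. The limits Om and Sg are
    given at the point t only, whereas the residuals involve estimators at every i of the window. At
    those points the eigenvalue condition and a lower bound on the kernel mass take the place of a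
    limit of the Gram matrix. The factor sqrt (b2 / b1) comes from serial uncorrelatedness: it gives
    the estimation noise a second moment of order 1 / b1. *)

Section Expectation.
Context {d : measure_display} {W : measurableType d} {R : realType}.
Variable P : probability W R.
Implicit Types f g : W -> R.

Definition itg f := P.-integrable setT (EFin \o f).
Definition Ex f : R := \int[P]_w f w.

Lemma itg_meas f : itg f -> measurable_fun setT f.
Proof. by move=> /integrableP[/measurable_EFinP]. Qed.

Lemma itg_dom f g : measurable_fun setT f -> itg g ->
  (forall w, `|f w| <= g w) -> itg f.
Proof.
move=> mf ig fg; apply: (le_integrable _ _ _ ig) => //.
  exact/measurable_EFinP.
by move=> w _; rewrite /= lee_fin (le_trans (fg w))// ler_norm.
Qed.

Lemma itg_cst (c : R) : itg (fun=> c).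
Proof. exact: finite_measure_integrable_cst. Qed.

Lemma itg_bounded f (B : R) : measurable_fun setT f ->
  (forall w, `|f w| <= B) -> itg f.
Proof. by move=> mf fB; exact: (itg_dom mf (itg_cst B)). Qed.

Lemma itgD f g : itg f -> itg g -> itg (fun w => f w + g w).
Proof. by move=> iF iG; exact: (integrableD _ iF iG). Qed.

Lemma itgZ (c : R) f : itg f -> itg (fun w => c * f w).
Proof. by move=> iF; exact: (integrableZl _ c iF). Qed.

Lemma itgB f g : itg f -> itg g -> itg (fun w => f w - g w).
Proof. by move=> iF iG; exact: (integrableB _ iF iG). Qed.

Lemma itg_norm f : itg f -> itg (fun w => `|f w|).
Proof. by move=> iF; exact: (integrable_abse iF). Qed.

Lemma itg_sum (I : Type) (s : seq I) (F : I -> W -> R) :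
  (forall i, itg (F i)) -> itg (fun w => \sum_(i <- s) F i w).
Proof.
move=> iF; elim: s => [|i s IHs].
  by under eq_fun do rewrite big_nil; exact: itg_cst.
by under eq_fun do rewrite big_cons; exact: itgD.
Qed.

Lemma Ex_cst c : Ex (fun=> c) = c.
Proof. by rewrite /Ex Rintegral_cst// [X in fine X]probability_setT mulr1. Qed.

Lemma ExD f g : itg f -> itg g -> Ex (fun w => f w + g w) = Ex f + Ex g.
Proof. by move=> iF iG; exact: RintegralD. Qed.

Lemma ExB f g : itg f -> itg g -> Ex (fun w => f w - g w) = Ex f - Ex g.
Proof. by move=> iF iG; exact: RintegralB. Qed.

Lemma ExZ c f : itg f -> Ex (fun w => c * f w) = c * Ex f.
Proof. by move=> iF; exact: RintegralZl. Qed.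

Lemma Ex_sum (I : Type) (s : seq I) (F : I -> W -> R) :
  (forall i, itg (F i)) ->
  Ex (fun w => \sum_(i <- s) F i w) = \sum_(i <- s) Ex (F i).
Proof.
move=> iF; elim: s => [|i s IHs].
  by rewrite big_nil -[RHS](Ex_cst 0); congr Ex; apply/funext => w; rewrite big_nil.
rewrite big_cons -IHs -ExD//; last exact: itg_sum.
by congr Ex; apply/funext => w; rewrite big_cons.
Qed.

Lemma Ex_le f g : itg f -> itg g -> (forall w, f w <= g w) -> Ex f <= Ex g.
Proof. by move=> iF iG fg; exact: le_Rintegral. Qed.

Lemma Ex_ge0 f : (forall w, 0 <= f w) -> 0 <= Ex f.
Proof. by move=> f0; exact: Rintegral_ge0. Qed.

Lemma Ex_norm f : itg f -> `|Ex f| <= Ex (fun w => `|f w|).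
Proof. by move=> iF; exact: le_normr_Rintegral. Qed.

Lemma Ex_le_cst f c : itg f -> (forall w, f w <= c) -> Ex f <= c.
Proof. by move=> iF fc; rewrite -(Ex_cst c); exact/Ex_le/fc/itg_cst. Qed.

Lemma Ex_bounded f B : measurable_fun setT f -> (forall w, `|f w| <= B) ->
  `|Ex f| <= B.
Proof.
move=> mf fB; have iF := itg_bounded mf fB.
by rewrite (le_trans (Ex_norm iF))// Ex_le_cst//; exact: itg_norm.
Qed.

Lemma EFin_Ex f : itg f -> (\int[P]_w (f w)%:E = (Ex f)%:E)%E.
Proof. by move=> iF; rewrite /Ex /Rintegral fineK//; exact: integrable_fin_num. Qed.

Lemma itg_ge0 f (C : R) : measurable_fun setT f -> (forall w, 0 <= f w) ->
  (\int[P]_w (f w)%:E <= C%:E)%E -> itg f /\ Ex f <= C.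
Proof.
move=> mf f0 fC.
have iF : itg f.
  apply/integrableP; split; first exact/measurable_EFinP.
  apply: le_lt_trans (ltry C); apply: le_trans fC.
  rewrite le_eqVlt; apply/orP; left; apply/eqP.
  by apply: eq_integral => w _ /=; rewrite ger0_norm.
by split => //; rewrite -lee_fin -EFin_Ex.
Qed.

Lemma itg_indic (A : set W) : measurable A -> itg (\1_A : W -> R).
Proof.
move=> mA; apply: (@itg_bounded _ 1) => //.
by move=> w; rewrite indicE ger0_norm //; case: (w \in A) => /=.
Qed.

Lemma Ex_indic (A : set W) : measurable A -> Ex \1_A = fine (P A).
Proof. by move=> mA; rewrite /Ex /Rintegral integral_indic// setIT. Qed.

Lemma prob_markov f (a : R) : itg f -> (forall w, 0 <= f w) -> 0 < a ->
  (P [set w | (a < f w)%R] <= (Ex f / a)%:E)%E.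
Proof.
move=> iF f0 a0.
have mA : measurable [set w | a < f w].
  rewrite -[X in measurable X]setTI; apply: measurable_fun_ltr => //.
  exact: itg_meas.
rewrite -(@fineK _ (P _)) ?fin_num_measure// lee_fin -Ex_indic//.
rewrite ler_pdivlMr// mulrC -ExZ; last exact: itg_indic.
apply: Ex_le => //; first exact/itgZ/itg_indic.
move=> w; rewrite indicE; have [/set_mem /= aw|_] := boolP (w \in _).
  by rewrite mulr1 ltW.
by rewrite mulr0.
Qed.

(* AM-GM in place of the Cauchy-Schwarz inequality for integrals. *)
Lemma Ex_norm_sqr f (k : R) : itg (fun w => f w ^+ 2) -> itg f -> 0 < k ->
  Ex (fun w => f w ^+ 2) <= k ^+ 2 -> Ex (fun w => `|f w|) <= k.
Proof.
move=> if2 iF k0 fk.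
have -> : k = 2^-1 * k + (2 * k)^-1 * k ^+ 2 by field; rewrite gt_eqF.
apply: (@le_trans _ _ (Ex (fun w => 2^-1 * k + (2 * k)^-1 * f w ^+ 2))).
  apply: Ex_le; [exact: itg_norm| |].
    by apply: itgD; [exact: itg_cst|exact: itgZ].
  move=> w; rewrite -[f w ^+ 2]real_normK ?num_real//.
  rewrite -subr_ge0 (_ : _ - _ = (2 * k)^-1 * (`|f w| - k) ^+ 2).
    by rewrite mulr_ge0 ?sqr_ge0// invr_ge0 mulr_ge0// ltW.
  by field; rewrite gt_eqF.
rewrite ExD; [|exact: itg_cst|exact: itgZ].
by rewrite Ex_cst ExZ// lerD2l ler_wpM2l// invr_ge0 mulr_ge0// ltW.
Qed.

End Expectation.

(** * Independence *)

Section Layers.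
Context {R : realType}.

(** On [0, 1] this is floor(n u) / n, written as an average of indicators of level sets, so that
    identities and inequalities for events extend linearly to functions. *)
Definition layer (n : nat) (u : R) : R :=
  n%:R^-1 * \sum_(1 <= k < n.+1) (k%:R / n%:R <= u)%R%:R.

Lemma sum_nat_le (n m : nat) : (m <= n)%N ->
  \sum_(1 <= k < n.+1) (k <= m)%N%:R = m%:R :> R.
Proof.
move=> mn; rewrite (big_cat_nat (n := m.+1))//=.
rewrite [X in X + _](eq_big_nat _ _ (F2 := fun=> 1)); last first.
  by move=> i /andP[_ im]; rewrite -ltnS im.
rewrite [X in _ + X](eq_big_nat _ _ (F2 := fun=> 0)); last first.
  by move=> i /andP[mi _]; rewrite leqNgt mi.
by rewrite big1_eq addr0 sumr_const_nat subn1.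
Qed.

Lemma layer_dist (n : nat) (u : R) : (0 < n)%N -> 0 <= u <= 1 ->
  `|u - layer n u| <= n%:R^-1.
Proof.
move=> n0 /andP[u0 u1]; have nR0 : 0 < n%:R :> R by rewrite ltr0n.
have nu0 : 0 <= n%:R * u by rewrite mulr_ge0.
have /andP[m1 m2] := truncn_itv nu0.
set m := Num.truncn _ in m1 m2.
have mn : (m <= n)%N.
  by rewrite -(ler_nat R) (le_trans m1)// -[leRHS]mulr1 ler_wpM2l.
have -> : layer n u = n%:R^-1 * m%:R.
  rewrite /layer -(sum_nat_le mn); congr (_ * _).
  apply: eq_bigr => k _; congr (nat_of_bool _)%:R.
  rewrite ler_pdivrMr// mulrC; apply/idP/idP => [ku|km].
    by rewrite -ltnS -(ltr_nat R) (le_lt_trans ku).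
  by rewrite (le_trans _ m1)// ler_nat.
have -> : u - n%:R^-1 * m%:R = n%:R^-1 * (n%:R * u - m%:R).
  by field; rewrite gt_eqF.
rewrite normrM gtr0_norm ?invr_gt0// -[leRHS]mulr1 ler_wpM2l ?invr_ge0//.
by rewrite ger0_norm ?subr_ge0// lerBlDl (le_trans (ltW m2))// -natr1.
Qed.

Lemma layer_ge0 n (u : R) : 0 <= layer n u.
Proof. by rewrite mulr_ge0 ?invr_ge0// sumr_ge0. Qed.

Lemma layer_le1 n (u : R) : layer n u <= 1.
Proof.
case: n => [|n]; first by rewrite /layer invr0 mul0r.
rewrite /layer mulrC ler_pdivrMr ?ltr0n// mul1r.
apply: (@le_trans _ _ (\sum_(1 <= k < n.+2) 1)).
  by apply: ler_sum => i _; rewrite lern1 leq_b1.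
by rewrite sumr_const_nat subn1.
Qed.

Lemma small_inv (e : R) : 0 < e -> exists2 n : nat, (0 < n)%N & n%:R^-1 <= e.
Proof.
move=> e0; exists (Num.truncn e^-1).+1 => //.
rewrite -[leRHS]invrK lef_pV2 ?posrE ?invr_gt0//.
exact/ltW/truncnS_gt.
Qed.

Lemma le_eps_mul (a c : R) : (forall e, 0 < e -> a <= c * e) -> a <= 0.
Proof.
move=> h; rewrite leNgt; apply/negP => a0.
have c0 : 0 < c.
  by have := h 1 ltr01; rewrite mulr1 => /(lt_le_trans a0).
have := h (a / (2 * c)) ltac:(by rewrite divr_gt0 ?mulr_gt0).
rewrite (_ : c * _ = a / 2); last by field; rewrite gt_eqF.
by move=> ?; lra.
Qed.

End Layers.


Section LayerMeasurable.
Context {d : measure_display} {W : measurableType d} {R : realType}.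

Lemma measurable_ge_set (f : W -> R) (c : R) : measurable_fun setT f ->
  measurable [set w | c <= f w].
Proof.
move=> mf; rewrite -[X in measurable X]setTI.
exact: (measurable_fun_ler (measurable_cst c) mf).
Qed.

Lemma measurable_gt_set (f : W -> R) (c : R) : measurable_fun setT f ->
  measurable [set w | c < f w].
Proof.
move=> mf; rewrite -[X in measurable X]setTI.
exact: (measurable_fun_ltr (measurable_cst c) mf).
Qed.

Lemma measurable_le_set (f : W -> R) (c : R) : measurable_fun setT f ->
  measurable [set w | f w <= c].
Proof.
move=> mf; rewrite -[X in measurable X]setTI.
exact: (measurable_fun_ler mf (measurable_cst c)).
Qed.

Lemma layer_comp n (f : W -> R) w : layer n (f w) =
  n%:R^-1 * \sum_(1 <= k < n.+1) \1_[set w | k%:R / n%:R <= f w] w.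
Proof.
congr (_ * _); apply: eq_bigr => k _; rewrite indicE.
by congr (nat_of_bool _)%:R; apply/idP/idP => [?|/set_mem//]; exact/mem_set.
Qed.

Lemma measurable_layer n (f : W -> R) : measurable_fun setT f ->
  measurable_fun setT (fun w => layer n (f w)).
Proof.
move=> mf; under eq_fun do rewrite layer_comp.
apply: measurable_funM => //; apply: measurable_sum => k.
exact/measurable_indic/measurable_ge_set.
Qed.

End LayerMeasurable.

Section LayerLinear.
Context {d : measure_display} {W : measurableType d} {R : realType}.
Variable P : probability W R.
Local Notation Ex := (Ex P).
Local Notation itg := (itg P).

(** The identity is linear in [f] and stable under uniform limits, and [layer] approximates
    uniformly every measurable function with values in [0, 1]; an affine change reduces a bounded
    [f] to that case. [C] stays abstract so that it can be a product of expectations in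
    [Ex_prod_indep]. *)
Lemma Ex_mul_ind {d1} {S : measurableType d1} (X : W -> S) (G : W -> R) (M C : R) :
  measurable_fun setT X -> measurable_fun setT G -> (forall w, `|G w| <= M) ->
  (forall B, measurable B ->
     Ex (fun w => \1_B (X w) * G w) = Ex (fun w => \1_B (X w)) * C) ->
  forall (f : S -> R) (B : R), measurable_fun setT f -> (forall s, `|f s| <= B) ->
  Ex (fun w => f (X w) * G w) = Ex (fun w => f (X w)) * C.
Proof.
move=> mX mG GM HB.
have mI (A : set S) : measurable A -> measurable_fun setT (fun w => \1_A (X w) : R).
  by move=> mA; apply: measurableT_comp mX; exact: measurable_indic.
have iI (A : set S) : measurable A -> itg (fun w => \1_A (X w)).
  move=> mA; apply: (@itg_bounded _ _ _ _ _ 1); first exact: mI.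
  by move=> w; rewrite indicE ger0_norm// lern1 leq_b1.
have iIG (A : set S) : measurable A -> itg (fun w => \1_A (X w) * G w).
  move=> mA; apply: (@itg_bounded _ _ _ _ _ M).
    by apply: measurable_funM => //; exact: mI.
  move=> w; rewrite normrM -[leRHS]mul1r ler_pM// indicE ger0_norm//.
  by rewrite lern1 leq_b1.
have M0 : 0 <= M by exact: le_trans (GM point).
have H01 (f : S -> R) : measurable_fun setT f -> (forall s, 0 <= f s <= 1) ->
    Ex (fun w => f (X w) * G w) = Ex (fun w => f (X w)) * C.
  move=> mf f01; apply/eqP; rewrite -subr_eq0 -normr_le0; apply/eqP.
  apply/eqP; apply: (@le_eps_mul _ _ (M + `|C|)) => e e0.
  have [n n0 ne] := small_inv e0.
  have mfX : measurable_fun setT (fun w => f (X w)) by exact: measurableT_comp mX.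
  have mlX : measurable_fun setT (fun w => layer n (f (X w))).
    exact: measurable_layer.
  have dl w : `|f (X w) - layer n (f (X w))| <= e.
    by rewrite (le_trans _ ne)// layer_dist.
  have bf w : `|f (X w)| <= 1.
    by have /andP[? ?] := f01 (X w); rewrite ger0_norm.
  have bl w : `|layer n (f (X w))| <= 1 by rewrite ger0_norm ?layer_ge0 ?layer_le1.
  have bG (h : W -> R) : measurable_fun setT h -> (forall w, `|h w| <= 1) ->
      itg (fun w => h w * G w).
    move=> mh h1; apply: (@itg_bounded _ _ _ _ _ M); first exact: measurable_funM.
    by move=> w; rewrite normrM -[leRHS]mul1r ler_pM.
  have i1 := itg_bounded P mfX bf; have i2 := itg_bounded P mlX bl.
  have i3 := bG _ mfX bf; have i4 := bG _ mlX bl.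
  have E1 : Ex (fun w => layer n (f (X w)) * G w) =
            Ex (fun w => layer n (f (X w))) * C.
    pose A k := [set s | k%:R / n%:R <= f s].
    have mA k : measurable (A k) by exact: measurable_ge_set.
    have -> : (fun w => layer n (f (X w))) =
        fun w => n%:R^-1 * \sum_(1 <= k < n.+1) \1_(A k) (X w).
      by apply/funext => w; rewrite layer_comp.
    have -> : (fun w => layer n (f (X w)) * G w) =
        fun w => n%:R^-1 * \sum_(1 <= k < n.+1) (\1_(A k) (X w) * G w).
      by apply/funext => w; rewrite layer_comp -mulrA mulr_suml.
    rewrite !ExZ; try by apply: itg_sum => k; [exact: iI || exact: iIG].
    rewrite !Ex_sum; try by move=> k; [exact: iI || exact: iIG].
    by rewrite -mulrA mulr_suml; congr (_ * _); apply: eq_bigr => k _; exact: HB.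
  have -> : Ex (fun w => f (X w) * G w) - Ex (fun w => f (X w)) * C =
      Ex (fun w => (f (X w) - layer n (f (X w))) * G w) -
      Ex (fun w => f (X w) - layer n (f (X w))) * C.
    rewrite ExB// mulrBl -E1.
    rewrite (_ : (fun w => (_ - _) * G w) = fun w => f (X w) * G w - layer n (f (X w)) * G w).
      by rewrite ExB//; ring.
    by apply/funext => w; rewrite mulrBl.
  rewrite (le_trans (ler_normB _ _))// mulrDl lerD//.
    apply: Ex_bounded.
      by apply: measurable_funM => //; exact: measurable_funB.
    by move=> w; rewrite normrM mulrC ler_pM.
  rewrite normrM mulrC ler_wpM2l//; apply: Ex_bounded => //.
  exact: measurable_funB.
move=> f B mf fB.
have B0 : 0 < B + 1 by rewrite ltr_wpDl// (le_trans _ (fB point)).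
pose g s := (2 * (B + 1))^-1 * (f s + (B + 1)).
have mg : measurable_fun setT g.
  by apply: measurable_funM => //; exact: measurable_funD.
have g01 s : 0 <= g s <= 1.
  have := fB s; rewrite ler_norml => /andP[f1 f2].
  rewrite /g mulrC; apply/andP; split.
    by rewrite divr_ge0// ?mulr_ge0 ?ltW//; lra.
  by rewrite ler_pdivrMr ?mulr_gt0//; lra.
have Hg := H01 g mg g01.
have H1 := H01 (fun=> 1) (measurable_cst _) ltac:(by move=> s; rewrite ler01 lexx).
have mfX : measurable_fun setT (fun w => f (X w)) by exact: measurableT_comp mX.
have mgX : measurable_fun setT (fun w => g (X w)) by exact: measurableT_comp mX.
have iG : itg G by exact: itg_bounded GM.
have bg w : `|g (X w)| <= 1.
  by have /andP[? ?] := g01 (X w); rewrite ger0_norm.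
have ig : itg (fun w => g (X w)) := itg_bounded P mgX bg.
have igG : itg (fun w => g (X w) * G w).
  apply: (@itg_bounded _ _ _ _ _ M); first exact: measurable_funM.
  by move=> w; rewrite normrM -[leRHS]mul1r ler_pM.
have fE s : f s = 2 * (B + 1) * g s - (B + 1).
  by rewrite /g; field; rewrite gt_eqF.
have -> : (fun w => f (X w) * G w) =
    fun w => (2 * (B + 1)) * (g (X w) * G w) - (B + 1) * G w.
  by apply/funext => w; rewrite fE; ring.
have -> : (fun w => f (X w)) = fun w => 2 * (B + 1) * g (X w) - (B + 1).
  by apply/funext => w; rewrite fE.
rewrite !ExB; try (by apply: itgZ); try exact: itg_cst.
rewrite (ExZ _ igG) (ExZ _ ig) (ExZ _ iG) Hg Ex_cst.
(* The case f = 1 identifies [C], which settles the additive constant of the affine change. *)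
have -> : Ex G = C.
  move: H1; rewrite Ex_cst mul1r => <-.
  by congr Ex; apply/funext => w; rewrite mul1r.
by ring.
Qed.

End LayerLinear.

Section IndependentProducts.
Context {d : measure_display} {W : measurableType d} {R : realType}.
Variables (P : probability W R) (eta : nat -> {RV P >-> R}).
Local Notation Ex := (Ex P).
Hypothesis indep : forall (s : seq nat) (B : nat -> set R), uniq s ->
  (forall t, measurable (B t)) ->
  P (\bigcap_(t in [set` s]) (eta t @^-1` B t)) =
  (\prod_(t <- s) P (eta t @^-1` B t))%E.

Lemma prod_indic (s : seq nat) (B : nat -> set R) w :
  \prod_(k <- s) \1_(B k) (eta k w) =
  \1_(\bigcap_(t in [set` s]) (eta t @^-1` B t)) w :> R.
Proof.
rewrite [RHS]indicE; elim: s => [|k s IHs].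
  by rewrite big_nil mem_set.
rewrite big_cons {}IHs indicE -natrM mulnb; congr (nat_of_bool _)%:R.
apply/idP/idP => [/andP[/set_mem Bk /set_mem Bs]|/set_mem Bs].
  apply/mem_set => t /=; rewrite inE => /predU1P[->//|ts]; exact: Bs.
apply/andP; split; apply/mem_set.
  by apply: Bs => /=; rewrite mem_head.
by move=> t ts; apply: Bs; rewrite /= inE ts orbT.
Qed.

Lemma prod_normr_le1 (s : seq nat) (f : nat -> R) :
  (forall k, `|f k| <= 1) -> `|\prod_(k <- s) f k| <= 1.
Proof.
move=> f1; elim: s => [|k s IHs]; first by rewrite big_nil normr1.
by rewrite big_cons normrM -[leRHS]mul1r ler_pM.
Qed.

Lemma Ex_prod_indep (s : seq nat) (f : nat -> R -> R) : uniq s ->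
  (forall k, measurable_fun setT (f k)) -> (forall k u, `|f k u| <= 1) ->
  Ex (fun w => \prod_(k <- s) f k (eta k w)) =
  \prod_(k <- s) Ex (fun w => f k (eta k w)).
Proof.
move=> us mf f1.
have mfk k : measurable_fun setT (fun w => f k (eta k w)).
  exact: measurableT_comp.
have mi (A : set R) k : measurable A -> measurable_fun setT (fun w => \1_A (eta k w) : R).
  by move=> mA; apply: measurableT_comp => //; exact: measurable_indic.
have i1 (A : set R) u : `|\1_A u| <= 1 :> R.
  by rewrite indicE ger0_norm// lern1 leq_b1.
(* Factors pass one at a time from indicators (on [s2]) to functions (on [s1]). With [s1] empty this
   is the independence hypothesis. *)
suff H s1 s2 (B : nat -> set R) : uniq (s1 ++ s2) -> (forall k, measurable (B k)) ->
    Ex (fun w => \prod_(k <- s1) f k (eta k w) * \prod_(k <- s2) \1_(B k) (eta k w)) =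
    \prod_(k <- s1) Ex (fun w => f k (eta k w)) *
    \prod_(k <- s2) Ex (fun w => \1_(B k) (eta k w)).
  have := H s [::] (fun=> setT) ltac:(by rewrite cats0) (fun=> measurableT).
  rewrite big_nil mulr1 => <-; congr Ex; apply/funext => w.
  by rewrite big_nil mulr1.
elim: s1 s2 B => [|k s1 IHs] s2 B us12 mB.
  rewrite big_nil mul1r.
  have -> : (fun w => \prod_(k <- [::]) f k (eta k w) * \prod_(k <- s2) \1_(B k) (eta k w)) =
      \1_(\bigcap_(t in [set` s2]) (eta t @^-1` B t)) :> (W -> R).
    by apply/funext => w; rewrite big_nil mul1r prod_indic.
  have mE t : measurable (eta t @^-1` B t).
    by rewrite -[X in measurable X]setTI; exact: measurable_funPT.
  rewrite Ex_indic; last first.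
    by apply: fin_bigcap_measurable => //; exact: finite_seq.
  rewrite indep//; elim: s2 {us12} => [|t s2 IH2]; first by rewrite !big_nil.
  rewrite !big_cons -IH2 fineM ?fin_num_measure//; last first.
    elim/big_ind : _ => //; first by move=> ? ? ? ?; exact: fin_numM.
    by move=> ? _; exact: fin_num_measure.
  by congr (_ * _); rewrite -Ex_indic//; congr Ex; apply/funext => w.
have /= /andP[ks us'] := us12.
rewrite big_cons -mulrA.
have -> : (fun w => \prod_(j <- k :: s1) f j (eta j w) * \prod_(j <- s2) \1_(B j) (eta j w)) =
    fun w => f k (eta k w) *
      (\prod_(j <- s1) f j (eta j w) * \prod_(j <- s2) \1_(B j) (eta j w)).
  by apply/funext => w; rewrite big_cons mulrA.
apply: (@Ex_mul_ind _ _ _ _ _ _ (eta k) _ 1 _ _ _ _ _ (f k) 1) => //.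
- by apply: measurable_funM; apply: measurable_prod => j _//; exact: mi.
- by move=> w; rewrite normrM -[leRHS]mul1r ler_pM// prod_normr_le1.
(* The induction hypothesis with [k] moved to the indicator side, carrying the set [A], is the
   product rule for indicators that [Ex_mul_ind] requires. *)
move=> A mA; pose B' j := if j == k then A else B j.
have /IHs : uniq (s1 ++ k :: s2).
  by rewrite -cat1s uniq_catCA/= ks.
move=> /(_ B' ltac:(by move=> j; rewrite /B'; case: ifP)).
have B'k : B' k = A by rewrite /B' eqxx.
rewrite !big_cons B'k.
have ns2 j : j \in s2 -> (j == k) = false.
  by move=> js; apply/negbTE; apply: contraNneq ks => <-; rewrite mem_cat js orbT.
have -> : \prod_(j <- s2) Ex (fun w => \1_(B' j) (eta j w)) =
    \prod_(j <- s2) Ex (fun w => \1_(B j) (eta j w)).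
  by apply: eq_big_seq => j js; rewrite /B' ns2.
move=> E; rewrite mulrCA -E; congr Ex; apply/funext => w.
rewrite big_cons mulrCA B'k; congr (_ * (_ * _)).
by apply: eq_big_seq => j js; rewrite /B' ns2.
Qed.

End IndependentProducts.

(** * The Gaussian characteristic function *)

Section NormalCharacteristicFunction.
Context {R : realType}.
Notation mu := (@lebesgue_measure R).

(** Change of variables holds for the Radon-Nikodym derivative, which agrees with the density almost
    everywhere because both integrate to the same measure. *)
Lemma integral_normal_prob (m s : R) (f : R -> R) (B : R) :
  measurable_fun setT f -> (forall u, `|f u| <= B) ->
  (\int[normal_prob m s]_u (f u)%:E =
   \int[mu]_u ((f u)%:E * (normal_pdf m s u)%:E))%E.
Proof.
move=> mf fB.
have dom := normal_prob_dominates m s.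
have ipdf := integrable_normal_pdf m s.
rewrite -(Radon_Nikodym_change_of_variables dom) //=; last first.
  apply: (le_integrable _ _ _ (finite_measure_integrable_cst _ B measurableT)) => //.
    exact/measurable_EFinP.
  by move=> u _ /=; rewrite lee_fin (le_trans (fB u))// ler_norm.
apply: ae_eq_integral => //.
- apply: emeasurable_funM; first exact/measurable_EFinP.
  by apply: (measurable_int mu); exact: Radon_Nikodym_integrable.
- apply/measurable_EFinP/measurable_funM => //; exact: measurable_normal_pdf.
apply: ae_eqe_mul2l.
rewrite Radon_NikodymE /=; case: cid => /= h [h1 ih hE].
apply: integral_ae_eq => //.
  exact: (measurable_int mu ipdf).
by move=> E _ mE; rewrite -hE.
Qed.

Variable s : R.
Hypothesis s0 : 0 < s.
Let g := normal_pdf 0 s.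
Let c := normal_peak s.

Let gE x : g x = c * expR (- x ^+ 2 / (2 * s ^+ 2)).
Proof.
rewrite /g normal_pdfE ?gt_eqF// /normal_fun subr0 -/c.
by rewrite -mulr_natl.
Qed.

Let mg : measurable_fun setT g := measurable_normal_pdf 0 s.
Let ig : mu.-integrable setT (EFin \o g) := integrable_normal_pdf 0 s.
Let g0 x : 0 <= g x := normal_pdf_ge0 0 s x.

(** Half of the Gaussian exponent absorbs |x|: with t = x^2 / (4 s^2), |x| <= s (1 + t) <= s exp t.
    What remains is a Gaussian of variance 2 s^2 = r^2, up to normalisation. *)
Let ixg : mu.-integrable setT (fun x => (`|x| * g x)%:E).
Proof.
pose r := Num.sqrt 2 * s.
have r0 : 0 < r by rewrite mulr_gt0// sqrtr_gt0.
have r2 : r ^+ 2 = 2 * s ^+ 2 by rewrite exprMn sqr_sqrtr.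
have C0 : 0 < normal_peak r by rewrite normal_peak_gt0// gt_eqF.
have iC := integrableZl (measurableT) (s * c / normal_peak r) (integrable_normal_pdf 0 r).
apply: le_integrable iC => //.
  apply/measurable_EFinP/measurable_funM => //; exact: measurable_normr.
move=> x _ /=; rewrite lee_fin normrM normr_id [`|g x|]ger0_norm//.
rewrite [leRHS]ger0_norm; last first.
  by rewrite !mulr_ge0 ?normal_pdf_ge0 ?invr_ge0 ?normal_peak_ge0 ?(ltW s0).
rewrite normal_pdfE ?gt_eqF// gE /normal_fun subr0.
have -> : s * c / normal_peak r * (normal_peak r * expR (- x ^+ 2 / (r ^+ 2 *+ 2))) =
   c * (s * expR (- x ^+ 2 / (r ^+ 2 *+ 2))) by field; rewrite gt_eqF.
rewrite mulrCA ler_wpM2l ?normal_peak_ge0//.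
pose t := x ^+ 2 / (r ^+ 2 *+ 2).
have -> : expR (- x ^+ 2 / (2 * s ^+ 2)) = expR (- t) * expR (- t).
  rewrite -expRD; congr expR; rewrite /t r2 -mulr_natl; field.
  by rewrite gt_eqF.
have -> : expR (- x ^+ 2 / (r ^+ 2 *+ 2)) = expR (- t) by rewrite /t mulNr.
rewrite mulrA ler_wpM2r ?expR_ge0// expRN ler_pdivrMr ?expR_gt0//.
apply: (@le_trans _ _ (s * (1 + t))); last by rewrite ler_wpM2l ?expR_ge1Dx// ltW.
rewrite /t r2 -[x ^+ 2]real_normK ?num_real// -subr_ge0.
have -> : s * (1 + `|x| ^+ 2 / (2 * s ^+ 2 *+ 2)) - `|x| =
   s^-1 * (2^-1 * `|x| - s) ^+ 2.
  by rewrite -mulr_natl; field; rewrite gt_eqF.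
by rewrite mulr_ge0 ?sqr_ge0// invr_ge0 ltW.
Qed.

Variable b : R.
(** The phase [b] lets one real family carry both cosine and sine moments, in place of a complex
    characteristic function. *)
Let F t := \int[mu]_x (cos (t * x + b) * g x).

Let meas_cos t : measurable_fun setT (fun x : R => cos (t * x + b)).
Proof.
apply: continuous_measurable_fun => x; apply: continuous_comp.
  apply: cvgD; last exact: cvg_cst.
  by apply: cvgM; [exact: cvg_cst|exact: cvg_id].
exact: continuous_cos.
Qed.

Let meas_sin t : measurable_fun setT (fun x : R => sin (t * x + b)).
Proof.
apply: continuous_measurable_fun => x; apply: continuous_comp.
  apply: cvgD; last exact: cvg_cst.
  by apply: cvgM; [exact: cvg_cst|exact: cvg_id].
exact: continuous_sin.
Qed.

Let int_bnd (h : R -> R) : measurable_fun setT h -> (forall x, `|h x| <= 1) ->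
  mu.-integrable setT (fun x => (h x * g x)%:E).
Proof.
move=> mh h1; apply: le_integrable ig => //.
  by apply/measurable_EFinP/measurable_funM.
by move=> x _ /=; rewrite lee_fin normrM ler_piMl.
Qed.

Let int_xbnd (h : R -> R) : measurable_fun setT h -> (forall x, `|h x| <= 1) ->
  mu.-integrable setT (fun x => (x * h x * g x)%:E).
Proof.
move=> mh h1; apply: le_integrable ixg => //.
  apply/measurable_EFinP/measurable_funM => //; exact: measurable_funM.
move=> x _ /=; rewrite lee_fin !normrM normr_id ler_wpM2r//.
by rewrite ler_piMr.
Qed.


Let dlin (x t : R) : is_derive t 1 (fun t => t * x + b) x.
Proof. by apply: trigger_derive; rewrite addr0 scaler0 add0r /GRing.scale/= mulr1. Qed.

Let d1 (x t : R) : is_derive t 1 (fun t => cos (t * x + b) * g x)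
  (- (x * sin (t * x + b) * g x)).
Proof.
have dc : is_derive t 1 (fun t => cos (t * x + b)) (- sin (t * x + b) * x).
  exact: (@is_derive1_comp R cos (fun t => t * x + b)).
have -> : - (x * sin (t * x + b) * g x) = - sin (t * x + b) * x * g x by ring.
have -> : (fun t => cos (t * x + b) * g x) = g x \*: (fun t => cos (t * x + b)).
  by apply/funext => u; rewrite mulrC.
by apply: trigger_derive; rewrite /GRing.scale/= mulrC.
Qed.

Let dF (t : R) : is_derive t 1 F (- \int[mu]_x (x * sin (t * x + b) * g x)).
Proof.
have It : `]t - 1, t + 1[%classic t by rewrite /= in_itv/= ltrBlDr ltrDl ltr01.
pose f t x := cos (t * x + b) * g x.
have p1 u x : partial1of2 f u x = - (x * sin (u * x + b) * g x).
  rewrite /partial1of2 derive1E /f; have h := d1 x u; exact: derive_val.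
have intf u : `]t - 1, t + 1[%classic u -> mu.-integrable setT (EFin \o f u).
  by move=> _; apply: int_bnd => // x; exact: cos_max.
have df u x : `]t - 1, t + 1[%classic u -> setT x -> derivable (f ^~ x) u 1.
  by move=> _ _; have h := d1 x u; exact: ex_derive.
have ub u x : `]t - 1, t + 1[%classic u -> setT x -> `|partial1of2 f u x| <= `|x| * g x.
  move=> _ _; rewrite p1 normrN !normrM (ger0_norm (g0 x)) ler_wpM2r//.
  by rewrite ler_piMr// sin_max.
have G0 (x : R) : 0 <= `|x| * g x by rewrite mulr_ge0.
have D := derivable_under_integral measurableT It intf df G0 ixg ub.
have E := differentiation_under_integral measurableT It intf df G0 ixg ub.
apply: DeriveDef => //.
rewrite -derive1E E.
transitivity (\int[mu]_x ((-1) * (x * sin (t * x + b) * g x))).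
  by apply: eq_Rintegral => x _; rewrite /= p1 mulN1r.
rewrite RintegralZl//; first by rewrite mulN1r.
by apply: int_xbnd => // x; exact: sin_max.
Qed.

(** An antiderivative of [k t], by g' = - (x / s^2) g. Integrating [k t] over the line is thus
    Gaussian integration by parts for sin (t x + b). *)
Let H t x := - s ^+ 2 * (g x * sin (t * x + b)).
Let k t x := x * sin (t * x + b) * g x - s ^+ 2 * t * (cos (t * x + b) * g x).

Let ik t : mu.-integrable setT (EFin \o k t).
Proof.
have i1 := int_xbnd (meas_sin t) (fun x => sin_max (t * x + b)).
have i2 := int_bnd (meas_cos t) (fun x => cos_max (t * x + b)).
exact: (integrableB _ i1 (integrableZl measurableT (s ^+ 2 * t) i2)).
Qed.

Let dH t (x : R) : is_derive x 1 (H t) (k t x).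
Proof.
have dg : is_derive x 1 g (- x / s ^+ 2 * g x).
  have -> : (g : R -> R) = c \*: (fun x => expR (- x ^+ 2 / (2 * s ^+ 2))).
    by apply/funext => u; rewrite /= gE.
  have dq : is_derive x 1 (fun x : R => - x ^+ 2 / (2 * s ^+ 2)) (- x / s ^+ 2).
    apply: trigger_derive; rewrite /GRing.scale/=; field; rewrite gt_eqF//.
  have de := is_derive1_comp (f := expR) (is_derive_expR _) dq.
  by apply: trigger_derive; rewrite /= /GRing.scale/=; ring.
have dl : is_derive x 1 (fun x => t * x + b) t.
  by apply: trigger_derive; rewrite /GRing.scale/=; ring.
have ds := is_derive1_comp (f := sin) (is_derive_sin _) dl.
apply: trigger_derive; rewrite /k /GRing.scale/=; field; rewrite gt_eqF//.
Qed.

Let ibp_itv t n : \int[mu]_(x in `[- n.+1%:R, n.+1%:R]) k t x =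
  H t n.+1%:R - H t (- n.+1%:R).
Proof.
have nn : - n.+1%:R < n.+1%:R :> R by rewrite gtrN.
have cH : continuous (H t).
  move=> x; apply: differentiable_continuous; apply/derivable1_diffP.
  by have h := dH t x; exact: ex_derive.
have ck : continuous (k t).
  move=> x; rewrite /k.
  have cg : {for x, continuous g} by exact: continuous_normal_pdf (lt0r_neq0 s0) x.
  have cl : {for x, continuous (fun x => t * x + b)}.
    apply: cvgD; last exact: cvg_cst.
    by apply: cvgM; [exact: cvg_cst|exact: cvg_id].
  apply: cvgB; [apply: cvgM => //; apply: cvgM; first exact: cvg_id|
                apply: cvgM; [exact: cvg_cst|apply: cvgM => //]].
    by apply: (continuous_comp cl); exact: continuous_sin.
  by apply: (continuous_comp cl); exact: continuous_cos.
rewrite /Rintegral (continuous_FTC2 (F := H t) nn)//.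
- exact: continuous_subspaceT.
- split.
  + by move=> x _; have h := dH t x; exact: ex_derive.
  + by apply: cvg_at_right_filter; exact: cH.
  + by apply: cvg_at_left_filter; exact: cH.
- by move=> x _; rewrite derive1E; have h := dH t x; exact: derive_val.
Qed.

(** From exp(-y) <= 1 / y with y = u^2 / (2 s^2): each boundary value is at most 2 s^4 c / (n +
    1)^2, hence at most 2 s^4 c / (n + 1). *)
Let H_small t n : `|H t n.+1%:R - H t (- n.+1%:R)| <= 4 * s ^+ 4 * c * n.+1%:R^-1.
Proof.
have n0 : 0 < n.+1%:R :> R by rewrite ltr0n.
have c0 : 0 <= c := normal_peak_ge0 s.
suff Hb (u : R) : u ^+ 2 = n.+1%:R ^+ 2 -> `|H t u| <= 2 * s ^+ 4 * c * n.+1%:R^-1.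
  rewrite (le_trans (ler_normB _ _))//.
  have -> : 4 * s ^+ 4 * c * n.+1%:R^-1 = 2 * s ^+ 4 * c * n.+1%:R^-1 +
    2 * s ^+ 4 * c * n.+1%:R^-1 by ring.
  by apply: lerD; apply: Hb => //; rewrite sqrrN.
move=> u2; rewrite /H normrM normrN (ger0_norm (sqr_ge0 _)) normrM (ger0_norm (g0 _)).
have -> : 2 * s ^+ 4 * c * n.+1%:R^-1 = s ^+ 2 * (2 * s ^+ 2 * c * n.+1%:R^-1) by ring.
rewrite ler_wpM2l ?sqr_ge0//.
apply: (@le_trans _ _ (g u)); first by rewrite ler_piMr// sin_max.
rewrite gE u2 -[leRHS]mulrA [leRHS]mulrCA ler_wpM2l// mulNr expRN.
rewrite -[leRHS]invrK lef_pV2 ?posrE ?expR_gt0 ?invr_gt0 ?mulr_gt0 ?invr_gt0 ?exprn_gt0//.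
apply: le_trans (expR_ge1Dx _).
rewrite [leLHS]invfM invrK mulrC.
apply: (@le_trans _ _ (n.+1%:R ^+ 2 / (2 * s ^+ 2))); last by rewrite lerDr.
rewrite ler_wpM2r ?invr_ge0 ?mulr_ge0 ?(ltW s0)//.
by rewrite expr2 ler_peMr ?ler1n// ltW.
Qed.

Let ibp t : \int[mu]_x (x * sin (t * x + b) * g x) = s ^+ 2 * t * F t.
Proof.
have i1 := int_xbnd (meas_sin t) (fun x => sin_max (t * x + b)).
have i2 := int_bnd (meas_cos t) (fun x => cos_max (t * x + b)).
apply/eqP; rewrite -subr_eq0 /F -RintegralZl// -RintegralB//; last first.
  exact: (integrableZl measurableT (s ^+ 2 * t) i2).
pose A n := `[- n.+1%:R, n.+1%:R]%classic : set R.
have mk : measurable_fun setT (k t) by case/integrableP : (ik t) => /measurable_EFinP.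
have mA n : measurable (A n) by exact: measurable_itv.
have [|||||_ _ C] := @dominated_convergence _ _ _ mu setT measurableT
   (fun n x => ((k t \_ (A n)) x)%:E) (fun x => (k t x)%:E) (fun x => `|k t x|%:E).
- move=> n; apply/measurable_EFinP; apply/(measurable_restrictT _ (mA n)).
  exact: measurable_funS mk.
- exact/measurable_EFinP.
- apply: aeW => x _; apply: cvg_near_cst.
  near=> n; rewrite patchE mem_set//; rewrite /A /= in_itv/= -ler_norml.
  rewrite (le_trans (ltW (truncnS_gt _)))// ler_nat ltnS.
  near: n; exact: nbhs_infty_ge.
- exact: (integrable_abse (ik t)).
- apply: aeW => x n _; rewrite /= lee_fin patchE; case: ifP => // _.
  by rewrite normr0.
have C' : H t n.+1%:R - H t (- n.+1%:R) @[n --> \oo] --> \int[mu]_x k t x.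
  have -> : (fun n => H t n.+1%:R - H t (- n.+1%:R)) =
      fun n => \int[mu]_x ((k t \_ (A n)) x).
    by apply/funext => n; rewrite -ibp_itv Rintegral_mkcond.
  apply: (@fine_cvg _ _ _ _ _ (\int[mu]_x k t x)).
  have -> : ((\int[mu]_x k t x)%R%:E = \int[mu]_x (k t x)%:E)%E.
    by rewrite /Rintegral fineK//; exact: integrable_fin_num (ik t).
  exact: C.
have Z : H t n.+1%:R - H t (- n.+1%:R) @[n --> \oo] --> (0 : R).
  apply: norm_cvg0.
  apply: (@squeeze_cvgr _ _ _ _ (cst 0) (fun n => 4 * s ^+ 4 * c * n.+1%:R^-1)).
  - by apply: nearW => n; rewrite normr_ge0 H_small.
  - exact: cvg_cst.
  - by rewrite -[X in _ --> X](mulr0 (4 * s ^+ 4 * c)); apply: cvgMr; exact: cvg_harmonic.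
by apply/eqP; rewrite -(cvg_unique _ C' Z).
Unshelve. all: end_near. Qed.

(** [ibp] turns [dF] into the differential equation F' = - s^2 t F, so F times exp(s^2 t^2 / 2) is
    constant. *)
Lemma normal_cf_lebesgue t : F t = cos b * expR (- (s * t) ^+ 2 / 2).
Proof.
have F0 : F 0 = cos b.
  transitivity (\int[mu]_x (cos b * g x)).
    by apply: eq_Rintegral => x _; rewrite mul0r add0r.
  by rewrite RintegralZl// /Rintegral integral_normal_pdf mulr1.
pose G t := F t * expR (t ^+ 2 * (s ^+ 2 / 2)).
have dG (u : R) : is_derive u 1 G 0.
  have h := dF u; rewrite ibp in h.
  apply: trigger_derive.
  by rewrite /GRing.scale/=; field.
have := is_derive_0_is_cst t 0 dG.
rewrite /G F0 expr0n/= mul0r expR0 mulr1 => <-.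
rewrite -mulrA -expRD -[LHS]mulr1; congr (_ * _).
by rewrite -[LHS]expR0; congr expR; field.
Qed.

End NormalCharacteristicFunction.

Section NormalVariables.
Context {d : measure_display} {W : measurableType d} {R : realType}.
Variable P : probability W R.

Lemma Ex_cos_normal (X : W -> R) (s t b : R) : measurable_fun setT X -> 0 < s ->
  (forall B, measurable B -> P [set w | B (X w)] = normal_prob 0 s B) ->
  Ex P (fun w => cos (t * X w + b)) = cos b * expR (- (s * t) ^+ 2 / 2).
Proof.
move=> mX s0 XN; rewrite -(normal_cf_lebesgue s0).
have mc : measurable_fun setT (fun x : R => cos (t * x + b)).
  apply: continuous_measurable_fun => x; apply: continuous_comp.
    apply: cvgD; last exact: cvg_cst.
    by apply: cvgM; [exact: cvg_cst|exact: cvg_id].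
  exact: continuous_cos.
have ic : itg P (fun w => cos (t * X w + b)).
  apply: (@itg_bounded _ _ _ _ _ 1); last by move=> w; exact: cos_max.
  by apply: (measurableT_comp mc).
congr fine.
pose Xm := isMeasurableFun.Build _ _ W (measurableTypeR R) X mX.
pose X' : {mfun W >-> measurableTypeR R} := MeasurableFun.Pack (MeasurableFun.Class Xm).
have mc' : measurable_fun [set: measurableTypeR R] (fun x => (cos (t * x + b))%:E).
  exact/measurable_EFinP.
have -> : (\int[P]_w (cos (t * X w + b))%:E =
    \int[distribution P X']_x (cos (t * x + b))%:E)%E.
  by rewrite integral_distribution.
transitivity (\int[normal_prob 0 s]_x (cos (t * x + b))%:E)%E.
  by apply: eq_measure_integral => A mA _; exact: (XN A mA).
by rewrite (@integral_normal_prob _ _ _ _ 1)// => x; exact: cos_max.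
Qed.

End NormalVariables.

(** * Cosine moments of sums of multipliers *)

Section NormalSums.
Context {d : measure_display} {W : measurableType d} {R : realType}.
Variables (P : probability W R) (eta : nat -> {RV P >-> R}).
Hypothesis eta_iid : iid_std_normal eta.
Local Notation Ex_of := Ex.
Local Notation Ex := (Ex P).

Lemma measurable_cos (f : W -> R) : measurable_fun setT f ->
  measurable_fun setT (fun w => cos (f w)).
Proof.
apply: (measurableT_comp (f := cos)).
by apply: continuous_measurable_fun; exact: continuous_cos.
Qed.

Lemma Ex_cos_eta k (t b : R) :
  Ex (fun w => cos (t * eta k w + b)) = cos b * expR (- t ^+ 2 / 2).
Proof.
case: eta_iid => law _.
by rewrite (Ex_cos_normal _ _ _ ltr01) ?mul1r// => B mB; exact: (law k B mB).
Qed.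

Lemma Ex_sin_eta k (t : R) : Ex (fun w => sin (t * eta k w)) = 0.
Proof.
rewrite (_ : (fun w => _) = fun w => cos (t * eta k w + - (pi / 2))).
  by rewrite Ex_cos_eta cosN cos_pihalf mul0r.
by apply/funext => w; rewrite cosD cosN sinN cos_pihalf sin_pihalf; ring.
Qed.

Lemma Ex_cos_sum_eta (s : seq nat) (a : nat -> R) (b : R) : uniq s ->
  Ex (fun w => cos (\sum_(k <- s) a k * eta k w + b)) =
  cos b * expR (- (\sum_(k <- s) a k ^+ 2) / 2).
Proof.
move=> us; have [_ indep] := eta_iid.
(* The addition formula detaches a factor in [eta k], which joins the product over [r]; hence the
   induction carries such a product and an arbitrary phase. The cosine factor contributes exp(-
   a_k^2 / 2). The sine factor has mean zero, and its companion - sin(S + b) is again a cosine, with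
   phase b + pi / 2. *)
suff H r (f : nat -> R -> R) : uniq (r ++ s) ->
    (forall k, measurable_fun setT (f k)) -> (forall k u, `|f k u| <= 1) ->
    Ex (fun w => \prod_(k <- r) f k (eta k w) *
                 cos (\sum_(k <- s) a k * eta k w + b)) =
    \prod_(k <- r) Ex (fun w => f k (eta k w)) *
      (cos b * expR (- (\sum_(k <- s) a k ^+ 2) / 2)).
  have := H [::] (fun _ _ => 1) us (fun=> measurable_cst _)
    ltac:(by move=> *; rewrite normr1).
  rewrite !big_nil mul1r => <-; congr (Ex_of _ _); apply/funext => w.
  by rewrite mul1r.
elim: s b r f {us} => [|k s IHs] b r f urs mf f1.
  rewrite big_nil oppr0 mul0r expR0 mulr1 cats0 in urs *.
  rewrite -(Ex_prod_indep (eta := eta))// [RHS]mulrC -ExZ; last first.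
    apply: (@itg_bounded _ _ _ _ _ 1); last by move=> w; exact: prod_normr_le1.
    by apply: measurable_prod => j _; exact: measurableT_comp.
  by congr (Ex_of _ _); apply/funext => w; rewrite big_nil add0r mulrC.
have /andP[kr urs'] : uniq (k :: r ++ s) by move: urs; rewrite -cat1s uniq_catCA.
have urs2 : uniq ((k :: r) ++ s) by rewrite /= kr.
have krN j : j \in r -> (j == k) = false.
  by move=> jr; apply/negbTE; apply: contraNneq kr => <-; rewrite mem_cat jr.
pose g (h : R -> R) j := if j == k then (fun u => h (a k * u)) else f j.
have mg h : measurable_fun setT h -> forall j, measurable_fun setT (g h j).
  move=> mh j; rewrite /g; case: ifP => // _.
  by apply: (measurableT_comp mh); exact: measurable_funM.
have g1 h : (forall u, `|h u| <= 1) -> forall j u, `|g h j u| <= 1.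
  by move=> h1 j u; rewrite /g; case: ifP.
have mcos : measurable_fun setT (@cos R).
  by apply: continuous_measurable_fun; exact: continuous_cos.
have msin : measurable_fun setT (@sin R).
  by apply: continuous_measurable_fun; exact: continuous_sin.
have Ec := IHs b (k :: r) (g cos) urs2 (mg _ mcos) (g1 _ (@cos_max R)).
have Es := IHs (b + pi / 2) (k :: r) (g sin) urs2 (mg _ msin) (g1 _ (@sin_max R)).
have prodg h w : \prod_(j <- k :: r) g h j (eta j w) =
    h (a k * eta k w) * \prod_(j <- r) f j (eta j w).
  rewrite big_cons {1}/g eqxx; congr (_ * _).
  by apply: eq_big_seq => j jr; rewrite /g krN.
have Exg h : \prod_(j <- k :: r) Ex (fun w => g h j (eta j w)) =
    Ex (fun w => h (a k * eta k w)) * \prod_(j <- r) Ex (fun w => f j (eta j w)).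
  rewrite big_cons {1}/g eqxx; congr (_ * _).
  by apply: eq_big_seq => j jr; rewrite /g krN.
rewrite Exg Ex_sin_eta !mul0r in Es.
have Ecos : Ex (fun w => cos (a k * eta k w)) = expR (- a k ^+ 2 / 2).
  rewrite (_ : (fun w => _) = fun w => cos (a k * eta k w + 0)).
    by rewrite Ex_cos_eta cos0 mul1r.
  by apply/funext => w; rewrite addr0.
rewrite Exg Ecos in Ec.
have mS : measurable_fun setT (fun w => \sum_(j <- s) a j * eta j w).
  by apply: measurable_sum => j; exact: measurable_funM.
have ig (h : R -> R) c : measurable_fun setT h -> (forall u, `|h u| <= 1) ->
    itg P (fun w => \prod_(j <- k :: r) g h j (eta j w) *
      cos (\sum_(j <- s) a j * eta j w + c)).
  move=> mh h1; apply: (@itg_bounded _ _ _ _ _ 1).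
    apply: measurable_funM; last exact/measurable_cos/measurable_funD.
    by apply: measurable_prod => j _; apply: measurableT_comp => //; exact: mg.
  move=> w; rewrite normrM -[leRHS]mul1r ler_pM// ?cos_max//.
  by apply: prod_normr_le1 => j; exact: g1.
have -> : (fun w => \prod_(j <- r) f j (eta j w) *
      cos (\sum_(j <- k :: s) a j * eta j w + b)) =
    fun w => \prod_(j <- k :: r) g cos j (eta j w) *
        cos (\sum_(j <- s) a j * eta j w + b) +
      \prod_(j <- k :: r) g sin j (eta j w) *
        cos (\sum_(j <- s) a j * eta j w + (b + pi / 2)).
  apply/funext => w; rewrite !prodg [in LHS]big_cons -addrA cosD.
  set S := \sum_(j <- s) _.
  have -> : cos (S + (b + pi / 2)) = - sin (S + b).
    by rewrite addrA [LHS]cosD cos_pihalf sin_pihalf; ring.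
  by ring.
rewrite ExD; [|exact: ig mcos (@cos_max R)|exact: ig msin (@sin_max R)].
rewrite Ec Es addr0 big_cons opprD mulrDl expRD; ring.
Qed.

End NormalSums.

(** * Orthant probabilities and linear forms *)

Section BoundedConvergence.
Context {d : measure_display} {W : measurableType d} {R : realType}.
Variable P : probability W R.

Lemma Ex_cvg (f : nat -> W -> R) (g : W -> R) (B : R) :
  (forall n, measurable_fun setT (f n)) -> measurable_fun setT g ->
  (forall n w, `|f n w| <= B) ->
  (forall w, f n w @[n --> \oo] --> g w) ->
  Ex P (f n) @[n --> \oo] --> Ex P g.
Proof.
move=> mf mg fB fg.
have iB := itg_cst P B.
have [|||||ig _ C] := @dominated_convergence _ _ _ P setT measurableT
   (fun n w => (f n w)%:E) (fun w => (g w)%:E) (fun w => B%:E).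
- by move=> n; exact/measurable_EFinP.
- exact/measurable_EFinP.
- by apply: aeW => w _; apply/cvg_EFin => //; [exact: nearW|exact: fg].
- exact: iB.
- by apply: aeW => w n _; rewrite /= lee_fin.
apply: (@fine_cvg _ _ _ _ _ (Ex P g)).
by rewrite -(EFin_Ex ig); exact: C.
Qed.

End BoundedConvergence.

Section StepApproximation.
Context {R : realType}.

(* tends to the indicator function of [1/2, 1] on [0, 1] *)
Definition step_poly (n : nat) (u : R) : R := 1 - (1 - u ^+ n) ^+ (n * 2 ^ n).

Lemma step_poly_01 n (u : R) : 0 <= u <= 1 -> 0 <= step_poly n u <= 1.
Proof.
move=> /andP[u0 u1]; have un0 : 0 <= u ^+ n by rewrite exprn_ge0.
have un1 : u ^+ n <= 1 by rewrite exprn_ile1.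
have v0 : 0 <= 1 - u ^+ n by rewrite subr_ge0.
rewrite /step_poly subr_ge0 exprn_ile1 ?lerBlDr ?lerDl//=.
by rewrite exprn_ge0.
Qed.

Lemma bernoulli_ineq (y : R) m : 0 <= y <= 1 -> 1 - m%:R * y <= (1 - y) ^+ m.
Proof.
move=> /andP[y0 y1]; elim: m => [|m IHm]; first by rewrite mul0r subr0 expr0.
have v0 : 0 <= 1 - y by rewrite subr_ge0.
rewrite exprS; apply: le_trans (ler_wpM2l v0 IHm).
have my : 0 <= m%:R * (y * y) by rewrite !mulr_ge0.
rewrite -subr_ge0 -natr1 (_ : _ - _ = m%:R * (y * y))//; ring.
Qed.

Lemma cvg_mul_geom (r : R) : 0 <= r < 1 -> n%:R * r ^+ n @[n --> \oo] --> (0 : R).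
Proof.
move=> /andP[]; rewrite le_eqVlt => /predU1P[<- _|r0 r1].
  apply: cvg_near_cst; near=> n.
  by rewrite expr0n; have -> : (n == 0%N) = false; rewrite ?mulr0//; near: n; exists 1%N => // -[].
(* Since n q^n <= 1 / (1 - q), splitting r^n = q^n q^n leaves a geometric sequence as majorant. *)
pose q := Num.sqrt r.
have q0 : 0 < q by rewrite sqrtr_gt0.
have q2 : q ^+ 2 = r by rewrite sqr_sqrtr// ltW.
have q1 : q < 1 by rewrite -(expr_lt1 (n := 2))// ?q2// ltW.
have qe : 0 < 1 - q by rewrite subr_gt0.
have nq n : n%:R * q ^+ n <= (1 - q)^-1.
  rewrite -[leRHS]mul1r ler_pdivlMr// -mulrA.
  rewrite -subr_ge0.
  have B := @bernoulli_ineq (1 - q) n ltac:(by rewrite ltW//= lerBlDr lerDl ltW).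
  have IH k : k%:R * q ^+ k * (1 - q) <= 1 - q ^+ k.
    elim: k => [|k IHk]; first by rewrite !mul0r expr0 subrr.
    have qk : 0 <= q ^+ k by rewrite exprn_ge0// ltW.
    have h1 : q * (k%:R * q ^+ k * (1 - q)) <= q * (1 - q ^+ k).
      by rewrite ler_wpM2l// ltW.
    have h2 : q * q ^+ k * (1 - q) <= 1 - q.
      rewrite -[leRHS]mul1r ler_wpM2r ?(ltW qe)// -exprS.
      by rewrite exprn_ile1 ?(ltW q0) ?(ltW q1).
    rewrite exprS -natr1; lra.
  have := IH n; rewrite mulrA => h; rewrite subr_ge0 (le_trans h)//.
  by rewrite lerBlDr lerDl exprn_ge0// ltW.
apply: (@squeeze_cvgr _ _ _ _ (cst 0) (fun n => (1 - q)^-1 * q ^+ n)).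
- apply: nearW => n; rewrite mulr_ge0 ?exprn_ge0 ?(ltW r0)//=.
  by rewrite -q2 exprAC expr2 mulrA ler_wpM2r// exprn_ge0// ltW.
- exact: cvg_cst.
- rewrite -[X in _ --> X](mulr0 (1 - q)^-1).
  apply: cvgM; first exact: cvg_cst.
  by apply: cvg_expr; rewrite gtr0_norm.
Unshelve. all: end_near. Qed.

(** The exponent n 2^n separates the two sides of 1/2. If u >= 1/2, then (1 - u^n)^(n 2^n) <= exp(-
    n (2 u)^n) <= exp(-n). If u < 1/2, Bernoulli's inequality gives the upper bound n (2 u)^n, which
    tends to 0. *)
Lemma step_poly_cvg (u : R) : 0 <= u <= 1 ->
  step_poly n u @[n --> \oo] --> ((2^-1 <= u)%R%:R : R).
Proof.
move=> u01; have /andP[u0 u1] := u01.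
have [u2|u2] := leP 2^-1 u.
  rewrite -[X in _ --> X]subr0.
  apply: cvgB; first exact: cvg_cst.
  apply: (@squeeze_cvgr _ _ _ _ (cst 0) (fun n => n.+1%:R^-1)); last 2 first.
  - exact: cvg_cst.
  - exact: cvg_harmonic.
  apply: nearW => n /=.
  have un1 : u ^+ n <= 1 by rewrite exprn_ile1.
  rewrite exprn_ge0 ?subr_ge0//=.
  apply: (@le_trans _ _ (expR (- u ^+ n) ^+ (n * 2 ^ n))).
    by rewrite lerXn2r ?nnegrE ?subr_ge0 ?expR_ge0// expR_ge1Dx.
  rewrite -expRM_natl.
  apply: (@le_trans _ _ (expR (- n%:R))).
    rewrite ler_expR mulrN lerN2 natrM -mulrA -[leLHS]mulr1 ler_wpM2l//.
    rewrite natrX -exprMn exprn_ege1//.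
    by rewrite mulrC -ler_pdivrMr// mul1r.
  rewrite expRN lef_pV2 ?posrE ?expR_gt0//.
  by rewrite -natr1 addrC expR_ge1Dx.
apply: (@squeeze_cvgr _ _ _ _ (cst 0) (fun n => n%:R * (2 * u) ^+ n)).
- apply: nearW => n; have /andP[-> _] /= := step_poly_01 n u01.
  have un1 : 0 <= u ^+ n <= 1 by rewrite exprn_ge0// exprn_ile1.
  have := bernoulli_ineq (n * 2 ^ n) un1; rewrite /step_poly.
  rewrite natrM natrX exprMn mulrA; lra.
- exact: cvg_cst.
- apply: cvg_mul_geom; apply/andP; split; first by rewrite mulr_ge0.
  by rewrite mulrC -ltr_pdivlMr// mul1r.
Qed.

(** Once n exceeds |v - z| the argument lies in (-pi, pi), where the sine has the sign of its
    argument; the sequence is eventually constant. *)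
Lemma step_sin_cvg (v z : R) :
  ((2^-1 <= 2^-1 + 2^-1 * sin ((v - z) / n.+1%:R))%R%:R : R) @[n --> \oo] -->
  ((z <= v)%R%:R : R).
Proof.
apply: cvg_near_cst; near=> n.
rewrite lerDl pmulr_rge0 ?invr_gt0//.
have n0 : 0 < n.+1%:R :> R by rewrite ltr0n.
have nb : `|v - z| < n.+1%:R.
  apply: lt_le_trans (truncnS_gt _) _; rewrite ler_nat ltnS.
  near: n; exact: nbhs_infty_ge.
have pi1 : 1 < pi :> R by rewrite (lt_le_trans _ (pi_ge2 R))// ltr1n.
have small : `|(v - z) / n.+1%:R| < pi.
  rewrite normrM [`|n.+1%:R^-1|]gtr0_norm ?invr_gt0// ltr_pdivrMr//.
  by rewrite (lt_le_trans nb)// ler_peMl// ltW.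
rewrite ltr_norml in small; have /andP[s1 s2] := small.
congr (nat_of_bool _)%:R; have [zv|vz] := leP z v.
  by rewrite sin_ge0_pi// (ltW s2) divr_ge0 ?subr_ge0.
apply/negbTE; rewrite -ltNge -oppr_gt0 -sinN sin_gt0_pi// ltrNl s1 andbT.
by rewrite oppr_gt0 pmulr_llt0 ?invr_gt0// subr_lt0.
Unshelve. all: end_near. Qed.

End StepApproximation.

Section TrigonometricPolynomials.
Context {R : realType} {p : nat}.
Implicit Types (F G : 'cV[R]_p -> R) (l z : 'cV[R]_p).

(** Cosines with a phase include sines and constants, and product-to-sum keeps the class closed
    under products. Hence every polynomial in sines of coordinates belongs to it, in particular
    [step_poly] of a sine. *)
Definition trig_poly F := exists s : seq (R * 'cV[R]_p * R),
  forall z, F z = \sum_(i <- s) i.1.1 * cos ((i.1.2^T *m z) 0 0 + i.2).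

Lemma trig_cos l b : trig_poly (fun z => cos ((l^T *m z) 0 0 + b)).
Proof. by exists [:: (1, l, b)] => z; rewrite big_seq1 mul1r. Qed.

Lemma trigD F G : trig_poly F -> trig_poly G -> trig_poly (fun z => F z + G z).
Proof.
by move=> [s Fs] [t Gt]; exists (s ++ t) => z; rewrite big_cat Fs Gt.
Qed.

Lemma trigZ c F : trig_poly F -> trig_poly (fun z => c * F z).
Proof.
move=> [s Fs]; exists [seq (c * i.1.1, i.1.2, i.2) | i <- s] => z.
rewrite big_map Fs mulr_sumr; apply: eq_bigr => i _.
by rewrite /= mulrA.
Qed.

Lemma trig_cst c : trig_poly (fun=> c).
Proof.
exists [:: (c, 0, 0)] => z.
by rewrite big_seq1 /= trmx0 mul0mx mxE addr0 cos0 mulr1.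
Qed.

Lemma trig_sum (I : Type) (s : seq I) (F : I -> 'cV[R]_p -> R) :
  (forall i, trig_poly (F i)) -> trig_poly (fun z => \sum_(i <- s) F i z).
Proof.
move=> tF; elim: s => [|i s IHs].
  by under eq_fun do rewrite big_nil; exact: trig_cst.
by under eq_fun do rewrite big_cons; exact: trigD.
Qed.

Lemma trigM F G : trig_poly F -> trig_poly G -> trig_poly (fun z => F z * G z).
Proof.
move=> [s Fs] [t Gt].
have -> : (fun z => F z * G z) = fun z => \sum_(i <- s) \sum_(j <- t)
   (i.1.1 * j.1.1 / 2) * (cos (((i.1.2 + j.1.2)^T *m z) 0 0 + (i.2 + j.2)) +
     cos (((i.1.2 - j.1.2)^T *m z) 0 0 + (i.2 - j.2))).
  apply/funext => z; rewrite Fs Gt mulr_suml; apply: eq_bigr => i _.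
  rewrite mulr_sumr; apply: eq_bigr => j _.
  rewrite !linearD !linearN /= !mulmxDl !mulNmx !mxE.
  set A := \sum_(_ < _) _; set B := \sum_(_ < _) _.
  rewrite (_ : A + B + _ = (A + i.2) + (B + j.2)); last by ring.
  rewrite (_ : A - B + _ = (A + i.2) - (B + j.2)); last by ring.
  by rewrite (cosD (A + i.2) (B + j.2)) cosB; field.
apply: trig_sum => i; apply: trig_sum => j; apply: trigZ.
by apply: trigD; exact: trig_cos.
Qed.

Lemma trigX F n : trig_poly F -> trig_poly (fun z => F z ^+ n).
Proof.
move=> tF; elim: n => [|n IHn].
  by under eq_fun do rewrite expr0; exact: trig_cst.
by under eq_fun do rewrite exprS; exact: trigM.
Qed.

Lemma trig_prod (I : Type) (s : seq I) (F : I -> 'cV[R]_p -> R) :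
  (forall i, trig_poly (F i)) -> trig_poly (fun z => \prod_(i <- s) F i z).
Proof.
move=> tF; elim: s => [|i s IHs].
  by under eq_fun do rewrite big_nil; exact: trig_cst.
by under eq_fun do rewrite big_cons; exact: trigM.
Qed.

Lemma trig_step n F : trig_poly F -> trig_poly (fun z => step_poly n (F z)).
Proof.
move=> tF; have tN G : trig_poly G -> trig_poly (fun z => 1 - G z).
  move=> tG; have := trigD (trig_cst 1) (trigZ (-1) tG).
  by under eq_fun do rewrite mulN1r.
by apply/tN/trigX/tN/trigX.
Qed.

Lemma trig_sin (i : 'I_p) (v c : R) :
  trig_poly (fun z => 2^-1 + 2^-1 * sin ((v - z i 0) / c)).
Proof.
apply: trigD; first exact: trig_cst.
apply: trigZ.
have := trig_cos ((- c^-1) *: (delta_mx i 0 : 'cV[R]_p)) (v / c - pi / 2).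
congr trig_poly; apply/funext => z.
have -> : (((- c^-1) *: (delta_mx i 0 : 'cV[R]_p))^T *m z) 0 0 = - c^-1 * z i 0.
  rewrite [X in X *m _](_ : _ = (- c^-1) *: (delta_mx i 0)^T); last exact: linearZ.
  rewrite -scalemxAl mxE; congr (_ * _).
  rewrite trmx_delta mxE (bigD1 i)//= big1 ?addr0.
    by rewrite mxE !eqxx mul1r.
  by move=> j /negbTE ji; rewrite mxE eqxx ji mul0r.
rewrite (_ : _ + _ = (v - z i 0) / c - pi / 2); last by ring.
by rewrite cosB cos_pihalf sin_pihalf; ring.
Qed.

End TrigonometricPolynomials.

Section CramerWold.
Context {R : realType} {p : nat}.
Context {d1 d2 : measure_display} {W1 : measurableType d1} {W2 : measurableType d2}.
Variables (P1 : probability W1 R) (P2 : probability W2 R).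
Variables (X1 : W1 -> 'cV[R]_p) (X2 : W2 -> 'cV[R]_p).
Hypotheses (mX1 : random_vector X1) (mX2 : random_vector X2).
Hypothesis cosE : forall (l : 'cV[R]_p) (b : R),
  Ex P1 (fun w => cos ((l^T *m X1 w) 0 0 + b)) =
  Ex P2 (fun w => cos ((l^T *m X2 w) 0 0 + b)).

Lemma measurable_linear_form {d} {W : measurableType d} (X : W -> 'cV[R]_p)
  (l : 'cV[R]_p) : random_vector X -> measurable_fun setT (fun w => (l^T *m X w) 0 0).
Proof.
move=> mX; under eq_fun do rewrite mxE.
by apply: measurable_sum => i; exact: measurable_funM.
Qed.

Let Ex_trig (F : 'cV[R]_p -> R) : trig_poly F ->
  Ex P1 (fun w => F (X1 w)) = Ex P2 (fun w => F (X2 w)).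
Proof.
move=> [s Fs].
have i0 d (W : measurableType d) (P : probability W R) (X : W -> 'cV[R]_p) (l : 'cV[R]_p) b :
    random_vector X -> itg P (fun w => cos ((l^T *m X w) 0 0 + b)).
  move=> mX; apply: (@itg_bounded _ _ _ _ _ 1); last by move=> w; exact: cos_max.
  by apply: measurable_cos; apply: measurable_funD => //; exact: measurable_linear_form.
have -> : (fun w => F (X1 w)) = fun w =>
    \sum_(i <- s) i.1.1 * cos ((i.1.2^T *m X1 w) 0 0 + i.2) by apply/funext.
have -> : (fun w => F (X2 w)) = fun w =>
    \sum_(i <- s) i.1.1 * cos ((i.1.2^T *m X2 w) 0 0 + i.2) by apply/funext.
rewrite !Ex_sum; try by move=> i; apply/itgZ/i0.
by apply: eq_bigr => i _; rewrite !ExZ ?cosE//; exact: i0.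
Qed.

Let prod01 (f : 'I_p -> R) : (forall i, 0 <= f i <= 1) ->
  `|\prod_(i < p) f i| <= 1.
Proof.
move=> f01; elim/big_ind : _ => [|a b a1 b1|i _].
- by rewrite normr1.
- by rewrite normrM -[leRHS]mul1r ler_pM.
- by have /andP[? ?] := f01 i; rewrite ger0_norm.
Qed.

Let cvg_prodI (f : nat -> 'I_p -> R) (g : 'I_p -> R) :
  (forall i, f n i @[n --> \oo] --> g i) ->
  \prod_(i < p) f n i @[n --> \oo] --> \prod_(i < p) g i.
Proof.
move=> fg.
suff H (s : seq 'I_p) :
    \prod_(i <- s) f n i @[n --> \oo] --> \prod_(i <- s) g i by exact: H.
elim: s => [|i s IHs].
  rewrite big_nil [X in X @ _ --> _](_ : _ = fun=> 1); first exact: cvg_cst.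
  by apply/funext => n; rewrite big_nil.
rewrite big_cons [X in X @ _ --> _](_ : _ = fun n => f n i * \prod_(j <- s) f n j).
  exact: cvgM.
by apply/funext => n; rewrite big_cons.
Qed.

(** Two successive limits under bounded convergence. With N fixed, [step_poly] n makes each factor
    the indicator of sin((v_i - z_i) / (N + 1)) >= 0; then N grows, and this becomes the indicator
    of z_i <= v_i. *)
Lemma cramer_wold_orthant (v : 'cV[R]_p) :
  fine (P1 [set w | vle (X1 w) v]) = fine (P2 [set w | vle (X2 w) v]).
Proof.
pose u (N : nat) (z : 'cV[R]_p) (i : 'I_p) : R :=
  2^-1 + 2^-1 * sin ((v i 0 - z i 0) / N.+1%:R).
have u01 N z i : 0 <= u N z i <= 1.
  rewrite /u; have := sin_geN1 ((v i 0 - z i 0) / N.+1%:R).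
  have := sin_le1 ((v i 0 - z i 0) / N.+1%:R).
  by move=> ? ?; apply/andP; split; lra.
have mu d (W : measurableType d) (X : W -> 'cV[R]_p) N i : random_vector X ->
    measurable_fun setT (fun w => u N (X w) i).
  move=> mX; apply: measurable_funD => //; apply: measurable_funM => //.
  apply: (measurableT_comp (f := sin)).
    by apply: continuous_measurable_fun; exact: continuous_sin.
  by apply: measurable_funM => //; apply: measurable_funB.
have E1 n N : Ex P1 (fun w => \prod_(i < p) step_poly n (u N (X1 w) i)) =
              Ex P2 (fun w => \prod_(i < p) step_poly n (u N (X2 w) i)).
  apply: (@Ex_trig (fun z => \prod_(i < p) step_poly n (u N z i))).
  by apply: trig_prod => i; apply: trig_step; exact: trig_sin.
have lim1 d (W : measurableType d) (P : probability W R) (X : W -> 'cV[R]_p) N :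
    random_vector X ->
    Ex P (fun w => \prod_(i < p) step_poly n (u N (X w) i)) @[n --> \oo] -->
    Ex P (fun w => \prod_(i < p) (2^-1 <= u N (X w) i)%R%:R).
  move=> mX; apply: (@Ex_cvg _ _ _ _ _ _ 1).
  - move=> n; apply: measurable_prod => i _.
    apply: measurable_funB => //; apply: measurable_funX.
    by apply: measurable_funB => //; apply: measurable_funX; exact: mu.
  - apply: measurable_prod => i _.
    have -> : (fun w => (2^-1 <= u N (X w) i)%R%:R) =
        \1_[set w | 2^-1 <= u N (X w) i] :> (W -> R).
      apply/funext => w; rewrite indicE; congr (nat_of_bool _)%:R.
      by apply/idP/idP => [?|/set_mem//]; exact/mem_set.
    exact/measurable_indic/measurable_ge_set/mu.
  - by move=> n w; apply: prod01 => i; exact: step_poly_01.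
  - by move=> w; apply: cvg_prodI => i; exact: step_poly_cvg.
have E2 N : Ex P1 (fun w => \prod_(i < p) (2^-1 <= u N (X1 w) i)%R%:R) =
            Ex P2 (fun w => \prod_(i < p) (2^-1 <= u N (X2 w) i)%R%:R).
  have L2 := lim1 _ _ P2 _ N mX2.
  rewrite -[X in X @ _ --> _](funext (E1 ^~ N)) in L2.
  exact: (cvg_unique _ (lim1 _ _ P1 _ N mX1) L2).
have mle d (W : measurableType d) (X : W -> 'cV[R]_p) i : random_vector X ->
    measurable_fun setT (fun w => (X w i 0 <= v i 0)%R%:R : R).
  move=> mX.
  have -> : (fun w => (X w i 0 <= v i 0)%R%:R) =
        \1_[set w | 0 <= v i 0 - X w i 0] :> (W -> R).
    apply/funext => w; rewrite indicE -subr_ge0; congr (nat_of_bool _)%:R.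
    by apply/idP/idP => [?|/set_mem//]; exact/mem_set.
  by apply/measurable_indic/measurable_ge_set/measurable_funB.
have lim2 d (W : measurableType d) (P : probability W R) (X : W -> 'cV[R]_p) :
    random_vector X ->
    Ex P (fun w => \prod_(i < p) (2^-1 <= u N (X w) i)%R%:R) @[N --> \oo] -->
    Ex P (fun w => \prod_(i < p) (X w i 0 <= v i 0)%R%:R).
  move=> mX; apply: (@Ex_cvg _ _ _ _ _ _ 1).
  - move=> N; apply: measurable_prod => i _.
    have -> : (fun w => (2^-1 <= u N (X w) i)%R%:R) =
        \1_[set w | 2^-1 <= u N (X w) i] :> (W -> R).
      apply/funext => w; rewrite indicE; congr (nat_of_bool _)%:R.
      by apply/idP/idP => [?|/set_mem//]; exact/mem_set.
    exact/measurable_indic/measurable_ge_set/mu.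
  - by apply: measurable_prod => i _; exact: mle.
  - by move=> n w; apply: prod01 => i; rewrite ler0n lern1 leq_b1.
  - by move=> w; apply: cvg_prodI => i; exact: step_sin_cvg.
have E3 : Ex P1 (fun w => \prod_(i < p) (X1 w i 0 <= v i 0)%R%:R) =
          Ex P2 (fun w => \prod_(i < p) (X2 w i 0 <= v i 0)%R%:R).
  have L2 := lim2 _ _ P2 _ mX2.
  rewrite -[X in X @ _ --> _](funext E2) in L2.
  exact: (cvg_unique _ (lim2 _ _ P1 _ mX1) L2).
have PE d (W : measurableType d) (P : probability W R) (X : W -> 'cV[R]_p) :
    random_vector X ->
    Ex P (fun w => \prod_(i < p) (X w i 0 <= v i 0)%R%:R) =
    fine (P [set w | vle (X w) v]).
  move=> mX; rewrite -Ex_indic.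
    congr (Ex _ _); apply/funext => w; rewrite indicE.
    have [/set_mem h|/negP h] := boolP (w \in _).
      by rewrite big1// => i _; rewrite h.
    have [i Hi] : exists i, ~ (X w i 0 <= v i 0).
      by apply/existsNP => h'; apply: h; exact/mem_set.
    by rewrite (bigD1 i)//=; move/negP/negbTE : Hi => ->; rewrite mul0r.
  rewrite (_ : [set w | _] = \bigcap_(i in [set: 'I_p]) [set w | 0 <= v i 0 - X w i 0]).
    apply: fin_bigcap_measurable => [|i _]; first exact: finite_finset.
    exact/measurable_ge_set/measurable_funB.
  apply/seteqP; split => w /= h i; first by move=> _ /=; rewrite subr_ge0.
  by rewrite -subr_ge0; exact: h.
by rewrite -!PE.
Qed.

End CramerWold.

(** * Laws of large numbers under near-epoch dependence *)

Section Mixing.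
Context {d dV : measure_display} {W : measurableType d} {SV : measurableType dV}.
Context {R : realType}.
Variables (P : probability W R) (V : int -> {RV P >-> SV}).
Local Notation Ex_of := Ex.
Local Notation Ex := (Ex P).
Local Notation itg := (itg P).

Definition gen_of (J : set int) : set (set W) :=
  \bigcup_(i in J) preimage_set_system setT (V i) measurable.

(** Measurability for the sub-sigma-algebra is expressed on the type that it generates, so that the
    general closure lemmas for measurable functions apply. *)
Definition sigma_meas (J : set int) (Y : W -> R) :=
  measurable_fun [set: g_sigma_algebraType (gen_of J)] Y.

Lemma gen_of_measurable J A : gen_of J A -> measurable A.
Proof. by move=> [i _ [B mB <-]]; exact: measurable_funPT. Qed.

Lemma sigma_of_measurable J A : sigma_of V J A -> measurable A.
Proof.
apply: smallest_sub => //; first exact: sigma_algebra_measurable.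
exact: gen_of_measurable.
Qed.

Lemma sigma_of_mono J J' A : J `<=` J' -> sigma_of V J A -> sigma_of V J' A.
Proof.
move=> JJ'; apply: sub_smallest2r; first exact: smallest_sigma_algebra.
by move=> B [i Ji Bi]; exists i => //; exact: JJ'.
Qed.

Lemma sigma_measP J Y : sigma_meas J Y <->
  forall B : set R, measurable B -> sigma_of V J (Y @^-1` B).
Proof.
split=> [mY B mB|h]; first by have := mY measurableT B mB; rewrite setTI.
by move=> _ B mB; rewrite setTI; exact: h.
Qed.

Lemma sigma_meas_measurable J Y : sigma_meas J Y -> measurable_fun setT Y.
Proof.
move=> /sigma_measP mY _ B mB; rewrite setTI.
exact: sigma_of_measurable (mY B mB).
Qed.

Lemma sigma_meas_mono J J' Y : J `<=` J' -> sigma_meas J Y -> sigma_meas J' Y.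
Proof.
move=> JJ' /sigma_measP mY; apply/sigma_measP => B mB.
exact: sigma_of_mono JJ' (mY B mB).
Qed.

Lemma mixing_coef_ge (m : nat) (t : int) A B :
  sigma_of V [set i | i <= t] A -> sigma_of V [set i | t + m%:Z <= i] B ->
  `|fine (P (A `&` B)) - fine (P A) * fine (P B)| <= mixing_coef V m.
Proof.
move=> sA sB; apply: ub_le_sup; last by exists t, A, B.
exists 1 => _ [t' [A' [B' [/sigma_of_measurable mA /sigma_of_measurable mB ->]]]].
have p01 (C : set W) : measurable C -> 0 <= fine (P C) <= 1.
  move=> mC; rewrite fine_ge0//= -lee_fin fineK ?fin_num_measure//.
  exact: probability_le1.
have mAB : measurable (A' `&` B') by exact: measurableI.
have /andP[a0 a1] := p01 _ mA; have /andP[b0 b1] := p01 _ mB.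
have /andP[c0 c1] := p01 _ mAB.
have ab0 : 0 <= fine (P A') * fine (P B') by rewrite mulr_ge0.
have ab1 : fine (P A') * fine (P B') <= 1 by rewrite mulr_ile1.
by rewrite ler_norml; apply/andP; split; lra.
Qed.

Lemma Ex_indicI (A B : set W) : measurable A -> measurable B ->
  Ex (fun w => \1_A w * \1_B w) = fine (P (A `&` B)).
Proof.
move=> mA mB; rewrite -Ex_indic; last exact: measurableI.
by congr (Ex_of _ _); apply/funext => w; rewrite indicI.
Qed.

(** After discretisation by [layer], the covariance is an average of n^2 differences P(A_k B_j) -
    P(A_k) P(B_j) over level sets, each at most the mixing coefficient. The discretisation costs 2 e
    in E[XY] and 2 e in E[X] E[Y]. *)
Lemma cov_mixing01 (m : nat) (t : int) (X Y : W -> R) :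
  sigma_meas [set i | i <= t] X -> sigma_meas [set i | t + m%:Z <= i] Y ->
  (forall w, 0 <= X w <= 1) -> (forall w, 0 <= Y w <= 1) ->
  `|Ex (fun w => X w * Y w) - Ex X * Ex Y| <= mixing_coef V m.
Proof.
move=> sX sY X01 Y01.
have mX := sigma_meas_measurable sX; have mY := sigma_meas_measurable sY.
rewrite -subr_le0; apply: (@le_eps_mul _ _ 4) => e e0.
have [n n0 ne] := small_inv e0.
pose Xn w := layer n (X w); pose Yn w := layer n (Y w).
have mXn : measurable_fun setT Xn by exact: measurable_layer.
have mYn : measurable_fun setT Yn by exact: measurable_layer.
have bnd (f : W -> R) : (forall w, 0 <= f w <= 1) -> forall w, `|f w| <= 1.
  by move=> f01 w; have /andP[? ?] := f01 w; rewrite ger0_norm.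
have Xn01 w : 0 <= Xn w <= 1 by rewrite layer_ge0 layer_le1.
have Yn01 w : 0 <= Yn w <= 1 by rewrite layer_ge0 layer_le1.
have dX w : `|X w - Xn w| <= e by rewrite (le_trans _ ne)// layer_dist.
have dY w : `|Y w - Yn w| <= e by rewrite (le_trans _ ne)// layer_dist.
have iX := itg_bounded P mX (bnd _ X01); have iY := itg_bounded P mY (bnd _ Y01).
have iXn := itg_bounded P mXn (bnd _ Xn01).
have iYn := itg_bounded P mYn (bnd _ Yn01).
have iM (f g : W -> R) : measurable_fun setT f -> measurable_fun setT g ->
   (forall w, 0 <= f w <= 1) -> (forall w, 0 <= g w <= 1) ->
   itg (fun w => f w * g w).
  move=> mf mg /bnd f1 /bnd g1; apply: (@itg_bounded _ _ _ _ _ 1).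
    exact: measurable_funM.
  by move=> w; rewrite normrM -[leRHS]mul1r ler_pM.
have E01 (f : W -> R) : (forall w, 0 <= f w <= 1) -> itg f -> 0 <= Ex f <= 1.
  move=> f01 iF; rewrite Ex_ge0 ?Ex_le_cst// => w; by have /andP[] := f01 w.
have dEx (f g : W -> R) : itg f -> itg g -> (forall w, `|f w - g w| <= e) -> `|Ex f - Ex g| <= e.
  move=> iF iG fg; rewrite -ExB//.
  by apply: Ex_bounded => //; exact: itg_meas (itgB iF iG).
have dXY : `|Ex (fun w => X w * Y w) - Ex (fun w => Xn w * Yn w)| <= e + e.
  have i1 := iM _ _ mX mY X01 Y01; have i2 := iM _ _ mXn mYn Xn01 Yn01.
  rewrite -ExB//; apply: Ex_bounded; first exact: itg_meas (itgB i1 i2).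
  move=> w; have /andP[x0 x1] := X01 w; have /andP[y0 y1] := Yn01 w.
  rewrite (_ : _ - _ = X w * (Y w - Yn w) + Yn w * (X w - Xn w)); last by ring.
  rewrite (le_trans (ler_normD _ _))// normrM [`|Yn w * _|]normrM lerD//.
    by rewrite -[leRHS]mul1r; apply: ler_pM => //; exact: (bnd _ X01).
  by rewrite -[leRHS]mul1r; apply: ler_pM => //; exact: (bnd _ Yn01).
have dEE : `|Ex X * Ex Y - Ex Xn * Ex Yn| <= e + e.
  have /andP[x0 x1] := E01 _ X01 iX; have /andP[y0 y1] := E01 _ Yn01 iYn.
  rewrite (_ : _ - _ = Ex X * (Ex Y - Ex Yn) + Ex Yn * (Ex X - Ex Xn)); last by ring.
  rewrite (le_trans (ler_normD _ _))// !normrM lerD//.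
    by rewrite -[leRHS]mul1r; apply: ler_pM => //; [rewrite ger0_norm|exact: dEx].
  by rewrite -[leRHS]mul1r; apply: ler_pM => //; [rewrite ger0_norm|exact: dEx].
have step : `|Ex (fun w => Xn w * Yn w) - Ex Xn * Ex Yn| <= mixing_coef V m.
  pose A k := [set w | k%:R / n%:R <= X w]; pose B k := [set w | k%:R / n%:R <= Y w].
  have sA k : sigma_of V [set i | i <= t] (A k).
    exact: (@measurable_ge_set _ (g_sigma_algebraType (gen_of _))).
  have sB k : sigma_of V [set i | t + m%:Z <= i] (B k).
    exact: (@measurable_ge_set _ (g_sigma_algebraType (gen_of _))).
  have mA k := sigma_of_measurable (sA k); have mB k := sigma_of_measurable (sB k).
  have iA k : itg \1_(A k) by exact: itg_indic.
  have iB k : itg \1_(B k) by exact: itg_indic.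
  have iAB k j : itg (fun w => \1_(A k) w * \1_(B j) w).
    have -> : (fun w => \1_(A k) w * \1_(B j) w) = \1_(A k `&` B j) :> (W -> R).
      by rewrite indicI.
    exact/itg_indic/measurableI.
  have EXn : Ex Xn = n%:R^-1 * \sum_(1 <= k < n.+1) fine (P (A k)).
    rewrite (_ : Xn = fun w => n%:R^-1 * \sum_(1 <= k < n.+1) \1_(A k) w).
      rewrite ExZ; last exact: itg_sum.
      by rewrite Ex_sum//; congr (_ * _); apply: eq_bigr => k _; exact: Ex_indic.
    by apply/funext => w; rewrite /Xn layer_comp.
  have EYn : Ex Yn = n%:R^-1 * \sum_(1 <= k < n.+1) fine (P (B k)).
    rewrite (_ : Yn = fun w => n%:R^-1 * \sum_(1 <= k < n.+1) \1_(B k) w).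
      rewrite ExZ; last exact: itg_sum.
      by rewrite Ex_sum//; congr (_ * _); apply: eq_bigr => k _; exact: Ex_indic.
    by apply/funext => w; rewrite /Yn layer_comp.
  have EXYn : Ex (fun w => Xn w * Yn w) = n%:R^-1 * n%:R^-1 *
      \sum_(1 <= k < n.+1) \sum_(1 <= j < n.+1) fine (P (A k `&` B j)).
    rewrite (_ : (fun w => _) = fun w => n%:R^-1 * n%:R^-1 *
      \sum_(1 <= k < n.+1) \sum_(1 <= j < n.+1) (\1_(A k) w * \1_(B j) w)).
      rewrite ExZ; last by apply: itg_sum => k; exact: itg_sum.
      rewrite Ex_sum; last by move=> k; exact: itg_sum.
      congr (_ * _); apply: eq_bigr => k _.
      by rewrite Ex_sum//; apply: eq_bigr => j _; exact: Ex_indicI.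
    apply/funext => w; rewrite /Xn /Yn !layer_comp mulrACA; congr (_ * _).
    by rewrite mulr_suml; apply: eq_bigr => k _; rewrite mulr_sumr.
  have -> : Ex (fun w => Xn w * Yn w) - Ex Xn * Ex Yn = n%:R^-1 * n%:R^-1 *
      \sum_(1 <= k < n.+1) \sum_(1 <= j < n.+1)
        (fine (P (A k `&` B j)) - fine (P (A k)) * fine (P (B j))).
    rewrite EXYn EXn EYn mulrACA -mulrBr mulr_suml -sumrB; congr (_ * _).
    by apply: eq_bigr => k _; rewrite mulr_sumr -sumrB.
  have nn0 : 0 < n%:R :> R by rewrite ltr0n.
  rewrite normrM ger0_norm ?mulr_ge0 ?invr_ge0//.
  rewrite -invfM mulrC ler_pdivrMr ?mulr_gt0//.
  rewrite (le_trans (ler_norm_sum _ _ _))//.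
  apply: (@le_trans _ _ (\sum_(1 <= k < n.+1) (n%:R * mixing_coef V m))).
    apply: ler_sum => k _; rewrite (le_trans (ler_norm_sum _ _ _))//.
    apply: (@le_trans _ _ (\sum_(1 <= j < n.+1) mixing_coef V m)).
      by apply: ler_sum => j _; exact: mixing_coef_ge (sA k) (sB j).
    by rewrite sumr_const_nat subn1 mulr_natl.
  by rewrite sumr_const_nat subn1 -[leLHS]mulr_natl mulrA mulrC.
rewrite lerBlDr.
have -> : Ex (fun w => X w * Y w) - Ex X * Ex Y =
  (Ex (fun w => X w * Y w) - Ex (fun w => Xn w * Yn w)) +
  (Ex (fun w => Xn w * Yn w) - Ex Xn * Ex Yn) - (Ex X * Ex Y - Ex Xn * Ex Yn) by ring.
rewrite (le_trans (ler_normB _ _))// (le_trans (lerD (ler_normD _ _) (lexx _)))//.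
by rewrite (le_trans (lerD (lerD dXY step) dEE))//; lra.
Qed.

(** The map z -> (z + B) / (2 B) sends both variables into [0, 1] and divides the covariance by 4
    B^2. *)
Lemma cov_mixing (m : nat) (t : int) (X Y : W -> R) (B : R) : 0 < B ->
  sigma_meas [set i | i <= t] X -> sigma_meas [set i | t + m%:Z <= i] Y ->
  (forall w, `|X w| <= B) -> (forall w, `|Y w| <= B) ->
  `|Ex (fun w => X w * Y w) - Ex X * Ex Y| <= 4 * B ^+ 2 * mixing_coef V m.
Proof.
move=> B0 sX sY XB YB.
pose n (Z : W -> R) w := (2 * B)^-1 * (Z w + B).
have sn J Z : sigma_meas J Z -> sigma_meas J (n Z).
  by move=> sZ; apply: measurable_funM => //; exact: measurable_funD.
have n01 Z : (forall w, `|Z w| <= B) -> forall w, 0 <= n Z w <= 1.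
  move=> ZB w; have := ZB w; rewrite ler_norml => /andP[z1 z2].
  rewrite /n mulrC; apply/andP; split.
    by rewrite divr_ge0 ?mulr_ge0 ?(ltW B0)//; lra.
  by rewrite ler_pdivrMr ?mulr_gt0//; lra.
have := cov_mixing01 (sn _ _ sX) (sn _ _ sY) (n01 _ XB) (n01 _ YB).
have mX := sigma_meas_measurable sX; have mY := sigma_meas_measurable sY.
have iX := itg_bounded P mX XB; have iY := itg_bounded P mY YB.
have iXY : itg (fun w => X w * Y w).
  apply: (@itg_bounded _ _ _ _ _ (B * B)); first exact: measurable_funM.
  by move=> w; rewrite normrM ler_pM.
have En Z : itg Z -> Ex (n Z) = (2 * B)^-1 * (Ex Z + B).
  move=> iZ; rewrite ExZ; last exact/itgD/itg_cst.
  by rewrite ExD ?Ex_cst//; exact: itg_cst.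
have -> : Ex (fun w => n X w * n Y w) =
    (2 * B)^-1 ^+ 2 * (Ex (fun w => X w * Y w) + (B * Ex X + (B * Ex Y + B * B))).
  rewrite (_ : (fun w => _) = fun w => (2 * B)^-1 ^+ 2 *
     (X w * Y w + (B * X w + (B * Y w + B * B)))).
    have i1 : itg (fun w => B * Y w + B * B) by exact/itgD/itg_cst/itgZ.
    have i2 : itg (fun w => B * X w + (B * Y w + B * B)) by exact/itgD/i1/itgZ.
    rewrite ExZ; last exact: itgD.
    have i3 : itg (fun w => B * X w) by exact: itgZ.
    have i4 : itg (fun w => B * Y w) by exact: itgZ.
    by rewrite (ExD iXY i2) (ExD i3 i1) (ExD i4 (itg_cst _ _)) Ex_cst !ExZ.
  by apply/funext => w; rewrite /n; ring.
rewrite !En// (_ : _ - _ = (4 * B ^+ 2)^-1 * (Ex (fun w => X w * Y w) - Ex X * Ex Y)).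
  have q0 : 0 < 4 * B ^+ 2 by rewrite mulr_gt0// exprn_gt0.
  rewrite normrM gtr0_norm ?invr_gt0// mulrC ler_pdivrMr//.
  by rewrite [leRHS]mulrC.
by field; rewrite gt_eqF.
Qed.

End Mixing.

Section WeakDependence.
Context {d dV : measure_display} {W : measurableType d} {SV : measurableType dV}.
Context {R : realType}.
Variables (P : probability W R) (V : int -> {RV P >-> SV}).
Local Notation Ex := (Ex P).
Local Notation itg := (itg P).

Definition near_window (t m : nat) : set int :=
  [set j : int | t%:Z - m%:Z <= j <= t%:Z + m%:Z].

Lemma near_window_mono t m m' : (m <= m')%N -> near_window t m `<=` near_window t m'.
Proof. by move=> mm' j /= /andP[j1 j2]; apply/andP; split; lia. Qed.

(** Near-epoch approximation in L1, uniform in t. The approximants share the bound [B], so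
    [cov_mixing] applies to them and products can be estimated. *)
Definition bounded_ned (g : nat -> W -> R) (B : R) :=
  (forall t, (1 <= t)%N -> measurable_fun setT (g t) /\ forall w, `|g t w| <= B) /\
  (forall e : R, 0 < e -> exists m : nat, forall t, (1 <= t)%N -> exists Y : W -> R,
     [/\ sigma_meas V (near_window t m) Y, forall w, `|Y w| <= B &
         Ex (fun w => `|g t w - Y w|) <= e]).

(** By f g - Y1 Y2 = g (f - Y1) + Y1 (g - Y2), the bounds carry the L1 errors over to the product;
    this is what truncation buys. *)
Lemma bounded_nedM (f g : nat -> W -> R) (A B : R) : 0 < A -> 0 < B ->
  bounded_ned f A -> bounded_ned g B -> bounded_ned (fun t w => f t w * g t w) (A * B).
Proof.
move=> A0 B0 [mf af] [mg ag]; split=> [t t1|e e0].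
  have [mft fA] := mf t t1; have [mgt gB] := mg t t1.
  split; first exact: measurable_funM.
  by move=> w; rewrite normrM ler_pM.
have [m1 H1] := af (e / (2 * B)) ltac:(by rewrite divr_gt0 ?mulr_gt0).
have [m2 H2] := ag (e / (2 * A)) ltac:(by rewrite divr_gt0 ?mulr_gt0).
exists (maxn m1 m2) => t t1.
have [mft fA] := mf t t1; have [mgt gB] := mg t t1.
have [Y1 [s1 Y1A e1]] := H1 t t1; have [Y2 [s2 Y2B e2]] := H2 t t1.
have s1' := sigma_meas_mono (near_window_mono (t := t) (leq_maxl m1 m2)) s1.
have s2' := sigma_meas_mono (near_window_mono (t := t) (leq_maxr m1 m2)) s2.
exists (fun w => Y1 w * Y2 w); split.
- exact: measurable_funM.
- by move=> w; rewrite normrM ler_pM.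
have mY1 := sigma_meas_measurable s1; have mY2 := sigma_meas_measurable s2.
have i1 : itg (fun w => `|f t w - Y1 w|).
  by apply/itg_norm/itgB; [exact: itg_bounded fA|exact: itg_bounded Y1A].
have i2 : itg (fun w => `|g t w - Y2 w|).
  by apply/itg_norm/itgB; [exact: itg_bounded gB|exact: itg_bounded Y2B].
apply: (@le_trans _ _ (Ex (fun w => B * `|f t w - Y1 w| + A * `|g t w - Y2 w|))).
  apply: Ex_le.
  - apply/itg_norm/itgB.
      apply: (@itg_bounded _ _ _ _ _ (A * B)); first exact: measurable_funM.
      by move=> w; rewrite normrM ler_pM.
    apply: (@itg_bounded _ _ _ _ _ (A * B)); first exact: measurable_funM.
    by move=> w; rewrite normrM ler_pM.
  - by apply: itgD; exact: itgZ.
  - move=> w; rewrite (_ : _ - _ = g t w * (f t w - Y1 w) + Y1 w * (g t w - Y2 w)).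
      by rewrite (le_trans (ler_normD _ _))// !normrM lerD// ler_wpM2r.
    by ring.
rewrite ExD; [|exact: itgZ|exact: itgZ]; rewrite !ExZ//.
have -> : e = B * (e / (2 * B)) + A * (e / (2 * A)) by field; rewrite !gt_eqF.
by rewrite lerD// ler_wpM2l// ltW.
Qed.

Hypothesis mix : mixing_coef V m @[m --> \oo] --> (0 : R).

Definition cov (X Y : W -> R) : R := Ex (fun w => X w * Y w) - Ex X * Ex Y.

Lemma bounded_ned_cov (g : nat -> W -> R) (B e : R) : 0 < B -> 0 < e ->
  bounded_ned g B -> exists k : nat, forall s t, (1 <= s)%N -> (s + k <= t)%N ->
  `|cov (g s) (g t)| <= e.
Proof.
move=> B0 e0 [mg ag].
(* Replacing g s and g t by their approximants costs 2 B e' = e / 4 in E[g_s g_t] and again in the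
   product of the means; mixing receives the other e / 2. *)
pose e' := e / (8 * B).
have e'0 : 0 < e' by rewrite divr_gt0 ?mulr_gt0.
have [m Hm] := ag e' e'0.
have [N _ HN] : \forall n \near \oo, mixing_coef V n <= e / (8 * B ^+ 2).
  have := cvgr_le _ mix; apply.
  by rewrite divr_gt0 ?mulr_gt0 ?exprn_gt0.
(* At this distance the windows of radius m around s and t are still N apart. *)
exists (N + 2 * m)%N => s t s1 st.
have t1 : (1 <= t)%N by lia.
have [ms sB] := mg s s1; have [mt tB] := mg t t1.
have [Y1 [m1 Y1B d1]] := Hm s s1; have [Y2 [m2 Y2B d2]] := Hm t t1.
have H1 : sigma_meas V [set i | i <= s%:Z + m%:Z] Y1.
  by apply: sigma_meas_mono m1 => j /= /andP[].
have H2 : sigma_meas V [set i | (s%:Z + m%:Z) + N%:Z <= i] Y2.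
  by apply: sigma_meas_mono m2 => j /= /andP[j1 j2]; lia.
have cm := cov_mixing B0 H1 H2 Y1B Y2B.
have {}cm : `|cov Y1 Y2| <= e / 2.
  rewrite (le_trans cm)//; have mN : mixing_coef V N <= e / (8 * B ^+ 2).
    by apply: HN => /=.
  apply: (@le_trans _ _ (4 * B ^+ 2 * (e / (8 * B ^+ 2)))).
    by rewrite ler_wpM2l// mulr_ge0// exprn_ge0// ltW.
  by rewrite le_eqVlt; apply/orP; left; apply/eqP; field; rewrite gt_eqF.
have mY1 := sigma_meas_measurable m1; have mY2 := sigma_meas_measurable m2.
have is_ := itg_bounded P ms sB; have it_ := itg_bounded P mt tB.
have i1 := itg_bounded P mY1 Y1B; have i2 := itg_bounded P mY2 Y2B.
have iM (f h : W -> R) : measurable_fun setT f -> measurable_fun setT h ->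
    (forall w, `|f w| <= B) -> (forall w, `|h w| <= B) -> itg (fun w => f w * h w).
  move=> mf mh fB hB; apply: (@itg_bounded _ _ _ _ _ (B * B)).
    exact: measurable_funM.
  by move=> w; rewrite normrM ler_pM.
have dE : `|Ex (fun w => g s w * g t w) - Ex (fun w => Y1 w * Y2 w)| <= 2 * B * e'.
  have j1 := iM _ _ ms mt sB tB; have j2 := iM _ _ mY1 mY2 Y1B Y2B.
  rewrite -ExB// (le_trans (Ex_norm (itgB j1 j2)))//.
  have n1 := itg_norm (itgB is_ i1); have n2 := itg_norm (itgB it_ i2).
  apply: (@le_trans _ _ (Ex (fun w => B * `|g s w - Y1 w| + B * `|g t w - Y2 w|))).
    apply: Ex_le; [exact/itg_norm/itgB|by apply: itgD; exact: itgZ|].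
    move=> w; rewrite (_ : _ - _ = g t w * (g s w - Y1 w) + Y1 w * (g t w - Y2 w)).
      by rewrite (le_trans (ler_normD _ _))// !normrM lerD// ler_wpM2r.
    by ring.
  rewrite ExD; [|exact: itgZ|exact: itgZ]; rewrite !ExZ//.
  have h1 := ler_wpM2l (ltW B0) d1; have h2 := ler_wpM2l (ltW B0) d2; lra.
have EB (f : W -> R) : measurable_fun setT f -> (forall w, `|f w| <= B) -> `|Ex f| <= B.
  exact: Ex_bounded.
have dd (f h : W -> R) : itg f -> itg h -> Ex (fun w => `|f w - h w|) <= e' -> `|Ex f - Ex h| <= e'.
  by move=> jf jh; apply: le_trans; rewrite -ExB//; exact/Ex_norm/itgB.
have dEE : `|Ex (g s) * Ex (g t) - Ex Y1 * Ex Y2| <= 2 * B * e'.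
  rewrite (_ : _ - _ = Ex (g t) * (Ex (g s) - Ex Y1) + Ex Y1 * (Ex (g t) - Ex Y2)).
    rewrite (le_trans (ler_normD _ _))// !normrM -mulrA mulr_natl mulr2n.
    by rewrite lerD// ler_pM//; [exact: EB|exact: dd|exact: EB|exact: dd].
  by ring.
rewrite /cov in cm *.
rewrite (_ : _ - _ = (Ex (fun w => g s w * g t w) - Ex (fun w => Y1 w * Y2 w))
  + (Ex (fun w => Y1 w * Y2 w) - Ex Y1 * Ex Y2) - (Ex (g s) * Ex (g t) - Ex Y1 * Ex Y2)).
  rewrite (le_trans (ler_normB _ _))// (le_trans (lerD (ler_normD _ _) (lexx _)))//.
  rewrite (le_trans (lerD (lerD dE cm) dEE))//.
  rewrite le_eqVlt; apply/orP; left; apply/eqP.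
  by rewrite /e'; field; rewrite gt_eqF.
by ring.
Qed.

Lemma cov_sym X Y : cov X Y = cov Y X.
Proof.
rewrite /cov [Ex Y * _]mulrC; congr (Ex _ - _).
by apply/funext => w; rewrite mulrC.
Qed.

Lemma cov_bound (X Y : W -> R) (B : R) : measurable_fun setT X -> measurable_fun setT Y ->
  (forall w, `|X w| <= B) -> (forall w, `|Y w| <= B) -> `|cov X Y| <= 2 * B ^+ 2.
Proof.
move=> mX mY XB YB; rewrite (le_trans (ler_normB _ _))//.
rewrite (_ : 2 * B ^+ 2 = B * B + B * B); last by ring.
apply: lerD; last by rewrite normrM ler_pM// Ex_bounded.
apply: Ex_bounded; first exact: measurable_funM.
by move=> w; rewrite normrM ler_pM.
Qed.

Lemma size_filter_near (s : seq nat) (l k : nat) : uniq s ->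
  (size [seq j <- s | (l < j + k) && (j < l + k)]%N <= 2 * k)%N.
Proof.
move=> us; rewrite -[leqRHS](size_iota (l - k)).
apply: uniq_leq_size; first exact: filter_uniq.
by move=> j; rewrite mem_filter mem_iota => /andP[/andP[h1 h2] _]; lia.
Qed.

Definition centered (f : nat -> W -> R) t w := f t w - Ex (f t).

(* a second-moment bound, split into near and distant pairs of indices *)
Lemma bounded_ned_lln (g : nat -> W -> R) (B C e : R) : 0 < B -> 0 < C -> 0 < e ->
  bounded_ned g B ->
  exists2 b0 : R, 0 < b0 & forall (b : R) (s : seq nat) (c : nat -> R),
    b0 <= b -> uniq s -> (forall l, l \in s -> (1 <= l)%N) ->
    (size s)%:R <= 5 * b -> (forall l, `|c l| <= C / b) ->
  Ex (fun w => `|\sum_(l <- s) c l * centered g l w|) <= e.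
Proof.
move=> B0 C0 e0 ng.
(* All pairs together pay (5 b)^2 (C / b)^2 e1 = e^2 / 2 for the bound on distant covariances. At
   most 2 k neighbours per index pay the crude bound 2 B^2, in total 20 C^2 B^2 k / b, which is at
   most e^2 / 2 beyond the threshold below. *)
pose e1 := e ^+ 2 / (50 * C ^+ 2).
have e10 : 0 < e1 by rewrite divr_gt0 ?exprn_gt0// mulr_gt0 ?exprn_gt0.
have [k Hk] := bounded_ned_cov B0 e10 ng.
have [mg _] := ng.
have q0 : 0 <= (20 * C ^+ 2 * B ^+ 2 * k%:R) * 2 / e ^+ 2.
  by rewrite divr_ge0 ?sqr_ge0// mulr_ge0// mulr_ge0// mulr_ge0 ?sqr_ge0// mulr_ge0 ?sqr_ge0.
exists ((20 * C ^+ 2 * B ^+ 2 * k%:R) * 2 / e ^+ 2 + 1); first by rewrite ltr_wpDl.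
move=> b s c b0b us s1 sb cC.
have bpos : 0 < b by apply: lt_le_trans b0b; rewrite ltr_wpDl.
(* The hypotheses concern indices from 1 on. Sending index 0 to 1 makes them hold for every index
   and changes nothing on [s]. *)
pose g1 l := g (maxn l 1).
have m1 l : (1 <= maxn l 1)%N by rewrite leq_maxr.
have mg1 l : measurable_fun setT (g1 l) by have [] := mg _ (m1 l).
have g1B l w : `|g1 l w| <= B by have [_ h] := mg _ (m1 l); exact: h.
pose h l w := g1 l w - Ex (g1 l).
have mh l : measurable_fun setT (h l) by exact: measurable_funB.
have hB l w : `|h l w| <= 2 * B.
  rewrite (le_trans (ler_normB _ _))// (_ : 2 * B = B + B); last by ring.
  by apply: lerD; [exact: g1B|exact: Ex_bounded].
have ih l := itg_bounded P (mh l) (hB l).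
have ig l := itg_bounded P (mg1 l) (g1B l).
have ihh l j : itg (fun w => h l w * h j w).
  apply: (@itg_bounded _ _ _ _ _ (2 * B * (2 * B))); first exact: measurable_funM.
  by move=> w; rewrite normrM ler_pM.
have igg l j : itg (fun w => g1 l w * g1 j w).
  apply: (@itg_bounded _ _ _ _ _ (B * B)); first exact: measurable_funM.
  by move=> w; rewrite normrM ler_pM.
have Ehh l j : Ex (fun w => h l w * h j w) = cov (g1 l) (g1 j).
  rewrite (_ : (fun w => _) = fun w => g1 l w * g1 j w -
    (Ex (g1 l) * g1 j w + (Ex (g1 j) * g1 l w - Ex (g1 l) * Ex (g1 j)))).
    have i1 : itg (fun w => Ex (g1 j) * g1 l w - Ex (g1 l) * Ex (g1 j)).
      exact/itgB/itg_cst/itgZ.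
    have i2 := itgD (itgZ (Ex (g1 l)) (ig j)) i1.
    rewrite (ExB (igg l j) i2) (ExD (itgZ _ (ig j)) i1).
    rewrite (ExB (itgZ _ (ig l)) (itg_cst _ _)) Ex_cst (ExZ _ (ig l)) (ExZ _ (ig j)).
    by rewrite /cov; ring.
  by apply/funext => w; rewrite /h; ring.
have -> : (fun w => `|\sum_(l <- s) c l * centered g l w|) =
    fun w => `|\sum_(l <- s) c l * h l w|.
  apply/funext => w; congr `|_|; apply: eq_big_seq => l /s1 l1.
  by rewrite /h /centered /g1 (maxn_idPl l1).
have iS : itg (fun w => \sum_(l <- s) c l * h l w).
  by apply: itg_sum => l; exact: itgZ.
have sqE : (fun w => (\sum_(l <- s) c l * h l w) ^+ 2) = fun w =>
   \sum_(l <- s) \sum_(j <- s) (c l * c j) * (h l w * h j w).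
  apply/funext => w; rewrite expr2 mulr_suml; apply: eq_bigr => l _.
  by rewrite mulr_sumr; apply: eq_bigr => j _; ring.
apply: Ex_norm_sqr => //.
  by rewrite sqE; apply: itg_sum => l; apply: itg_sum => j; exact: itgZ.
rewrite sqE Ex_sum; last by move=> l; apply: itg_sum => j; exact: itgZ.
pose far (l j : nat) := ((l < j + k) && (j < l + k))%N.
have covb l j : l \in s -> j \in s ->
    `|cov (g1 l) (g1 j)| <= e1 + (far l j)%:R * (2 * B ^+ 2).
  move=> /s1 l1 /s1 j1; rewrite /far.
  have [lj|lj] := ltnP l (j + k); last first.
    rewrite mul0r addr0 cov_sym /g1 (maxn_idPl l1) (maxn_idPl j1).
    exact: Hk.
  have [jl|jl] := ltnP j (l + k); last first.
    by rewrite mul0r addr0 /g1 (maxn_idPl l1) (maxn_idPl j1); exact: Hk.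
  by rewrite mul1r ler_wpDl ?(ltW e10)// cov_bound.
have near_count l : \sum_(j <- s) (far l j)%:R * (2 * B ^+ 2) <= (2 * k)%:R * (2 * B ^+ 2).
  rewrite -mulr_suml ler_wpM2r ?mulr_ge0 ?exprn_ge0 ?(ltW B0)//.
  rewrite -natr_sum ler_nat (leq_trans _ (size_filter_near l k us))//.
  by rewrite size_filter -sum1_count [leqRHS]big_mkcond leq_sum// => j _; case: ifP.
have rowb l : l \in s -> `|\sum_(j <- s) (c l * c j) * cov (g1 l) (g1 j)| <=
    (C / b) ^+ 2 * ((size s)%:R * e1 + (2 * k)%:R * (2 * B ^+ 2)).
  move=> ls; rewrite (le_trans (ler_norm_sum _ _ _))//.
  apply: (@le_trans _ _ (\sum_(j <- s) (C / b) ^+ 2 * (e1 + (far l j)%:R * (2 * B ^+ 2)))).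
    rewrite big_seq [leRHS]big_seq; apply: ler_sum => j js.
    by rewrite normrM ler_pM ?covb// normrM expr2 ler_pM.
  rewrite -mulr_sumr ler_wpM2l ?sqr_ge0// big_split/=.
  by rewrite lerD// big_const_seq count_predT iter_addr addr0 mulr_natl.
apply: le_trans (ler_norm _) _.
have -> : \sum_(l <- s) Ex (fun w => \sum_(j <- s) c l * c j * (h l w * h j w)) =
    \sum_(l <- s) \sum_(j <- s) (c l * c j) * cov (g1 l) (g1 j).
  apply: eq_bigr => l _; rewrite Ex_sum; last by move=> j; exact: itgZ.
  by apply: eq_bigr => j _; rewrite ExZ// Ehh.
rewrite (le_trans (ler_norm_sum _ _ _))//.
set D := (C / b) ^+ 2 * _ in rowb.
apply: (@le_trans _ _ (\sum_(l <- s) D)).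
  by rewrite big_seq [leRHS]big_seq; apply: ler_sum => l; exact: rowb.
rewrite big_const_seq count_predT iter_addr addr0 -mulr_natl.
have D1 : D <= (C / b) ^+ 2 * (5 * b * e1 + (2 * k)%:R * (2 * B ^+ 2)).
  by rewrite ler_wpM2l ?sqr_ge0// lerD2r ler_wpM2r// ltW.
have D0 : 0 <= D.
  apply: mulr_ge0; first exact: sqr_ge0.
  apply: addr_ge0; first by apply: mulr_ge0; rewrite ?ler0n// ltW.
  by apply: mulr_ge0; [exact: ler0n|rewrite mulr_ge0 ?sqr_ge0].
apply: (@le_trans _ _ (5 * b * ((C / b) ^+ 2 * (5 * b * e1 + (2 * k)%:R * (2 * B ^+ 2))))).
  exact: ler_pM.
have -> : 5 * b * ((C / b) ^+ 2 * (5 * b * e1 + (2 * k)%:R * (2 * B ^+ 2))) =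
   e ^+ 2 / 2 + (20 * C ^+ 2 * B ^+ 2 * k%:R) / b.
  by rewrite /e1 natrM; field; rewrite !gt_eqF.
rewrite [leRHS](splitr (e ^+ 2)) lerD2l ler_pdivrMr//.
have : (20 * C ^+ 2 * B ^+ 2 * k%:R) * 2 / e ^+ 2 <= b.
  by rewrite (le_trans _ b0b)// lerDl.
rewrite ler_pdivrMr ?exprn_gt0// => hb; lra.
Qed.

End WeakDependence.

Section LawOfLargeNumbers.
Context {d dV : measure_display} {W : measurableType d} {SV : measurableType dV}.
Context {R : realType}.
Variables (P : probability W R) (V : int -> {RV P >-> SV}).
Local Notation Ex := (Ex P).
Local Notation itg := (itg P).
Local Notation centered := (centered P).

(** The L1 closure of [bounded_ned], uniformly in t: the class that contains the products of four
    coordinates, whose variance may be infinite. *)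
Definition ned_L1 (f : nat -> W -> R) :=
  (forall t, (1 <= t)%N -> itg (f t)) /\
  forall e : R, 0 < e -> exists2 B : R, 0 < B & exists2 g, bounded_ned V g B &
    forall t, (1 <= t)%N -> Ex (fun w => `|f t w - g t w|) <= e.

Lemma ned_L1_bound f : ned_L1 f ->
  exists2 A : R, 0 < A & forall t, (1 <= t)%N -> Ex (fun w => `|centered f t w|) <= A.
Proof.
move=> [iF af]; have [B B0 [g [mg _] fg]] := af 1 ltr01.
exists (2 * (1 + B)); first by rewrite mulr_gt0// addr_gt0.
move=> t t1; have [mgt gB] := mg t t1; have ig := itg_bounded P mgt gB.
have Ef : Ex (fun w => `|f t w|) <= 1 + B.
  apply: (@le_trans _ _ (Ex (fun w => `|f t w - g t w| + B))).
    apply: Ex_le; [exact/itg_norm/iF| |].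
      by apply: itgD; [exact/itg_norm/itgB/ig/iF|exact: itg_cst].
    move=> w; rewrite -{1}(subrK (g t w) (f t w)) (le_trans (ler_normD _ _))//.
    by rewrite lerD2l.
  rewrite ExD ?Ex_cst; [|exact/itg_norm/itgB/ig/iF|exact: itg_cst].
  by rewrite lerD2r fg.
apply: (@le_trans _ _ (Ex (fun w => `|f t w| + `|Ex (f t)|))).
  apply: Ex_le.
  - by apply: itg_norm; apply: itgB; [exact: iF|exact: itg_cst].
  - by apply: itgD; [exact/itg_norm/iF|exact: itg_cst].
  - by move=> w; exact: ler_normB.
rewrite ExD ?Ex_cst; [|exact/itg_norm/iF|exact: itg_cst].
rewrite (_ : 2 * (1 + B) = (1 + B) + (1 + B)); last by ring.
by rewrite lerD// (le_trans (Ex_norm (iF t t1))).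
Qed.

Hypothesis mix : mixing_coef V m @[m --> \oo] --> (0 : R).

Lemma ned_lln (f : nat -> W -> R) (C e : R) : 0 < C -> 0 < e -> ned_L1 f ->
  exists2 b0 : R, 0 < b0 & forall (b : R) (s : seq nat) (c : nat -> R),
    b0 <= b -> uniq s -> (forall l, l \in s -> (1 <= l)%N) ->
    (size s)%:R <= 5 * b -> (forall l, `|c l| <= C / b) ->
  Ex (fun w => `|\sum_(l <- s) c l * centered f l w|) <= e.
Proof.
move=> C0 e0 [iF af].
(* Centring doubles the approximation error to e / (10 C), and the weights sum to at most 5 b (C /
   b) = 5 C; the replacement thus costs e / 2. *)
have dl0 : 0 < e / (20 * C) by rewrite divr_gt0// mulr_gt0.
have [B B0 [g ng fg]] := af _ dl0.
have e20 : 0 < e / 2 by rewrite divr_gt0.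
have [b0 b00 H] := bounded_ned_lln mix B0 C0 e20 ng.
exists b0 => // b s c b0b us s1 sb cC.
have {}H := H b s c b0b us s1 sb cC.
have bpos : 0 < b := lt_le_trans b00 b0b.
have m1 l : (1 <= maxn l 1)%N by rewrite leq_maxr.
pose f1 l := f (maxn l 1); pose g1 l := g (maxn l 1).
have if1 l : itg (f1 l) by exact: iF.
have ig1 l : itg (g1 l).
  by have [h _] := ng; have [mg gB] := h _ (m1 l); exact: itg_bounded gB.
have toS (u : nat -> W -> R) :
    (fun w => `|\sum_(l <- s) c l * centered u l w|) =
    fun w => `|\sum_(l <- s) c l * centered (fun l => u (maxn l 1)) l w|.
  apply/funext => w; congr `|_|; apply: eq_big_seq => l /s1 l1.
  by rewrite /centered (maxn_idPl l1).
rewrite toS in H; rewrite toS.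
have icf l : itg (fun w => c l * centered f1 l w).
  by apply: itgZ; apply: itgB => //; exact: itg_cst.
have icg l : itg (fun w => c l * centered g1 l w).
  by apply: itgZ; apply: itgB => //; exact: itg_cst.
pose r l w := centered f1 l w - centered g1 l w.
have ir l : itg (r l).
  by apply: itgB; apply: itgB => //; exact: itg_cst.
have Er l : Ex (fun w => `|r l w|) <= e / (10 * C).
  apply: (@le_trans _ _ (Ex (fun w => `|f1 l w - g1 l w| + `|Ex (f1 l) - Ex (g1 l)|))).
    apply: Ex_le; [exact/itg_norm/ir| |].
      by apply: itgD; [exact/itg_norm/itgB|exact: itg_cst].
    move=> w; rewrite (_ : r l w = (f1 l w - g1 l w) - (Ex (f1 l) - Ex (g1 l))).
      exact: ler_normB.
    by rewrite /r /centered; ring.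
  rewrite ExD ?Ex_cst; [|exact/itg_norm/itgB|exact: itg_cst].
  rewrite (_ : e / (10 * C) = e / (20 * C) + e / (20 * C)); last first.
    by field; rewrite gt_eqF.
  rewrite lerD ?fg// -ExB// (le_trans (Ex_norm (itgB _ _)))// fg//.
apply: (@le_trans _ _ (Ex (fun w => `|\sum_(l <- s) c l * centered g1 l w| +
   \sum_(l <- s) C / b * `|r l w|))).
  have irs : itg (fun w => \sum_(l <- s) C / b * `|r l w|).
    by apply: itg_sum => l; apply: itgZ; exact: itg_norm.
  apply: Ex_le.
  - by apply: itg_norm; exact: itg_sum.
  - by apply: itgD => //; apply: itg_norm; exact: itg_sum.
  - move=> w; rewrite (_ : \sum_(l <- s) c l * centered f1 l w =
       \sum_(l <- s) c l * centered g1 l w + \sum_(l <- s) c l * r l w).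
      rewrite (le_trans (ler_normD _ _))// lerD2l (le_trans (ler_norm_sum _ _ _))//.
      by apply: ler_sum => l _; rewrite normrM ler_wpM2r.
    by rewrite -big_split/=; apply: eq_bigr => l _; rewrite /r; ring.
rewrite ExD; last 2 first.
- by apply: itg_norm; exact: itg_sum.
- by apply: itg_sum => l; apply: itgZ; exact: itg_norm.
rewrite [leRHS](splitr e) lerD// Ex_sum; last first.
  by move=> l; apply: itgZ; exact: itg_norm.
apply: (@le_trans _ _ (\sum_(l <- s) C / b * (e / (10 * C)))).
  apply: ler_sum => l _; rewrite ExZ; last exact: itg_norm.
  by rewrite ler_wpM2l// divr_ge0// ltW.
rewrite big_const_seq count_predT iter_addr addr0 -[leLHS]mulr_natl.
apply: (@le_trans _ _ (5 * b * (C / b * (e / (10 * C))))).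
  by rewrite ler_wpM2r// !mulr_ge0 ?invr_ge0 ?mulr_ge0 ?(ltW C0) ?(ltW bpos) ?(ltW e0).
by rewrite le_eqVlt; apply/orP; left; apply/eqP; field; rewrite !gt_eqF.
Qed.

(* A uniform law over the whole window follows from the law at the points of a
   grid with mesh of order [b], because the kernel is Lipschitz. *)
Lemma ned_uniform_lln (K : R -> R) (L M : R) (f : nat -> W -> R) (e : R) :
  0 < L -> (forall u v, `|K u - K v| <= L * `|u - v|) ->
  0 < M -> (forall u, `|K u| <= M) -> 0 < e -> ned_L1 f ->
  exists2 b0 : R, 0 < b0 & forall (b : R) (t : nat), b0 <= b ->
    let n := Num.truncn b in (2 * n < t)%N ->
    exists H : W -> R, [/\ itg H, forall w, 0 <= H w, Ex H <= e &
      forall i w, (t - n <= i <= t + n)%N ->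
       `|b^-1 * \sum_(t - 2 * n <= l < (t + 2 * n).+1) kw K b i l * centered f l w| <= H w].
Proof.
move=> L0 KL M0 KM e0 nf.
have [A A0 fA] := ned_L1_bound nf.
have [iF _] := nf.
(* Mesh relative to b: moving a centre by dl b changes the average by at most L dl Y with E[Y] <= 5
   A, that is by at most e / 2 in mean. *)
pose dl := Num.min 1 (e / (10 * A * L)).
have dl0 : 0 < dl by rewrite lt_min ltr01 divr_gt0 ?mulr_gt0.
have dlL : L * dl * (5 * A) <= e / 2.
  have dle : dl <= e / (10 * A * L) by rewrite ge_min lexx orbT.
  apply: (@le_trans _ _ (L * (e / (10 * A * L)) * (5 * A))).
    by rewrite ler_wpM2r ?mulr_ge0 ?(ltW A0)// ler_wpM2l// ltW.
  by rewrite le_eqVlt; apply/orP; left; apply/eqP; field; rewrite !gt_eqF.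
(* The spacing s0 = floor(dl b) is at least dl b / 2, since dl b >= 2. A window of length at most 2
   b therefore needs grid indices up to 4 / dl. *)
pose N := (Num.truncn (4 / dl)).+2.
have e'0 : 0 < e / (2 * N%:R) by rewrite divr_gt0// mulr_gt0// ltr0n.
have [b0 b00 lln] := ned_lln M0 e'0 nf.
exists (Num.max b0 (Num.max 1 (2 / dl))); first by rewrite lt_max b00.
move=> b t; rewrite !ge_max => /and3P[b0b b1 bdl].
move nE : (Num.truncn b) => n /= nt.
have bpos : 0 < b := lt_le_trans b00 b0b.
have nb : n%:R <= b by rewrite -nE truncn_le ltW.
move s0E : (Num.truncn (dl * b)) => s0.
have db2 : 2 <= dl * b by rewrite mulrC -ler_pdivrMr.
have s0le : s0%:R <= dl * b by rewrite -s0E truncn_le (le_trans _ db2).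
have s0ge : dl * b / 2 <= s0%:R.
  have := truncnS_gt (dl * b); rewrite -natr1 s0E => ?; lra.
have s00 : (0 < s0)%N by rewrite -s0E truncn_gt0 (le_trans _ db2)// ler1n.
(* Radius 2 n contains the kernel supports of all centres within n of t, so a single index set
   serves the whole window. *)
pose J := index_iota (t - 2 * n) (t + 2 * n).+1.
have J1 l : l \in J -> (1 <= l)%N.
  by rewrite mem_index_iota => /andP[+ _]; apply: leq_trans; rewrite subn_gt0.
have uJ : uniq J by exact: iota_uniq.
have sJ : (size J)%:R <= 5 * b.
  rewrite size_iota (_ : (_ - _)%N = (4 * n).+1); last by clear - nt; lia.
  rewrite -natr1 natrM; lra.
pose S i w := b^-1 * \sum_(l <- J) kw K b i l * centered f l w.
pose gr k := ((t - n) + k * s0)%N.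
pose f1 l := f (maxn l 1).
have if1 l : itg (centered f1 l).
  by apply: itgB; [apply: iF; rewrite leq_maxr|exact: itg_cst].
pose Y w := b^-1 * \sum_(l <- J) `|centered f1 l w|.
have J1E (c : nat -> R) (F : R -> R) w : \sum_(l <- J) c l * F (centered f l w) =
    \sum_(l <- J) c l * F (centered f1 l w).
  by apply: eq_big_seq => l /J1 l1; rewrite /centered /f1 (maxn_idPl l1).
have SE i w : S i w = b^-1 * \sum_(l <- J) kw K b i l * centered f1 l w.
  by congr (_ * _); exact: (J1E _ id).
have iS i : itg (S i).
  rewrite (_ : S i = fun w => b^-1 * \sum_(l <- J) kw K b i l * centered f1 l w).
    by apply: itgZ; apply: itg_sum => l; exact: itgZ.
  by apply/funext => w; exact: SE.
have iY : itg Y by apply: itgZ; apply: itg_sum => l; exact: itg_norm.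
have ES i : Ex (fun w => `|S i w|) <= e / (2 * N%:R).
  have := lln b J (fun l => b^-1 * kw K b i l) b0b uJ J1 sJ.
  have -> : (fun w => `|\sum_(l <- J) b^-1 * kw K b i l * centered f l w|) =
      fun w => `|S i w|.
    apply/funext => w; rewrite /S mulr_sumr; congr `|_|.
    by apply: eq_bigr => l _; rewrite mulrA.
  apply => l; rewrite normrM gtr0_norm ?invr_gt0// mulrC.
  by apply: ler_wpM2r; [rewrite invr_ge0 ltW|exact: KM].
have EY : Ex Y <= 5 * A.
  rewrite ExZ; last by apply: itg_sum => l; exact: itg_norm.
  rewrite Ex_sum; last by move=> l; exact: itg_norm.
  rewrite mulrC ler_pdivrMr//.
  apply: (@le_trans _ _ (\sum_(l <- J) A)).
    by apply: ler_sum => l _; rewrite fA// leq_maxr.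
  rewrite big_const_seq count_predT iter_addr addr0 -[leLHS]mulr_natl.
  rewrite (_ : 5 * A * b = 5 * b * A); last by ring.
  by rewrite ler_wpM2r// ltW.
have Y0 w : 0 <= Y w by rewrite mulr_ge0 ?invr_ge0 ?(ltW bpos)// sumr_ge0.
(* The maximum over the grid is replaced by a sum. [N] does not depend on b, so each term may be
   given the tolerance e / (2 N). *)
exists (fun w => \sum_(k < N) `|S (gr k) w| + L * dl * Y w); split.
- apply: itgD; first by apply: itg_sum => k; exact: itg_norm.
  exact: itgZ.
- move=> w; rewrite addr_ge0 ?sumr_ge0// mulr_ge0// mulr_ge0// ltW//.
- rewrite ExD; [|by apply: itg_sum => k; exact: itg_norm|exact: itgZ].
  rewrite [leRHS](splitr e) lerD//.
    rewrite Ex_sum; last by move=> k; exact: itg_norm.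
    apply: (@le_trans _ _ (\sum_(k < N) e / (2 * N%:R))).
      by apply: ler_sum => k _; exact: ES.
    rewrite sumr_const card_ord -[leLHS]mulr_natl.
    rewrite le_eqVlt; apply/orP; left; apply/eqP; field.
    by rewrite pnatr_eq0.
  rewrite ExZ//; apply: le_trans dlL; rewrite ler_wpM2l// mulr_ge0// ltW//.
move=> i w /andP[i1 i2].
move kE0 : ((i - (t - n)) %/ s0)%N => k.
have kE : (i - (t - n) = k * s0 + (i - (t - n)) %% s0)%N by rewrite -kE0; exact: divn_eq.
have kmod : ((i - (t - n)) %% s0 < s0)%N by rewrite ltn_mod.
have kN : (k < N)%N.
  rewrite /N ltnS -(ler_nat R).
  apply: (@le_trans _ _ (4 / dl)); last exact/ltW/truncnS_gt.
  rewrite ler_pdivlMr//.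
  have h1 : k%:R * s0%:R <= 2 * b.
    rewrite -natrM; apply: (@le_trans _ _ (2 * n)%:R); last first.
      by rewrite natrM ler_wpM2l.
    by rewrite ler_nat; clear - kE i1 i2; lia.
  have h2 : k%:R * (dl * b / 2) <= 2 * b.
    by apply: le_trans h1; rewrite ler_wpM2l.
  rewrite -(ler_pM2r bpos); lra.
have ig : `|i%:R - (gr k)%:R| <= dl * b :> R.
  apply: le_trans s0le.
  have gi : (gr k <= i)%N by rewrite /gr; clear - kE i1; lia.
  by rewrite -natrB// ger0_norm// ler_nat /gr; clear - kE kmod i1; lia.
rewrite -/J -/(S i w).
have -> : S i w = S (gr k) w + (S i w - S (gr k) w) by ring.
rewrite (le_trans (ler_normD _ _))// lerD//.
  by rewrite (bigD1 (Ordinal kN))//= lerDl sumr_ge0.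
rewrite !SE -mulrBr -sumrB normrM gtr0_norm ?invr_gt0// /Y mulrCA.
rewrite ler_wpM2l ?invr_ge0 ?(ltW bpos)//.
rewrite (le_trans (ler_norm_sum _ _ _))// mulr_sumr.
apply: ler_sum => l _; rewrite -mulrBl normrM ler_wpM2r//.
rewrite (le_trans (KL _ _))// ler_wpM2l ?(ltW L0)//.
rewrite -mulrBl (_ : i%:R - l%:R - _ = i%:R - (gr k)%:R); last by ring.
by rewrite normrM [`|b^-1|]gtr0_norm ?invr_gt0// ler_pdivrMr.
Qed.

End LawOfLargeNumbers.

Section PowerLimits.
Context {R : realType}.

Lemma near_powR_ge (s M : R) : 0 < s -> \forall n \near \oo, M <= n%:R `^ s.
Proof.
move=> s0; pose N := (Num.truncn (`|M| `^ s^-1)).+1.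
exists N => // n /= Nn.
apply: (le_trans (ler_norm M)).
have -> : `|M| = (`|M| `^ s^-1) `^ s by rewrite -powRrM mulVf ?gt_eqF// powRr1.
rewrite ge0_ler_powR ?nnegrE ?powR_ge0 ?(ltW s0)//.
by rewrite (le_trans (ltW (truncnS_gt _)))// ler_nat.
Qed.

Lemma near_powR_le (s e : R) : 0 < s -> 0 < e ->
  \forall n \near \oo, n%:R `^ (- s) <= e.
Proof.
move=> s0 e0; near=> n.
have h : e^-1 <= n%:R `^ s by near: n; exact: near_powR_ge.
have p0 : 0 < n%:R `^ s :> R by apply: lt_le_trans h; rewrite invr_gt0.
by rewrite powRN -[leRHS]invrK lef_pV2 ?posrE// invr_gt0.
Unshelve. all: end_near. Qed.

Lemma of_size_cvg0 (a : R) (nu : nat -> R) : 0 < a -> of_size a nu ->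
  forall e, 0 < e -> \forall n \near \oo, `|nu n| <= e.
Proof.
move=> a0 [dl [dl0 /eqO_exP[k k0 H]]] e e0.
near=> n.
have h1 : `|nu n| <= k * `|n%:R `^ (- a - dl)| by near: n.
apply: (le_trans h1); rewrite ger0_norm ?powR_ge0// mulrC -ler_pdivlMr//.
near: n; rewrite -opprD; apply: near_powR_le; first by rewrite addr_gt0.
by rewrite divr_gt0.
Unshelve. all: end_near. Qed.

End PowerLimits.

(** * Truncation of products of four coordinates *)

Section Truncation.
Context {R : realType}.
Implicit Types (a b u B : R).

Definition clip B u := Num.max (- B) (Num.min B u).

Lemma clip_bound B u : 0 < B -> `|clip B u| <= B.
Proof.
move=> B0; rewrite /clip ler_norml le_max lexx/= ge_max ge_min lexx /= andbT.
by lra.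
Qed.

Lemma clip_lip B a b : 0 < B -> `|clip B a - clip B b| <= `|a - b|.
Proof.
move=> B0; rewrite /clip.
have [h1|h1] := leP B a; have [h2|h2] := leP B b;
  rewrite ?(@max_r _ _ (- B) B) //; try lra.
- by rewrite subrr normr0.
- have [h3|h3] := leP (- B) b; rewrite [leRHS]ger0_norm ?ger0_norm; lra.
- have [h3|h3] := leP (- B) a; rewrite [leRHS]ler0_norm ?ler0_norm; lra.
have [h3|h3] := leP (- B) a; have [h4|h4] := leP (- B) b => //.
- rewrite [leRHS]ger0_norm ?ger0_norm; lra.
- rewrite [leRHS]ler0_norm ?ler0_norm; lra.
- by rewrite subrr normr0.
Qed.

Lemma clip_id B u : `|u| <= B -> clip B u = u.
Proof.
rewrite ler_norml => /andP[h1 h2].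
by rewrite /clip min_r// max_r.
Qed.

(** Contraction towards 0 passes to products, and it bounds the error of a product of clipped
    factors by the modulus of the product itself. *)
Definition shrinks b a := exists2 c : R, 0 <= c <= 1 & b = c * a.

Lemma clip_shrinks B u : 0 < B -> shrinks (clip B u) u.
Proof.
move=> B0; have [uB|Bu] := leP `|u| B.
  by exists 1; rewrite ?ler01 ?lexx// mul1r clip_id.
have u0 : `|u| != 0 by rewrite gt_eqF// (lt_trans B0).
exists (B / `|u|); first by rewrite divr_ge0 ?(ltW B0)//= ler_pdivrMr ?mul1r ?ltW// (lt_trans B0).
have [u1|u1] := leP 0 u.
  rewrite (ger0_norm u1) in Bu u0 *; rewrite /clip min_l ?ltW// max_r; last lra.
  by field.
rewrite (ltr0_norm u1) in Bu u0 *; rewrite /clip min_r; last lra.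
rewrite max_l; last lra.
by field; move: u0; rewrite oppr_eq0.
Qed.

Lemma shrinksM b a b' a' : shrinks b a -> shrinks b' a' -> shrinks (b * b') (a * a').
Proof.
move=> [c /andP[c0 c1] ->] [c' /andP[c0' c1'] ->]; exists (c * c'); last by ring.
by rewrite mulr_ge0// mulr_ile1.
Qed.

Lemma shrinks_dist b a : shrinks b a -> `|a - b| <= `|a|.
Proof.
move=> [c /andP[c0 c1] ->]; rewrite -{1}[a]mul1r -mulrBl normrM ler_piMl//.
by rewrite ger0_norm ?subr_ge0// lerBlDr lerDl.
Qed.

(** Let m be the largest modulus. If m <= B nothing is clipped. Otherwise the error is at most m^4 =
    m^(4 - 2 q) m^(2 q), and the first factor is at most B^(4 - 2 q) because 4 - 2 q < 0. *)
Lemma prod4_clip_dist (q B u1 u2 u3 u4 : R) : 2 < q -> 1 <= B ->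
  `|u1 * u2 * u3 * u4 - clip B u1 * clip B u2 * clip B u3 * clip B u4| <=
  B `^ (4 - 2 * q) *
    (`|u1| `^ (2 * q) + `|u2| `^ (2 * q) + `|u3| `^ (2 * q) + `|u4| `^ (2 * q)).
Proof.
move=> q2 B1; have B0 : 0 < B by lra.
set S := _ + _ + _ + _.
have p0 u : 0 <= `|u| `^ (2 * q) by exact: powR_ge0.
have S0 : 0 <= S by rewrite /S !addr_ge0.
pose m := Num.max (Num.max `|u1| `|u2|) (Num.max `|u3| `|u4|).
have mE : [/\ `|u1| <= m, `|u2| <= m, `|u3| <= m & `|u4| <= m].
  by rewrite /m !le_max !lexx !orbT.
have [m1 m2 m3 m4] := mE.
have [mB|Bm] := leP m B.
  rewrite !clip_id ?(le_trans _ mB)// subrr normr0 mulr_ge0// powR_ge0//.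
have m0 : 0 < m by lra.
have sh : `|u1 * u2 * u3 * u4 - clip B u1 * clip B u2 * clip B u3 * clip B u4| <= m ^+ 4.
  apply: le_trans (shrinks_dist _) _.
    by apply: shrinksM; [apply: shrinksM; [apply: shrinksM|]|]; exact: clip_shrinks.
  rewrite !normrM !exprS expr0 mulr1 !mulrA.
  by rewrite ler_pM ?mulr_ge0// ler_pM ?mulr_ge0// ler_pM.
apply: (le_trans sh).
have mS : m `^ (2 * q) <= S.
  rewrite /S /m; have [_|_] := leP (Num.max `|u1| `|u2|) (Num.max `|u3| `|u4|).
    have [_|_] := leP `|u3| `|u4|; first by rewrite lerDr !addr_ge0.
    by rewrite -addrA addrC -addrA lerDl !addr_ge0.
  have [_|_] := leP `|u1| `|u2|; last by rewrite -!addrA lerDl !addr_ge0.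
  by rewrite -!addrA [leRHS]addrCA lerDl !addr_ge0.
have -> : m ^+ 4 = m `^ (4 - 2 * q) * m `^ (2 * q).
  rewrite -powRD ?subrK; last by rewrite (gt_eqF m0) implybT.
  by rewrite powR_mulrn// ltW.
apply: ler_pM; rewrite ?powR_ge0//.
have -> : 4 - 2 * q = - (2 * q - 4) by ring.
rewrite !powRN lef_pV2 ?posrE ?powR_gt0//.
by rewrite ge0_ler_powR ?nnegrE ?(ltW B0) ?(ltW m0) ?(ltW Bm)//; lra.
Qed.

End Truncation.

Section Coordinates.
Context {d dV : measure_display} {W : measurableType d} {SV : measurableType dV}.
Context {R : realType}.
Variables (P : probability W R) (V : int -> {RV P >-> SV}) (q : R).
Hypothesis q2 : 2 < q.
Local Notation Ex := (Ex P).
Local Notation itg := (itg P).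

(** The approximants need not be bounded here: clipping is 1-Lipschitz, so it preserves L1 errors
    and yields [bounded_ned]. *)
Definition ned_moment (u : nat -> W -> R) :=
  [/\ forall t, (1 <= t)%N -> measurable_fun setT (u t),
      exists C : R, forall t, (1 <= t)%N ->
        itg (fun w => `|u t w| `^ (2 * q)) /\ Ex (fun w => `|u t w| `^ (2 * q)) <= C &
      forall e : R, 0 < e -> exists m : nat, forall t, (1 <= t)%N -> exists Y : W -> R,
        [/\ sigma_meas V (near_window t m) Y, itg (fun w => `|u t w - Y w|) &
            Ex (fun w => `|u t w - Y w|) <= e] ].

(** Pads products of two coordinates to products of four. *)
Lemma ned_moment_one : ned_moment (fun _ _ => 1).
Proof.
split=> //.
- exists 1 => t _; split; first exact: itg_cst.
  by rewrite Ex_cst normr1 powR1.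
- move=> e e0; exists 0%N => t _; exists (fun=> 1); split.
  + exact: measurable_cst.
  + by under [X in itg X]eq_fun do rewrite subrr normr0; exact: itg_cst.
  + by under [X in Ex X]eq_fun do rewrite subrr normr0; rewrite Ex_cst ltW.
Qed.

Lemma measurable_clip d' (T : measurableType d') (B : R) (f : T -> R) :
  measurable_fun setT f -> measurable_fun setT (fun w => clip B (f w)).
Proof.
by move=> mf; apply: measurable_maxr => //; exact: measurable_minr.
Qed.

Lemma clip_bounded_ned (B : R) u : 0 < B -> ned_moment u ->
  bounded_ned V (fun t w => clip B (u t w)) B.
Proof.
move=> B0 [mu _ au]; split=> [t t1|e e0].
  by split; [exact/measurable_clip/mu|move=> w; exact: clip_bound].
have [m Hm] := au e e0; exists m => t t1; have [Y [sY iY eY]] := Hm t t1.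
exists (fun w => clip B (Y w)); split.
- exact: measurable_clip.
- by move=> w; exact: clip_bound.
apply: le_trans eY; apply: Ex_le => //.
  have mY := sigma_meas_measurable sY.
  apply: itg_norm; apply: itgB.
    apply: (@itg_bounded _ _ _ _ _ B); first exact/measurable_clip/mu.
    by move=> w; exact: clip_bound.
  apply: (@itg_bounded _ _ _ _ _ B); first exact: measurable_clip.
  by move=> w; exact: clip_bound.
by move=> w; exact: clip_lip.
Qed.

(** Clipped products are [bounded_ned], and the clipping error is at most B^(4 - 2 q) times a
    bounded moment, which vanishes as B grows. This is where more than four moments are used. *)
Lemma prod4_ned_L1 u1 u2 u3 u4 : ned_moment u1 -> ned_moment u2 ->
  ned_moment u3 -> ned_moment u4 ->
  ned_L1 V (fun t w => u1 t w * u2 t w * u3 t w * u4 t w).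
Proof.
move=> n1 n2 n3 n4.
have [m1 [C1 H1] _] := n1; have [m2 [C2 H2] _] := n2.
have [m3 [C3 H3] _] := n3; have [m4 [C4 H4] _] := n4.
pose S t w := `|u1 t w| `^ (2 * q) + `|u2 t w| `^ (2 * q) + `|u3 t w| `^ (2 * q)
              + `|u4 t w| `^ (2 * q).
have iS t : (1 <= t)%N -> itg (S t) /\ Ex (S t) <= C1 + C2 + C3 + C4.
  move=> t1; have [i1 e1] := H1 t t1; have [i2 e2] := H2 t t1.
  have [i3 e3] := H3 t t1; have [i4 e4] := H4 t t1.
  have i12 := itgD i1 i2; have i123 := itgD i12 i3; have i1234 := itgD i123 i4.
  split; first exact: i1234.
  by rewrite (ExD i123 i4) (ExD i12 i3) (ExD i1 i2) !lerD.
pose f t w := u1 t w * u2 t w * u3 t w * u4 t w.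
pose g B t w := clip B (u1 t w) * clip B (u2 t w) * clip B (u3 t w) * clip B (u4 t w).
have fg B t w : 1 <= B -> `|f t w - g B t w| <= B `^ (4 - 2 * q) * S t w.
  by move=> B1; exact: prod4_clip_dist.
have mf t : (1 <= t)%N -> measurable_fun setT (f t).
  move=> t1; apply: measurable_funM (m4 t t1); apply: measurable_funM (m3 t t1).
  by apply: measurable_funM (m2 t t1); exact: m1.
have ng B : 0 < B -> bounded_ned V (g B) (B * B * B * B).
  move=> B0; have c u := @clip_bounded_ned B u B0.
  apply: bounded_nedM (c _ n4); rewrite ?mulr_gt0//.
  apply: bounded_nedM (c _ n3); rewrite ?mulr_gt0//.
  by apply: bounded_nedM (c _ n2); rewrite ?mulr_gt0//; exact: c.
have itg_g B t : 0 < B -> (1 <= t)%N -> itg (g B t).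
  by move=> B0 t1; have [/(_ t t1)[mg gB] _] := ng B B0; exact: itg_bounded gB.
have itg_f t : (1 <= t)%N -> itg (f t).
  move=> t1; have [iSt _] := iS t t1.
  (* Clipping at level 1 already gives an integrable majorant of the product. *)
  have i1 : itg (fun w => 1 `^ (4 - 2 * q) * S t w + `|g 1 t w|).
    by apply: itgD; [exact: itgZ|apply/itg_norm/itg_g].
  apply: (itg_dom (mf t t1) i1) => w.
  rewrite -{1}(subrK (g 1 t w) (f t w)) (le_trans (ler_normD _ _))//.
  by rewrite lerD2r fg.
split=> [//|e e0].
pose C := `|C1 + C2 + C3 + C4| + 1.
have C0 : 0 < C by rewrite ltr_wpDl.
have eC : 0 < e / C by rewrite divr_gt0.
have s0 : 0 < 2 * q - 4.
  by rewrite subr_gt0 (_ : 4 = 2 * 2) ?ltr_pM2l//; ring.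
have [N _ HN] := near_powR_le s0 eC.
have B1 : 1 <= (N.+1)%:R :> R by rewrite ler1n.
have B0 : 0 < (N.+1)%:R :> R by rewrite ltr0n.
exists (N.+1%:R * N.+1%:R * N.+1%:R * N.+1%:R); first by rewrite !mulr_gt0.
exists (g N.+1%:R); first exact: ng.
move=> t t1; have [iSt eSt] := iS t t1.
apply: (@le_trans _ _ (Ex (fun w => N.+1%:R `^ (4 - 2 * q) * S t w))).
  apply: Ex_le; [apply/itg_norm/itgB; [exact: itg_f|exact: itg_g]|exact: itgZ|].
  by move=> w; exact: fg.
rewrite ExZ//; apply: (@le_trans _ _ (e / C * C)); last first.
  by rewrite divfK ?gt_eqF.
apply: ler_pM; rewrite ?powR_ge0//.
- apply: Ex_ge0 => w; rewrite /S !addr_ge0 ?powR_ge0//.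
- have -> : 4 - 2 * q = - (2 * q - 4) by ring.
  by apply: HN => /=.
- by rewrite (le_trans eSt)// (le_trans (ler_norm _))// lerDl.
Qed.

End Coordinates.

(** * Consequences of the moment and dependence condition *)

Section FromDa.
Context {d : measure_display} {W : measurableType d} {R : realType}.
Variables (P : probability W R) (p : nat).
Variables (x : nat -> W -> 'cV[R]_p) (eps : nat -> {RV P >-> R}).
Hypothesis x_rv : forall t, (1 <= t)%N -> random_vector (x t).

Lemma frobE (m n : nat) (A : 'M[R]_(m, n)) :
  frob A = Num.sqrt (\sum_(j < n) \sum_(i < m) A i j ^+ 2).
Proof.
congr Num.sqrt; apply: eq_bigr => j _; rewrite mxE.
by apply: eq_bigr => i _; rewrite mxE expr2.
Qed.

Lemma mxBE (m n : nat) (A B : 'M[R]_(m, n)) i j : (A - B) i j = A i j - B i j.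
Proof. by rewrite !mxE. Qed.

Lemma ler_norm_frob (m n : nat) (A : 'M[R]_(m, n)) i j : `|A i j| <= frob A.
Proof.
rewrite frobE -sqrtr_sqr; apply: ler_wsqrtr.
rewrite (bigD1 j)//= (bigD1 i)//= -addrA lerDl addr_ge0//.
  by apply: sumr_ge0 => k _; rewrite sqr_ge0.
by apply: sumr_ge0 => k _; apply: sumr_ge0 => l _; rewrite sqr_ge0.
Qed.

Lemma measurable_sqrt d' (T : measurableType d') (f : T -> R) :
  measurable_fun setT f -> measurable_fun setT (fun w => Num.sqrt (f w)).
Proof.
apply: (measurableT_comp (f := @Num.sqrt R)).
by apply: continuous_measurable_fun; exact: sqrt_continuous.
Qed.

Lemma measurable_frob d' (T : measurableType d') (m n : nat) (A : T -> 'M[R]_(m, n)) :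
  (forall i j, measurable_fun setT (fun w => A w i j)) ->
  measurable_fun setT (fun w => frob (A w)).
Proof.
move=> mA; under eq_fun do rewrite frobE; apply: measurable_sqrt.
by do 2 (apply: measurable_sum => ?); exact: measurable_funX.
Qed.

Lemma frob_ge0 (m n : nat) (A : 'M[R]_(m, n)) : 0 <= frob A.
Proof. exact: sqrtr_ge0. Qed.

(** For q > 2 both sizes are positive, so the mixing and approximation coefficients tend to 0; the
    bound on the constants d_t makes the approximation uniform in t. The L2 error of the stacked
    vector dominates the L1 error of each coordinate. *)
Lemma cond_Da_ned : cond_Da x eps ->
  exists q : R, 2 < q /\
  exists (dV : measure_display) (SV : measurableType dV) (V : int -> {RV P >-> SV}),
    [/\ mixing_coef V m @[m --> \oo] --> (0 : R),
        forall i, ned_moment V q (fun t w => x t w i 0),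
        ned_moment V q (fun t w => eps t w) &
        exists C, forall t, (1 <= t)%N ->
          itg P (fun w => frob (x t w) `^ (2 * q)) /\
          Ex P (fun w => frob (x t w) `^ (2 * q)) <= C].
Proof.
move=> [q [q2 [dV [SV [V [dc [mixs dc0 [D dcD] [nu [nus ned]]]]]]] [Cx xC] [Ce eC]]].
have q20 : 0 < q - 2 by lra.
exists q; split => //; exists dV, SV, V.
have mfx t : (1 <= t)%N -> measurable_fun setT (fun w => frob (x t w)).
  by move=> t1; apply: measurable_frob => i j; rewrite (ord1 j); exact: x_rv.
have mpow (f : W -> R) (a : R) : measurable_fun setT f ->
    measurable_fun setT (fun w => f w `^ a).
  move=> mf; exact: (measurableT_comp (measurable_powR a) mf).
have xq t : (1 <= t)%N -> itg P (fun w => frob (x t w) `^ (2 * q)) /\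
          Ex P (fun w => frob (x t w) `^ (2 * q)) <= Cx.
  move=> t1; apply: itg_ge0; first exact/mpow/mfx.
    by move=> w; exact: powR_ge0.
  by have := xC t t1; rewrite unlock.
have eq_ t : (1 <= t)%N -> itg P (fun w => `|eps t w| `^ (2 * q)) /\
          Ex P (fun w => `|eps t w| `^ (2 * q)) <= Ce.
  move=> t1; apply: itg_ge0; first exact/mpow/measurableT_comp.
    by move=> w; exact: powR_ge0.
  by have := eC t t1; rewrite unlock.
have nucv e : 0 < e -> \forall n \near \oo, `|nu n| <= e.
  by move=> e0; apply: (of_size_cvg0 _ nus) => //; rewrite divr_gt0// mulr_gt0//; lra.
have approx k e : 0 < e -> exists m : nat, forall t, (1 <= t)%N -> exists Y : W -> R,
    [/\ sigma_meas V (near_window t m) Y,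
      itg P (fun w => `|col_mx (x t w) (eps t w)%:M k 0 - Y w|) &
      Ex P (fun w => `|col_mx (x t w) (eps t w)%:M k 0 - Y w|) <= e].
  move=> e0; have D0 : 0 < `|D| + 1 by rewrite ltr_wpDl.
  have [m _ Hm] := nucv (e / (`|D| + 1)) ltac:(by rewrite divr_gt0).
  exists m => t t1; have [Y [cY LY]] := ned t m t1.
  have sY i : sigma_meas V (near_window t m) (fun w => Y w i 0).
    by apply/sigma_measP; have [h _ _] := cY i.
  have mY i : measurable_fun setT (fun w => Y w i 0) by exact: sigma_meas_measurable (sY i).
  have mz i : measurable_fun setT (fun w => col_mx (x t w) (eps t w)%:M i 0).
    rewrite -(fintype.splitK i); case: (fintype.split i) => j /=.
      by under eq_fun do rewrite col_mxEu; exact: x_rv.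
    by under eq_fun do rewrite col_mxEd mxE; rewrite (ord1 j) eqxx; exact: measurable_funPT.
  pose F w := frob (col_mx (x t w) (eps t w)%:M - Y w).
  have mF : measurable_fun setT F.
    apply: measurable_frob => i j; rewrite (ord1 j).
    by under eq_fun do rewrite mxBE; exact: measurable_funB.
  have F2 : (\int[P]_w (F w ^+ 2)%:E <= (e ^+ 2)%:E)%E.
    have -> : (\int[P]_w (F w ^+ 2)%:E = \int[P]_w (`|(F w)%:E| `^ 2))%E.
      apply: eq_integral => w _ /=; rewrite ger0_norm ?frob_ge0//
       powR_mulrn ?frob_ge0//.
    rewrite -poweR_Lnorm//.
    have h : (Lnorm P 2%:E (fun w => (F w)%:E) <= e%:E)%E.
      apply: (le_trans LY); rewrite lee_fin.
      have hm : `|nu m| <= e / (`|D| + 1) by apply: Hm => /=.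
      apply: (@le_trans _ _ (dc t * `|nu m|)); first by rewrite ler_wpM2l ?ler_norm// ltW// dc0.
      rewrite (_ : e = (`|D| + 1) * (e / (`|D| + 1))); last by field; rewrite gt_eqF.
      apply: ler_pM => //; first by rewrite ltW// dc0.
      by rewrite (le_trans (dcD t t1))// (le_trans (ler_norm _))// lerDl.
    have -> : ((e ^+ 2)%:E = e%:E `^ 2)%E by rewrite poweR_EFin powR_mulrn// ltW.
    by apply: gt0_ler_poweR => //; rewrite in_itv/= ?Lnorm_ge0 ?leey// lee_fin ltW.
  have [iF2 eF2] := @itg_ge0 _ _ _ P (fun w => F w ^+ 2) (e ^+ 2)
    ltac:(exact: measurable_funX) (fun w => sqr_ge0 _) F2.
  have iF : itg P F.
    apply: (itg_dom mF (itgD (itg_cst P 1) iF2)) => w.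
    rewrite ger0_norm ?frob_ge0//; have := sqr_ge0 (F w - 1); rewrite sqrrB.
    have := frob_ge0 (col_mx (x t w) (eps t w)%:M - Y w); rewrite -/(F w); nra.
  have kF w : `|col_mx (x t w) (eps t w)%:M k 0 - Y w k 0| <= F w.
    have := ler_norm_frob (col_mx (x t w) (eps t w)%:M - Y w) k 0.
    by rewrite mxBE.
  exists (fun w => Y w k 0).
  have ik : itg P (fun w => `|col_mx (x t w) (eps t w)%:M k 0 - Y w k 0|).
    apply: (itg_dom _ iF); last by move=> w; rewrite normr_id.
    apply: measurableT_comp => //; exact: measurable_funB.
  split => //; apply: (@le_trans _ _ (Ex P (fun w => `|F w|))); last exact: Ex_norm_sqr.
  apply: Ex_le => //; first exact: itg_norm.
  by move=> w; rewrite (le_trans (kF w))// ler_norm.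
split.
- apply/cvgrPdist_le => e e0; near=> n; rewrite sub0r normrN.
  by near: n; apply: (of_size_cvg0 _ mixs) => //; rewrite divr_gt0// mulr_gt0//; lra.
- move=> i; split.
  + by move=> t t1; exact: x_rv.
  + exists Cx => t t1; have [h1 h2] := xq t t1.
    have m1 : measurable_fun setT (fun w => `|x t w i 0| `^ (2 * q)).
      by apply: mpow; apply: measurableT_comp => //; exact: x_rv.
    have le w : `|x t w i 0| `^ (2 * q) <= frob (x t w) `^ (2 * q).
      by rewrite ge0_ler_powR ?nnegrE ?frob_ge0 ?ler_norm_frob//; lra.
    have i1 : itg P (fun w => `|x t w i 0| `^ (2 * q)).
      by apply: (itg_dom m1 h1) => w; rewrite ger0_norm ?powR_ge0.
    split; [exact: i1|exact: le_trans (Ex_le i1 h1 le) h2].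
  + move=> e e0; have [m Hm] := approx (lshift 1 i) e e0.
    exists m => t t1; have [Y [sY iY eY]] := Hm t t1; exists Y.
    have E : (fun w => `|col_mx (x t w) (eps t w)%:M (lshift 1 i) 0 - Y w|) =
        fun w => `|x t w i 0 - Y w| by apply/funext => w; rewrite col_mxEu.
    by rewrite E in iY eY.
- split.
  + by move=> t _; exact: measurable_funPT.
  + by exists Ce => t t1; exact: eq_.
  + move=> e e0; have [m Hm] := approx (rshift p 0) e e0.
    exists m => t t1; have [Y [sY iY eY]] := Hm t t1; exists Y.
    have E : (fun w => `|col_mx (x t w) (eps t w)%:M (rshift p 0) 0 - Y w|) =
        fun w => `|eps t w - Y w| by apply/funext => w; rewrite col_mxEd mxE eqxx.
    by rewrite E in iY eY.
- by exists Cx.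
Unshelve. all: end_near. Qed.

End FromDa.

(** * Coercive matrices *)

Section FrobeniusNorm.
Context {R : realType}.

Lemma frob_cV_sqr (p : nat) (v : 'cV[R]_p) : frob v ^+ 2 = \sum_(i < p) v i 0 ^+ 2.
Proof.
rewrite frobE big_ord1 sqr_sqrtr//.
by apply: sumr_ge0 => i _; rewrite sqr_ge0.
Qed.

Definition dotv (p : nat) (u v : 'cV[R]_p) : R := (u^T *m v) 0 0.

Lemma dotvE (p : nat) (u v : 'cV[R]_p) : dotv u v = \sum_(i < p) u i 0 * v i 0.
Proof. by rewrite /dotv mxE; apply: eq_bigr => i _; rewrite mxE. Qed.

Lemma dotvC (p : nat) (u v : 'cV[R]_p) : dotv u v = dotv v u.
Proof. by rewrite !dotvE; apply: eq_bigr => i _; rewrite mulrC. Qed.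

Lemma dotvv (p : nat) (v : 'cV[R]_p) : dotv v v = frob v ^+ 2.
Proof. by rewrite frob_cV_sqr dotvE; apply: eq_bigr => i _; rewrite expr2. Qed.

Lemma dotvDr (p : nat) (u v w : 'cV[R]_p) : dotv u (v + w) = dotv u v + dotv u w.
Proof. by rewrite /dotv mulmxDr mxE. Qed.

Lemma dotvZr (p : nat) (u v : 'cV[R]_p) a : dotv u (a *: v) = a * dotv u v.
Proof. by rewrite /dotv -scalemxAr mxE. Qed.

Lemma dotv_sumr (p : nat) (I : Type) (s : seq I) (u : 'cV[R]_p) (F : I -> 'cV[R]_p) :
  dotv u (\sum_(i <- s) F i) = \sum_(i <- s) dotv u (F i).
Proof. by rewrite /dotv mulmx_sumr summxE. Qed.

Lemma dotv_mull (p m : nat) (M : 'M[R]_(p, m)) (u : 'cV[R]_p) (v : 'cV[R]_m) :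
  dotv u (M *m v) = dotv (M^T *m u) v.
Proof. by rewrite /dotv trmx_mul trmxK mulmxA. Qed.

Lemma frob0_eq0 (p : nat) (v : 'cV[R]_p) : frob v = 0 -> v = 0.
Proof.
move=> v0; apply/matrixP => i j; rewrite (ord1 j) mxE.
by apply/eqP; rewrite -normr_le0 -v0 ler_norm_frob.
Qed.

Lemma frob0 (p : nat) : frob (0 : 'cV[R]_p) = 0.
Proof.
apply/eqP; rewrite -sqrf_eq0 frob_cV_sqr big1// => i _.
by rewrite mxE expr0n.
Qed.

Lemma cauchy_schwarz (p : nat) (u v : 'cV[R]_p) : `|dotv u v| <= frob u * frob v.
Proof.
have [v0|v0] := eqVneq (frob v) 0.
  by rewrite (frob0_eq0 v0) /dotv mulmx0 mxE normr0 frob0 mulr0.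
rewrite -(ler_pXn2r (n := 2))// ?nnegrE ?mulr_ge0 ?frob_ge0//.
rewrite real_normK ?num_real// exprMn -!dotvv.
have vv : 0 < dotv v v by rewrite dotvv exprn_even_gt0.
have := sqr_ge0 (frob (dotv v v *: u - dotv u v *: v)).
rewrite -dotvv [X in 0 <= X](_ : _ = dotv v v * (dotv u u * dotv v v - dotv u v ^+ 2)).
  by rewrite pmulr_rge0// subr_ge0.
rewrite -scaleNr !(dotvDr, dotvZr).
rewrite [dotv (_ + _) u]dotvC [dotv (_ + _) v]dotvC !(dotvDr, dotvZr) [dotv v u]dotvC.
ring.
Qed.

Lemma ler_frobD (p : nat) (u v : 'cV[R]_p) : frob (u + v) <= frob u + frob v.
Proof.
rewrite -(ler_pXn2r (n := 2))// ?nnegrE ?addr_ge0 ?frob_ge0//.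
rewrite -dotvv dotvDr [dotv (u + v) u]dotvC [dotv (u + v) v]dotvC !dotvDr.
rewrite [dotv v u]dotvC !dotvv.
have := cauchy_schwarz u v; have := ler_norm (dotv u v) => h1 h2; nra.
Qed.

Lemma frobZ (p : nat) (v : 'cV[R]_p) a : frob (a *: v) = `|a| * frob v.
Proof.
apply: (@pexpIrn _ 2); rewrite ?nnegrE ?mulr_ge0 ?frob_ge0//.
rewrite exprMn real_normK ?num_real// -!dotvv dotvZr dotvC dotvZr; ring.
Qed.

Lemma frobN (p : nat) (v : 'cV[R]_p) : frob (- v) = frob v.
Proof. by rewrite -scaleN1r frobZ normrN1 mul1r. Qed.

Lemma ler_frob_sum (p : nat) (I : Type) (s : seq I) (F : I -> 'cV[R]_p) :
  frob (\sum_(i <- s) F i) <= \sum_(i <- s) frob (F i).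
Proof.
elim: s => [|i s IHs]; first by rewrite !big_nil frob0.
by rewrite !big_cons (le_trans (ler_frobD _ _))// lerD2l.
Qed.

Lemma frob_le_sum (p : nat) (v : 'cV[R]_p) : frob v <= \sum_(i < p) `|v i 0|.
Proof.
have -> : v = \sum_(i < p) v i 0 *: delta_mx i 0.
  apply/matrixP => i j; rewrite (ord1 j) summxE (bigD1 i)//= big1 ?addr0.
    by rewrite !mxE !eqxx mulr1.
  by move=> k ki; rewrite !mxE eq_sym (negbTE ki) mulr0.
rewrite (le_trans (ler_frob_sum _ _))//; apply: ler_sum => i _.
rewrite frobZ [X in _ <= `|X|](_ : _ = v i 0); last first.
  rewrite summxE (bigD1 i)//= big1 ?addr0; first by rewrite !mxE !eqxx mulr1.
  by move=> k ki; rewrite !mxE eq_sym (negbTE ki) mulr0.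
rewrite ler_piMr// -[leRHS](expr1n _ 2) -(ler_pXn2r (n := 2))// ?nnegrE ?frob_ge0//.
rewrite frob_cV_sqr (bigD1 i)//= big1 ?addr0; first by rewrite mxE !eqxx !expr1n.
by move=> k ki; rewrite mxE (negbTE ki) expr0n.
Qed.

(** The entrywise l1 norm: it dominates the operator norm, can be checked entry by entry, and makes
    the diagonal weights in [fill] nonnegative. *)
Definition norm1 (m p : nat) (M : 'M[R]_(m, p)) : R := \sum_(i < m) \sum_(j < p) `|M i j|.

Lemma norm1_ge0 (m p : nat) (M : 'M[R]_(m, p)) : 0 <= norm1 M.
Proof. by apply: sumr_ge0 => i _; exact: sumr_ge0. Qed.

Lemma frob_mulmx (m p : nat) (M : 'M[R]_(m, p)) (v : 'cV[R]_p) :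
  frob (M *m v) <= norm1 M * frob v.
Proof.
rewrite (le_trans (frob_le_sum _))// mulr_suml; apply: ler_sum => i _.
rewrite mxE (le_trans (ler_norm_sum _ _ _))// mulr_suml; apply: ler_sum => j _.
by rewrite normrM ler_wpM2l// ler_norm_frob.
Qed.

Lemma dotv_mulmx_le (p : nat) (M : 'M[R]_p) (v : 'cV[R]_p) :
  `|dotv v (M *m v)| <= norm1 M * frob v ^+ 2.
Proof.
rewrite (le_trans (cauchy_schwarz _ _))// mulrC expr2 mulrA ler_wpM2r ?frob_ge0//.
exact: frob_mulmx.
Qed.

End FrobeniusNorm.

Section Coercive.
Context {R : realType} {p : nat}.
Implicit Types (M S L : 'M[R]_p).

(** Stands for a lower bound on the smallest eigenvalue. It gives invertibility with the bound 1 / c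
    on the inverse, and it survives small perturbations. *)
Definition coercive M (c : R) := forall u : 'cV[R]_p, c * frob u ^+ 2 <= dotv u (M *m u).

Lemma unitmx_ker0 M : (forall v : 'cV[R]_p, M *m v = 0 -> v = 0) -> M \in unitmx.
Proof.
move=> H; rewrite -unitmx_tr unitmxE unitfE; apply/negP => /det0P[v v0 vM].
move/eqP: v0; apply; rewrite -[v]trmxK (H v^T) ?trmx0//.
by rewrite -[M]trmxK -trmx_mul vM trmx0.
Qed.

Lemma coercive_unitmx M c : 0 < c -> coercive M c -> M \in unitmx.
Proof.
move=> c0 cM; apply: unitmx_ker0 => v Mv0; apply: frob0_eq0.
have := cM v; rewrite Mv0 /dotv mulmx0 mxE => h; apply/eqP.
by rewrite -sqrf_eq0 eq_le sqr_ge0 andbT -(pmulr_rle0 _ c0).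
Qed.

(** For u = M^(-1) v: c |u|^2 <= u'M u = u'v <= |u| |v|. *)
Lemma coercive_inv M c (v : 'cV[R]_p) : 0 < c -> coercive M c ->
  frob (invmx M *m v) <= c^-1 * frob v.
Proof.
move=> c0 cM; have uM := coercive_unitmx c0 cM.
set u := invmx M *m v; have Mu : M *m u = v by rewrite /u mulKVmx.
have := cM u; rewrite Mu => h.
have h2 := le_trans h (le_trans (ler_norm _) (cauchy_schwarz u v)).
have [->|u0] := eqVneq (frob u) 0; first by rewrite mulr_ge0 ?invr_ge0 ?(ltW c0) ?frob_ge0.
have up : 0 < frob u by rewrite lt_def u0 frob_ge0.
by rewrite mulrC ler_pdivlMr// -(ler_pM2l up) (le_trans _ h2)// expr2; lra.
Qed.

Lemma coercive_perturb M S c : coercive S c -> norm1 (M - S) <= c / 2 -> coercive M (c / 2).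
Proof.
move=> cS MS u; have -> : M = S + (M - S) by rewrite addrC subrK.
rewrite mulmxDl dotvDr.
have h := dotv_mulmx_le (M - S) u; have h1 := cS u.
have h2 : norm1 (M - S) * frob u ^+ 2 <= c / 2 * frob u ^+ 2 by rewrite ler_wpM2r ?sqr_ge0.
have := ler_norm (- dotv u ((M - S) *m u)); rewrite normrN; lra.
Qed.

Lemma posdef_unitmx S : posdef S -> S \in unitmx.
Proof.
move=> [_ pS]; apply: unitmx_ker0 => v Sv0; apply/eqP; apply: contraT => v0.
by have := pS v v0; rewrite -mulmxA Sv0 mulmx0 mxE ltxx.
Qed.

End Coercive.

Section Cholesky.
Context {R : realType}.

(** One step of the Cholesky recursion. The Schur complement C - b b' / a is positive definite
    because its quadratic form at v is that of S at (- b'v / a, v). *)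
Lemma posdef_sqrt_schur (p : nat) (S : 'M[R]_(1 + p)) :
  (forall C : 'M[R]_p, posdef C -> exists L : 'M[R]_p, C = L *m L^T) ->
  posdef S -> exists L : 'M[R]_(1 + p), S = L *m L^T.
Proof.
move=> IHp [symS pS].
pose a := ulsubmx S 0 0; pose b := dlsubmx S; pose C := drsubmx S.
have Sblock : S = block_mx a%:M b^T b C.
  rewrite -[LHS]submxK; congr block_mx; first by rewrite [LHS]mx11_scalar.
  by rewrite /b trmx_dlsub symS.
have quad (c : R) (v : 'cV[R]_p) : ((col_mx c%:M v)^T *m S *m col_mx c%:M v) 0 0 =
    c ^+ 2 * a + 2 * c * (b^T *m v) 0 0 + (v^T *m C *m v) 0 0.
  rewrite Sblock tr_col_mx mul_row_block mul_row_col tr_scalar_mx !mulmxDl.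
  have vb : (v^T *m b) = (b^T *m v)^T by rewrite trmx_mul trmxK.
  rewrite vb !mul_scalar_mx !mul_mx_scalar -!scalemxAl.
  rewrite !mxE eqxx mulr1n; ring.
have a0 : 0 < a.
  have := pS (col_mx 1%:M 0); rewrite quad trmx0 mulmx0 mul0mx mul0mx !mxE => h.
  have : 0 < 1 ^+ 2 * a + 2 * 1 * 0 + 0.
    apply: h; apply/eqP => /(congr1 usubmx); rewrite col_mxKu linear0.
    by move=> /matrixP/(_ 0 0); rewrite !mxE eqxx => /eqP; rewrite oner_eq0.
  by rewrite expr1n mul1r mulr0 !addr0.
have [|L' L'E] := IHp (C - a^-1 *: (b *m b^T)).
  split.
    rewrite linearB linearZ /= trmx_mul trmxK; congr (_ - _).
    by rewrite /C trmx_drsub symS.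
  move=> v v0; pose c := - a^-1 * (b^T *m v) 0 0.
  have := pS (col_mx c%:M v); rewrite quad => h.
  have {}h : 0 < c ^+ 2 * a + 2 * c * (b^T *m v) 0 0 + (v^T *m C *m v) 0 0.
    apply: h; apply/eqP => /(congr1 dsubmx); rewrite col_mxKd linear0 => v0'.
    by rewrite v0' eqxx in v0.
  rewrite mulmxBr mulmxBl mxBE -scalemxAr -scalemxAl [X in _ < _ - X]mxE.
  have -> : (v^T *m (b *m b^T) *m v) 0 0 = (b^T *m v) 0 0 ^+ 2.
    rewrite !mulmxA -mulmxA; have -> : v^T *m b = (b^T *m v)^T by rewrite trmx_mul trmxK.
    by rewrite mxE big_ord1 mxE expr2.
  have E : c ^+ 2 * a + 2 * c * (b^T *m v) 0 0 = - (a^-1 * (b^T *m v) 0 0 ^+ 2).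
    by rewrite /c; field; rewrite gt_eqF.
  by rewrite E addrC in h.
have sa0 : Num.sqrt a != 0 by rewrite gt_eqF// sqrtr_gt0.
exists (block_mx (Num.sqrt a)%:M 0 ((Num.sqrt a)^-1 *: b) L').
rewrite tr_block_mx mulmx_block tr_scalar_mx !trmx0 !mul0mx !mulmx0 !addr0 -L'E.
rewrite Sblock; congr block_mx.
- by rewrite mul_scalar_mx scale_scalar_mx -expr2 sqr_sqrtr// ltW.
- by rewrite linearZ /= mul_scalar_mx scalerA mulfV// scale1r.
- by rewrite mul_mx_scalar scalerA mulfV// scale1r.
- rewrite linearZ /= -scalemxAl -scalemxAr scalerA -invfM -expr2 sqr_sqrtr ?ltW//.
  by rewrite addrC subrK.
Qed.

Lemma posdef_sqrt (p : nat) (S : 'M[R]_p) : posdef S -> exists L : 'M[R]_p, S = L *m L^T.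
Proof.
elim: p S => [|p IHp] S pS; last exact: (posdef_sqrt_schur (S := S) IHp pS).
by exists 0; apply/matrixP => -[].
Qed.

Lemma posdef_cholesky (p : nat) (S : 'M[R]_p) : posdef S ->
  exists2 L : 'M[R]_p, L \in unitmx & S = L *m L^T.
Proof.
move=> pS; have [L SL] := posdef_sqrt pS; exists L => //.
by have := posdef_unitmx pS; rewrite SL unitmx_mul => /andP[].
Qed.

(** With S = L L' one has u'S u = |L'u|^2, and |u| <= k |L'u| for any k above the norm of the
    inverse of L'. The summand 1 keeps k positive even for p = 0. *)
Lemma posdef_coercive (p : nat) (S : 'M[R]_p) : posdef S ->
  exists2 c : R, 0 < c & coercive S c.
Proof.
move=> pS; have [L uL SL] := posdef_cholesky pS.
have uLT : L^T \in unitmx by rewrite unitmx_tr.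
pose k := norm1 (invmx L^T) + 1.
have k0 : 0 < k by rewrite ltr_wpDl ?norm1_ge0.
exists (k ^+ 2)^-1; first by rewrite invr_gt0 exprn_gt0.
move=> u; rewrite mulrC ler_pdivrMr ?exprn_gt0//.
rewrite SL -mulmxA dotv_mull dotvv mulrC -exprMn ler_pXn2r ?nnegrE ?frob_ge0 ?mulr_ge0 ?frob_ge0 ?(ltW k0)//.
rewrite -{1}[u](mulKmx uLT) (le_trans (frob_mulmx _ _))// ler_wpM2r ?frob_ge0//.
by rewrite lerDl.
Qed.

End Cholesky.

(** * Gaussian coupling *)

Section GaussianCombinations.
Context {d : measure_display} {W : measurableType d} {R : realType}.
Variables (P : probability W R) (eta : nat -> {RV P >-> R}).
Hypothesis eta_iid : iid_std_normal eta.
Variables (J : eqType) (phi : J -> nat).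
Local Notation Ex_of := Ex.
Local Notation Ex := (Ex P).

(** Transports [Ex_cos_sum_eta] along an injective labelling, so that multipliers can be indexed by
    a sum type, as in [mult_index]. *)
Lemma Ex_cos_sum_inj (s : seq J) (a : J -> R) (b : R) : uniq (map phi s) ->
  Ex (fun w => cos (\sum_(j <- s) a j * eta (phi j) w + b)) =
  cos b * expR (- (\sum_(j <- s) a j ^+ 2) / 2).
Proof.
case: s => [|j0 s0] us.
  rewrite big_nil oppr0 mul0r expR0 mulr1 -[RHS](Ex_cst P).
  by congr (Ex_of _ _); apply/funext => w; rewrite big_nil add0r.
set s := j0 :: s0 in us *.
pose a' k := a (nth j0 s (index k (map phi s))).
have aE j : j \in s -> a' (phi j) = a j.
  move=> js; rewrite /a'; congr a.
  have -> : phi j = nth (phi j0) (map phi s) (index j s).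
    by rewrite (nth_map j0) ?index_mem// nth_index.
  by rewrite index_uniq ?size_map ?index_mem// nth_index.
have := Ex_cos_sum_eta eta_iid a' b us.
rewrite big_map (eq_big_seq (fun j => a j ^+ 2)); last by move=> j js; rewrite aE.
move=> <-; congr (Ex_of _ _); apply/funext => w; congr (cos (_ + _)).
by rewrite big_map; apply: eq_big_seq => j js; rewrite aE.
Qed.

Definition gauss_comb (p : nat) (s : seq J) (z : J -> 'cV[R]_p) (w : W) : 'cV[R]_p :=
  \sum_(j <- s) eta (phi j) w *: z j.

Lemma dotv_gauss_comb (p : nat) (s : seq J) (z : J -> 'cV[R]_p) (l : 'cV[R]_p) w :
  dotv l (gauss_comb s z w) = \sum_(j <- s) dotv l (z j) * eta (phi j) w.
Proof.
by rewrite dotv_sumr; apply: eq_bigr => j _; rewrite dotvZr mulrC.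
Qed.

Lemma gauss_comb_rv (p : nat) (s : seq J) (z : J -> 'cV[R]_p) :
  random_vector (gauss_comb s z).
Proof.
move=> i; under eq_fun do rewrite summxE; apply: measurable_sum => j.
by under eq_fun do rewrite mxE; exact: measurable_funM.
Qed.

Lemma gaussian_cos (dQ : measure_display) (WQ : measurableType dQ)
    (Q : probability WQ R) (p : nat) (Z : WQ -> 'cV[R]_p) (S : 'M[R]_p)
    (l : 'cV[R]_p) (b : R) : posdef S -> gaussian_vector Q Z S ->
  Ex_of Q (fun w => cos ((l^T *m Z w) 0 0 + b)) =
  cos b * expR (- (dotv l (S *m l)) / 2).
Proof.
(* Positive definiteness makes the variance of l'Z positive for nonzero l, which selects the
   nondegenerate branch of [normal_law]. *)
move=> [_ pS] [mZ law]; have [->|l0] := eqVneq l 0.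
  rewrite /dotv trmx0 mul0mx mxE oppr0 mul0r expR0 mulr1 -[RHS](Ex_cst Q).
  by congr (Ex_of _ _); apply/funext => w; rewrite mul0mx mxE add0r.
have v0 := pS l l0; set v := (l^T *m S *m l) 0 0 in v0.
have s0 : 0 < Num.sqrt v by rewrite sqrtr_gt0.
have := @Ex_cos_normal _ _ _ Q (fun w => (l^T *m Z w) 0 0) (Num.sqrt v) 1 b
  (measurable_linear_form l mZ) s0.
rewrite mulr1 sqr_sqrtr ?(ltW v0)// [dotv _ _](_ : _ = v); last by rewrite /dotv mulmxA.
move=> <-; first by congr (Ex_of _ _); apply/funext => w; rewrite mul1r.
by move=> B mB; rewrite law// /normal_law gt_eqF.
Qed.

Lemma gauss_comb_law (dQ : measure_display) (WQ : measurableType dQ)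
    (Q : probability WQ R) (p : nat) (Z : WQ -> 'cV[R]_p) (S : 'M[R]_p)
    (s : seq J) (z : J -> 'cV[R]_p) (v : 'cV[R]_p) :
  posdef S -> gaussian_vector Q Z S -> uniq (map phi s) ->
  (forall l, \sum_(j <- s) dotv l (z j) ^+ 2 = dotv l (S *m l)) ->
  fine (P [set w | vle (gauss_comb s z w) v]) = fine (Q [set w | vle (Z w) v]).
Proof.
move=> pS gZ us zS; apply: cramer_wold_orthant.
- exact: gauss_comb_rv.
- by case: gZ.
move=> l b; rewrite (gaussian_cos l b pS gZ) -zS -Ex_cos_sum_inj//.
by congr (Ex_of _ _); apply/funext => w; rewrite -dotv_gauss_comb.
Qed.

End GaussianCombinations.

Section GaussianTail.
Context {d : measure_display} {W : measurableType d} {R : realType}.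
Variables (P : probability W R) (eta : nat -> {RV P >-> R}).
Hypothesis eta_iid : iid_std_normal eta.

(** By [cramer_wold_orthant] in dimension one, the combination has the distribution function of sg
    times a single multiplier, with sg <= t. Every tail is thereby compared with one fixed tail. *)
Lemma gauss_tail_one (J : eqType) (phi : J -> nat) (s : seq J) (a : J -> R) (t c : R) :
  uniq (map phi s) -> 0 < t -> \sum_(j <- s) a j ^+ 2 <= t ^+ 2 ->
  fine (P [set w | c * t < \sum_(j <- s) a j * eta (phi j) w]) <=
  fine (P [set w | (c < `|eta 0 w|)%R]).
Proof.
move=> us t0 at2.
pose sg := Num.sqrt (\sum_(j <- s) a j ^+ 2).
have ss : sg ^+ 2 = \sum_(j <- s) a j ^+ 2.
  by rewrite sqr_sqrtr// sumr_ge0// => j _; rewrite sqr_ge0.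
have sgt : sg <= t.
  by rewrite -(ler_pXn2r (n := 2))// ?nnegrE ?sqrtr_ge0 ?(ltW t0)// ss.
pose X1 (w : W) : 'cV[R]_1 := (\sum_(j <- s) a j * eta (phi j) w)%:M.
pose X2 (w : W) : 'cV[R]_1 := (sg * eta 0 w)%:M.
have mS : measurable_fun setT (fun w => \sum_(j <- s) a j * eta (phi j) w).
  by apply: measurable_sum => j; exact: measurable_funM.
have mE : measurable_fun setT (fun w => sg * eta 0 w) by exact: measurable_funM.
have rv1 (f : W -> R) : measurable_fun setT f -> random_vector (fun w => (f w)%:M : 'cV[R]_1).
  move=> mf i; rewrite (_ : (fun w => _) = f)//.
  by apply/funext => w; rewrite mxE (ord1 i) eqxx mulr1n.
have m1 : random_vector X1 by exact: rv1.
have m2 : random_vector X2 by exact: rv1.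
have cosE (l : 'cV[R]_1) (b : R) : Ex P (fun w => cos ((l^T *m X1 w) 0 0 + b)) =
    Ex P (fun w => cos ((l^T *m X2 w) 0 0 + b)).
  have lin (u : R) : (l^T *m (u%:M : 'cV[R]_1)) 0 0 = l 0 0 * u.
    by rewrite mul_mx_scalar !mxE mulrC.
  transitivity (Ex P (fun w => cos (\sum_(j <- s) (l 0 0 * a j) * eta (phi j) w + b))).
    congr (Ex _ _); apply/funext => w; rewrite lin mulr_sumr.
    by congr (cos (_ + _)); apply: eq_bigr => j _; rewrite mulrA.
  rewrite Ex_cos_sum_inj//.
  transitivity (Ex P (fun w => cos ((l 0 0 * sg) * eta 0 w + b))).
    rewrite (Ex_cos_eta eta_iid).
    have -> : \sum_(j <- s) (l 0 0 * a j) ^+ 2 = (l 0 0 * sg) ^+ 2; last by [].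
    by rewrite exprMn ss mulr_sumr; apply: eq_bigr => j _; rewrite exprMn.
  by congr (Ex _ _); apply/funext => w; rewrite lin mulrA.
have CW := cramer_wold_orthant m1 m2 cosE (c * t)%:M.
have compl (f : W -> R) (u : R) : measurable_fun setT f ->
    fine (P [set w | u < f w]) = 1 - fine (P [set w | f w <= u]).
  move=> mf; have mle : measurable [set w | f w <= u].
    exact: measurable_le_set.
  have -> : [set w | u < f w] = ~` [set w | f w <= u].
    by apply/seteqP; split => w /=; rewrite ltNge => /negP.
  by rewrite probability_setC// fineB// fin_num_measure.
have vE (f : W -> R) : [set w | vle ((f w)%:M : 'cV[R]_1) (c * t)%:M] =
    [set w | f w <= c * t].
  apply/seteqP; split => w /=; first by move=> /(_ 0); rewrite !mxE eqxx !mulr1n.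
  by move=> h i; rewrite !mxE (ord1 i) eqxx !mulr1n.
rewrite (compl _ _ mS) -vE CW vE -(compl _ _ mE).
have mA : measurable [set w | c * t < sg * eta 0 w].
  exact: measurable_gt_set.
have mB : measurable [set w | (c < `|eta 0 w|)%R].
  by apply: measurable_gt_set; exact: measurableT_comp.
(* For negative c the event on the right is the whole space. *)
have [c0|c0] := leP 0 c; last first.
  have -> : [set w | (c < `|eta 0 w|)%R] = setT.
    by apply/seteqP; split => w //= _; exact: lt_le_trans (normr_ge0 _).
  by rewrite probability_setT/= -lee_fin fineK ?fin_num_measure// probability_le1.
apply: fine_le; rewrite ?fin_num_measure//.
apply: le_measure; rewrite ?inE//.
move=> w /= h; rewrite -(ltr_pM2r t0) (lt_le_trans h)// (le_trans (ler_norm _))//.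
by rewrite normrM ger0_norm ?sqrtr_ge0// mulrC ler_wpM2l.
Qed.

(** [c] depends on [dl] alone: continuity from above makes the tail of |eta 0| small, and
    [gauss_tail_one] applied to a and to - a covers both sides. *)
Lemma gauss_tail (dl : R) : 0 < dl -> exists2 c : R, 0 < c &
  forall (J : eqType) (phi : J -> nat) (s : seq J) (a : J -> R) (t : R),
  uniq (map phi s) -> 0 < t -> \sum_(j <- s) a j ^+ 2 <= t ^+ 2 ->
  fine (P [set w | c * t < `|\sum_(j <- s) a j * eta (phi j) w|]) <= dl.
Proof.
move=> dl0.
have : exists2 c : R, 0 < c & fine (P [set w | (c < `|eta 0 w|)%R]) <= dl / 2.
  pose F n := [set w | ((n.+1%:R : R) < `|eta 0 w|)%R].
  have mF n : measurable (F n).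
    by apply: measurable_gt_set; exact: measurableT_comp.
  have F0 : \bigcap_n F n = set0.
    apply/seteqP; split => // w h; have := h (Num.truncn `|eta 0 w|) I.
    by rewrite /F /= => /lt_trans/(_ (truncnS_gt _)); rewrite ltxx.
  have := @nonincreasing_cvg_mu _ _ _ P F _ mF.
  rewrite F0 measure0 => C0.
  have C : P (F n) @[n --> \oo] --> 0%E.
    apply: C0.
    - by rewrite (le_lt_trans (probability_le1 _ _))// ltry.
    - exact: measurable0.
    - move=> n m nm; apply/subsetPset => w; rewrite /F /=; apply: le_lt_trans.
      by rewrite ler_nat ltnS.
  have /fine_cvgP[_ /cvgrPdist_le/(_ (dl / 2))] := C.
  rewrite divr_gt0// => /(_ isT)[N _ /(_ N (leqnn N))].
  rewrite /= sub0r normrN => h; exists N.+1%:R => //.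
  by rewrite (le_trans (ler_norm _)).
move=> [c c0 tail]; exists c => // J phi s a t us t0 at2.
have h1 := gauss_tail_one c us t0 at2.
have at2' : \sum_(j <- s) (- a j) ^+ 2 <= t ^+ 2.
  by under eq_bigr do rewrite sqrrN.
have h2 := gauss_tail_one c us t0 at2'.
set A := [set w | _] in h1; set B := [set w | _] in h2.
have mS (b : J -> R) : measurable_fun setT (fun w => \sum_(j <- s) b j * eta (phi j) w).
  by apply: measurable_sum => j; exact: measurable_funM.
have mA : measurable A.
  exact: measurable_gt_set.
have mB : measurable B.
  exact: measurable_gt_set.
have mAB : measurable (A `|` B) by exact: measurableU.
apply: (@le_trans _ _ (fine (P (A `|` B)))).
  have mC : measurable [set w | c * t < `|\sum_(j <- s) a j * eta (phi j) w|].
    by apply: measurable_gt_set; exact: measurableT_comp.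
  apply: fine_le; rewrite ?fin_num_measure//.
  apply: le_measure; rewrite ?inE//.
  move=> w /=; rewrite ltr_normr => /orP[h|h]; [by left|right].
  rewrite /B /= (lt_le_trans h)// -sumrN le_eqVlt; apply/orP; left; apply/eqP.
  by apply: eq_bigr => j _; rewrite mulNr.
rewrite -lee_fin fineK ?fin_num_measure//.
apply: (le_trans (measureU2 _ mA mB)).
suff : ((fine (P A))%:E + (fine (P B))%:E <= dl%:E)%E.
  by rewrite !fineK ?fin_num_measure.
by rewrite -EFinD lee_fin [dl]splitr lerD// ?(le_trans h1)// (le_trans h2).
Qed.

End GaussianTail.

(** * Exact covariance by fresh multipliers *)

Section Coupling.
Context {R : realType} {p : nat}.
Implicit Types (E L Sg iOm : 'M[R]_p).

(* The columns of a matrix [D] with [D D' = norm1 E * I - E]: for each pair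
   [-E_ij (e_i e_j' + e_j e_i') = |E_ij| ((e_i - sg e_j)(e_i - sg e_j)' - e_i e_i' - e_j e_j')]
   with [sg] the sign of [E_ij]. *)
Definition fill E (u : 'I_p * 'I_p + 'I_p) : 'cV[R]_p :=
  match u with
  | inl (i, j) => Num.sqrt (`|E i j| / 2) *: (delta_mx i 0 - Num.sg (E i j) *: delta_mx j 0)
  | inr i => Num.sqrt (norm1 E - \sum_j `|E i j|) *: delta_mx i 0
  end.

Lemma dotv_delta (n : 'cV[R]_p) i : dotv n (delta_mx i 0) = n i 0.
Proof.
rewrite dotvE (bigD1 i)//= mxE !eqxx mulr1 big1 ?addr0// => j ji.
by rewrite mxE (negbTE ji) mulr0.
Qed.

Lemma fill_quad E (n : 'cV[R]_p) : E^T = E ->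
  \sum_u dotv n (fill E u) ^+ 2 = norm1 E * frob n ^+ 2 - dotv n (E *m n).
Proof.
move=> sE; have Esym i j : E i j = E j i by rewrite -{1}sE mxE.
rewrite big_sumType /=.
have -> : \sum_(u : 'I_p * 'I_p) dotv n (fill E (inl u)) ^+ 2 =
    \sum_i \sum_j (`|E i j| / 2 * (n i 0 ^+ 2 + n j 0 ^+ 2) - E i j * n i 0 * n j 0).
  rewrite pair_bigA /=; apply: eq_bigr => -[i j] _ /=.
  rewrite dotvZr exprMn sqr_sqrtr ?divr_ge0//.
  rewrite -scaleNr dotvDr dotvZr !dotv_delta.
  (* A zero entry is treated apart: the square of its sign is not 1, but its weight vanishes. *)
  have [->|E0] := eqVneq (E i j) 0; first by rewrite normr0 mul0r !mul0r subr0.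
  have sg2 : Num.sg (E i j) ^+ 2 = 1 by rewrite sqr_sg E0.
  have EE : E i j = Num.sg (E i j) * `|E i j| by rewrite -numEsg.
  set e := `|_| in EE *; set sg := Num.sg _ in sg2 EE *; rewrite EE.
  rewrite (_ : e / 2 * (n i 0 + - sg * n j 0) ^+ 2 =
    e / 2 * (n i 0 ^+ 2 + sg ^+ 2 * n j 0 ^+ 2) - sg * e * n i 0 * n j 0).
    by rewrite sg2 mul1r.
  by field.
have -> : \sum_i dotv n (fill E (inr i)) ^+ 2 =
    \sum_i (norm1 E - \sum_j `|E i j|) * n i 0 ^+ 2.
  apply: eq_bigr => i _ /=; rewrite dotvZr dotv_delta exprMn sqr_sqrtr// subr_ge0.
  rewrite /norm1 [leRHS](bigD1 i)//= lerDl.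
  by apply: sumr_ge0 => k _; exact: sumr_ge0.
have -> : \sum_i \sum_j (`|E i j| / 2 * (n i 0 ^+ 2 + n j 0 ^+ 2) - E i j * n i 0 * n j 0) =
    \sum_i (\sum_j `|E i j|) * n i 0 ^+ 2 - dotv n (E *m n).
  transitivity (\sum_i \sum_j `|E i j| / 2 * n i 0 ^+ 2 +
     \sum_i \sum_j `|E i j| / 2 * n j 0 ^+ 2 - \sum_i \sum_j E i j * n i 0 * n j 0).
    rewrite -big_split -sumrB /=; apply: eq_bigr => i _.
    by rewrite -big_split -sumrB /=; apply: eq_bigr => j _; ring.
  congr (_ - _).
    rewrite [X in _ + X]exchange_big /= -big_split /=; apply: eq_bigr => i _.
    rewrite -big_split mulr_suml /=; apply: eq_bigr => j _.
    by rewrite (Esym j i); field.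
  rewrite dotvE; apply: eq_bigr => i _; rewrite mxE mulr_sumr.
  by apply: eq_bigr => j _; ring.
rewrite addrAC -big_split /= frob_cV_sqr mulr_sumr; congr (_ - _).
by apply: eq_bigr => i _; ring.
Qed.

Variables (Om Sg L : 'M[R]_p).
Hypotheses (symOm : Om^T = Om) (uL : L \in unitmx) (SgL : Sg = L *m L^T).
Variables (s : seq nat) (a : nat -> 'cV[R]_p).

Definition emp_var : 'M[R]_p := \sum_(k <- s) a k *m (a k)^T.
Definition white : 'M[R]_p := invmx L *m (emp_var - Sg) *m (invmx L)^T.
Definition damp : R := (Num.sqrt (1 + norm1 white))^-1.

(* The multipliers in [inr u] fill the gap between the random covariance of the
   scores [a k] and [Sg]; damping all of them by [damp] makes the total
   covariance deterministic, see [coupled_quad]. *)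
Definition coupled (j : nat + ('I_p * 'I_p + 'I_p)) : 'cV[R]_p :=
  match j with
  | inl k => damp *: (invmx Om *m a k)
  | inr u => damp *: (invmx Om *m (L *m fill white u))
  end.

Definition coupled_index : seq (nat + ('I_p * 'I_p + 'I_p)) :=
  map inl s ++ map inr (index_enum ('I_p * 'I_p + 'I_p)%type).

Lemma dotv_outer (u v : 'cV[R]_p) : dotv u (v *m v^T *m u) = dotv u v ^+ 2.
Proof.
rewrite -mulmxA [v^T *m u]mx11_scalar mul_mx_scalar dotvZr -/(dotv v u).
by rewrite [dotv v u]dotvC expr2.
Qed.

Lemma emp_var_quad (u : 'cV[R]_p) : dotv u (emp_var *m u) = \sum_(k <- s) dotv u (a k) ^+ 2.
Proof. by rewrite mulmx_suml dotv_sumr; apply: eq_bigr => k _; exact: dotv_outer. Qed.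

Lemma emp_var_sym : emp_var^T = emp_var.
Proof.
by rewrite linear_sum /=; apply: eq_bigr => k _; rewrite trmx_mul trmxK.
Qed.

Lemma white_sym : white^T = white.
Proof.
by rewrite /white !trmx_mul trmxK linearB /= emp_var_sym SgL trmx_mul trmxK mulmxA.
Qed.

Lemma damp_sqr : damp ^+ 2 * (1 + norm1 white) = 1.
Proof.
have h : 0 < 1 + norm1 white by rewrite ltr_wpDr ?norm1_ge0.
by rewrite exprVn sqr_sqrtr ?ltW// mulVf// gt_eqF.
Qed.

Lemma damp_01 : 0 <= damp <= 1.
Proof.
rewrite invr_ge0 sqrtr_ge0 /= invf_le1 ?sqrtr_gt0 ?ltr_wpDr ?norm1_ge0//.
by rewrite -[leLHS]sqrtr1 ler_wsqrtr// lerDl norm1_ge0.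
Qed.

Lemma invOm_sym : (invmx Om)^T = invmx Om.
Proof. by rewrite trmx_inv symOm. Qed.

(** With m = Om^(-1) l, n = L'm, E = [white] and s = [norm1] E, the total is damp^2 (m'A A'm + s
    |n|^2 - n'E n). Since |n|^2 = m'Sg m and n'E n = m'A A'm - m'Sg m, this equals damp^2 (1 + s)
    m'Sg m = m'Sg m. *)
Lemma coupled_quad (l : 'cV[R]_p) :
  \sum_(j <- coupled_index) dotv l (coupled j) ^+ 2 =
  dotv l ((invmx Om *m Sg *m invmx Om) *m l).
Proof.
move mE : (invmx Om *m l) => m; pose n := L^T *m m.
rewrite big_cat !big_map /=.
have -> : \sum_(k <- s) dotv l (damp *: (invmx Om *m a k)) ^+ 2 =
    damp ^+ 2 * dotv m (emp_var *m m).
  rewrite emp_var_quad mulr_sumr; apply: eq_bigr => k _.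
  by rewrite dotvZr exprMn dotv_mull invOm_sym mE.
have -> : \sum_(u : 'I_p * 'I_p + 'I_p) dotv l (damp *: (invmx Om *m (L *m fill white u))) ^+ 2 =
    damp ^+ 2 * (norm1 white * frob n ^+ 2 - dotv n (white *m n)).
  rewrite -fill_quad ?white_sym// mulr_sumr.
  apply: eq_bigr => u _.
  by rewrite dotvZr exprMn dotv_mull invOm_sym mE dotv_mull.
have nn : frob n ^+ 2 = dotv m (Sg *m m).
  by rewrite -dotvv /n -dotv_mull SgL mulmxA.
have nEn : dotv n (white *m n) = dotv m (emp_var *m m) - dotv m (Sg *m m).
  rewrite /n -dotv_mull /white !mulmxA mulmxV// mul1mx.
  rewrite -[_ *m L^T](mulmxA _ (invmx L)^T) -trmx_mul mulmxV// trmx1 mulmx1.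
  by rewrite mulmxBl /dotv mulmxBr mxBE.
have -> : dotv l (invmx Om *m Sg *m invmx Om *m l) = dotv m (Sg *m m).
  by rewrite -!mulmxA (dotv_mull (invmx Om)) invOm_sym mE.
rewrite nn nEn -[RHS]mul1r -damp_sqr; ring.
Qed.

End Coupling.

Section CouplingError.
Context {R : realType} {p : nat}.
Implicit Types (A B L Sg Om H : 'M[R]_p).

Lemma norm1_mul A B : norm1 (A *m B) <= norm1 A * norm1 B.
Proof.
apply: (@le_trans _ _ (\sum_i \sum_k `|A i k| * \sum_j `|B k j|)).
  apply: ler_sum => i _.
  apply: (@le_trans _ _ (\sum_j \sum_k `|A i k| * `|B k j|)).
    apply: ler_sum => j _; rewrite mxE (le_trans (ler_norm_sum _ _ _))//.
    by apply: ler_sum => k _; rewrite normrM.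
  by rewrite exchange_big /=; apply: ler_sum => k _; rewrite mulr_sumr.
rewrite /norm1 mulr_suml; apply: ler_sum => i _; rewrite mulr_suml.
apply: ler_sum => k _; rewrite ler_wpM2l// [leRHS](bigD1 k)//= lerDl.
by apply: sumr_ge0 => l _; exact: sumr_ge0.
Qed.

Lemma norm1_tr A : norm1 A^T = norm1 A.
Proof.
rewrite /norm1 exchange_big /=; apply: eq_bigr => i _; apply: eq_bigr => j _.
by rewrite mxE.
Qed.

Lemma norm1D A B : norm1 (A + B) <= norm1 A + norm1 B.
Proof.
rewrite /norm1 -big_split /=; apply: ler_sum => i _; rewrite -big_split /=.
by apply: ler_sum => j _; rewrite mxE ler_normD.
Qed.

Lemma norm1N A : norm1 (- A) = norm1 A.
Proof.
by apply: eq_bigr => i _; apply: eq_bigr => j _; rewrite mxE normrN.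
Qed.

Lemma frob_delta (i : 'I_p) : frob (delta_mx i 0 : 'cV[R]_p) = 1.
Proof.
apply/eqP; rewrite -(eqrXn2 (n := 2))// ?frob_ge0// frob_cV_sqr (bigD1 i)//= big1.
  by rewrite mxE !eqxx !expr1n addr0.
by move=> k ki; rewrite mxE (negbTE ki) expr0n.
Qed.

(** The left-hand side is the trace of [emp_var s a]. *)
Lemma sum_frob_sqr (s : seq nat) (a : nat -> 'cV[R]_p) :
  \sum_(k <- s) frob (a k) ^+ 2 <= norm1 (emp_var s a).
Proof.
have -> : \sum_(k <- s) frob (a k) ^+ 2 = \sum_i emp_var s a i i.
  under eq_bigr do rewrite frob_cV_sqr.
  rewrite exchange_big /=; apply: eq_bigr => i _; rewrite summxE.
  by apply: eq_bigr => k _; rewrite mxE big_ord1 mxE expr2.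
apply: ler_sum => i _; rewrite (le_trans (ler_norm _))// (bigD1 i)//= lerDl.
exact: sumr_ge0.
Qed.

(** By 1 / sqrt(1 + n) >= 1 / (1 + n) >= 1 - n. *)
Lemma damp_ge (Sg L : 'M[R]_p) s a : 1 - damp Sg L s a <= norm1 (white Sg L s a).
Proof.
have n0 := norm1_ge0 (white Sg L s a); set n := norm1 _ in n0 *.
have h : 0 < 1 + n by rewrite ltr_wpDr.
have sq : Num.sqrt (1 + n) <= 1 + n.
  rewrite -(ler_pXn2r (n := 2))// ?nnegrE ?sqrtr_ge0 ?(ltW h)//.
  by rewrite sqr_sqrtr ?(ltW h)// expr2 ler_peMl ?(ltW h)// lerDl.
have : (1 + n)^-1 <= damp Sg L s a.
  by rewrite lef_pV2 ?posrE// sqrtr_gt0.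
have : 1 - n <= (1 + n)^-1.
  by rewrite -[leRHS]mul1r ler_pdivlMr//; nra.
lra.
Qed.

Variables (Om Sg L : 'M[R]_p).
Hypotheses (pOm : posdef Om) (uL : L \in unitmx) (SgL : Sg = L *m L^T).

(** Coefficient of each multiplier in the bootstrap error minus its coefficient in the coupled
    vector, up to the scale sqrt b2. Fresh multipliers are absent from the bootstrap error, hence
    the bare minus sign. *)
Definition coupling_resid (H : 'M[R]_p) s a (j : nat + ('I_p * 'I_p + 'I_p)) : 'cV[R]_p :=
  match j with
  | inl k => invmx H *m a k - coupled Om Sg L s a (inl k)
  | inr u => - coupled Om Sg L s a (inr u)
  end.

(** For the sample multipliers the operator H^(-1) - damp Om^(-1) is of order dl. For the fresh ones
    the total variance is of order [norm1] of [white], again of order dl. In C the two summands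
    correspond to these two groups. *)
Lemma coupling_error (tau : R) : 0 < tau -> exists2 dl : R, 0 < dl &
  forall (H : 'M[R]_p) (s : seq nat) (a : nat -> 'cV[R]_p),
  norm1 (H - Om) <= dl -> norm1 (emp_var s a - Sg) <= dl -> forall i,
  \sum_(j <- @coupled_index p s) coupling_resid H s a j i 0 ^+ 2 <= tau.
Proof.
move=> tau0; have symOm : Om^T = Om by case: pOm.
have [c c0 cOm] := posdef_coercive pOm.
pose kL := norm1 (invmx L) ^+ 2.
have kL0 : 0 <= kL by exact: sqr_ge0.
pose k1 := 2 / c ^+ 2 + kL / c.
have k10 : 0 <= k1 by rewrite addr_ge0 ?divr_ge0 ?sqr_ge0 ?(ltW c0).
pose kn := (norm1 L^T * norm1 (invmx Om)) ^+ 2.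
have kn0 : 0 <= kn by exact: sqr_ge0.
pose C := k1 ^+ 2 * (norm1 Sg + 1) + 2 * kL * kn.
have C0 : 0 <= C.
  have n1 : 0 <= norm1 Sg + 1 by rewrite addr_ge0 ?norm1_ge0.
  apply: addr_ge0; first by apply: mulr_ge0 => //; exact: sqr_ge0.
  by apply: mulr_ge0 => //; apply: mulr_ge0.
(* The three bounds serve to replace dl^2 by dl, to keep H coercive with constant c / 2, and to make
   C dl at most tau. *)
pose dl := Num.min 1 (Num.min (c / 2) (tau / (C + 1))).
have dl0 : 0 < dl by rewrite !lt_min ltr01 !divr_gt0// ltr_wpDl.
have dl1 : dl <= 1 by rewrite ge_min lexx.
have dlc : dl <= c / 2 by rewrite /dl ge_min orbC ge_min lexx.
have dlC : C * dl <= tau.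
  have h : dl <= tau / (C + 1) by rewrite /dl ge_min orbC ge_min lexx orbT.
  apply: (@le_trans _ _ ((C + 1) * dl)); first by rewrite ler_wpM2r ?(ltW dl0)// lerDl.
  by rewrite mulrC -ler_pdivlMr// ltr_wpDl.
exists dl => // H s a HOm Asg i.
set wn := norm1 (white Sg L s a).
have wn0 : 0 <= wn by exact: norm1_ge0.
have wnle : wn <= kL * dl.
  rewrite (le_trans (norm1_mul _ _))// norm1_tr.
  rewrite (le_trans (ler_wpM2r (norm1_ge0 _) (norm1_mul _ _)))//.
  rewrite mulrAC -expr2 ler_wpM2l//.
have cH : coercive H (c / 2) by apply: coercive_perturb cOm _; exact: le_trans dlc.
have c20 : 0 < c / 2 by rewrite divr_gt0.
have uH := coercive_unitmx c20 cH; have uOm := coercive_unitmx c0 cOm.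
have /andP[d0 d1] := damp_01 Sg L s a.
have dge := damp_ge Sg L s a; rewrite -/wn in dge.
set dm := damp Sg L s a in d0 d1 dge.
have opb (v : 'cV[R]_p) : frob (invmx H *m v - dm *: (invmx Om *m v)) <= k1 * dl * frob v.
  (* The resolvent identity contributes 2 / c^2 to k1, and the damping term kL / c. *)
  have -> : invmx H *m v - dm *: (invmx Om *m v) =
      invmx H *m ((Om - H) *m (invmx Om *m v)) + (1 - dm) *: (invmx Om *m v).
    rewrite mulmxBl mulmxBr mulKVmx// mulKmx//.
    by rewrite scalerBl scale1r addrA subrK.
  rewrite (le_trans (ler_frobD _ _))// frobZ ger0_norm ?subr_ge0//.
  have h1 := coercive_inv v c0 cOm.
  have h2 := coercive_inv ((Om - H) *m (invmx Om *m v)) c20 cH.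
  have h3 := frob_mulmx (Om - H) (invmx Om *m v).
  have nOH : norm1 (Om - H) <= dl by rewrite -norm1N opprB.
  have f0 := frob_ge0 v; have g0 := frob_ge0 (invmx Om *m v).
  have h4 : frob ((Om - H) *m (invmx Om *m v)) <= dl * (c^-1 * frob v).
    by rewrite (le_trans h3)// ler_pM// norm1_ge0.
  have h5 : frob (invmx H *m ((Om - H) *m (invmx Om *m v))) <=
      (c / 2)^-1 * (dl * (c^-1 * frob v)).
    by rewrite (le_trans h2)// ler_wpM2l// invr_ge0 ltW.
  have h6 : (1 - dm) * frob (invmx Om *m v) <= kL * dl * (c^-1 * frob v).
    by apply: ler_pM => //; rewrite ?subr_ge0// (le_trans dge).
  rewrite (le_trans (lerD h5 h6))// le_eqVlt; apply/orP; left; apply/eqP.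
  by rewrite /k1; field; rewrite gt_eqF.
rewrite big_cat !big_map /=.
apply: le_trans dlC; rewrite mulrDl lerD//.
  apply: (@le_trans _ _ (\sum_(k <- s) (k1 * dl) ^+ 2 * frob (a k) ^+ 2)).
    apply: ler_sum => k _; rewrite -exprMn -[leLHS]real_normK ?num_real//.
    rewrite ler_pXn2r ?nnegrE ?mulr_ge0 ?frob_ge0 ?(ltW dl0)//.
    exact: le_trans (ler_norm_frob _ _ _) (opb _).
  rewrite -mulr_sumr exprMn.
  have dl2 : dl ^+ 2 <= dl by rewrite expr2 ler_piMl// ltW.
  have sf : \sum_(k <- s) frob (a k) ^+ 2 <= norm1 Sg + 1.
    rewrite (le_trans (sum_frob_sqr s a))// -[emp_var s a](subrK Sg).
    by rewrite (le_trans (norm1D _ _))// addrC lerD2l (le_trans Asg).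
  have sf0 : 0 <= \sum_(k <- s) frob (a k) ^+ 2.
    by apply: sumr_ge0 => k _; exact: sqr_ge0.
  rewrite -[leRHS]mulrA [(_ + 1) * dl]mulrC -[leLHS]mulrA.
  apply: ler_wpM2l; first exact: sqr_ge0.
  by apply: ler_pM => //; exact: sqr_ge0.
pose n := L^T *m (invmx Om *m delta_mx i 0) : 'cV[R]_p.
have nk : frob n ^+ 2 <= kn.
  rewrite /kn ler_pXn2r ?nnegrE ?frob_ge0 ?mulr_ge0 ?norm1_ge0//.
  rewrite (le_trans (frob_mulmx _ _))// ler_wpM2l ?norm1_ge0//.
  by rewrite (le_trans (frob_mulmx _ _))// frob_delta mulr1.
(* [fill_quad] evaluates the fresh part exactly; the result is at most 2 wn |n|^2. *)
have -> : \sum_(u : 'I_p * 'I_p + 'I_p)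
     (- (dm *: (invmx Om *m (L *m fill (white Sg L s a) u)))) i 0 ^+ 2 =
   dm ^+ 2 * (wn * frob n ^+ 2 - dotv n (white Sg L s a *m n)).
  rewrite -fill_quad ?white_sym// mulr_sumr; apply: eq_bigr => u _.
  rewrite mxE sqrrN -exprMn mxE; congr ((_ * _) ^+ 2).
  by rewrite /n -dotv_mull -{2}(invOm_sym symOm) -dotv_mull dotvC dotv_delta.
have hd : dotv n (white Sg L s a *m n) >= - (wn * frob n ^+ 2).
  by have := dotv_mulmx_le (white Sg L s a) n; rewrite ler_norml => /andP[].
have fn0 := sqr_ge0 (frob n).
apply: (@le_trans _ _ (1 * (2 * wn * frob n ^+ 2))).
  apply: ler_pM; rewrite ?sqr_ge0//; last by lra.
    have := dotv_mulmx_le (white Sg L s a) n; rewrite ler_norml => /andP[_].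
    by rewrite subr_ge0.
  by rewrite expr_le1.
rewrite mul1r.
have h7 : wn * frob n ^+ 2 <= kL * dl * kn by apply: ler_pM.
rewrite -mulrA; lra.
Qed.

End CouplingError.

Section MultiplierIndex.
Variable p : nat.

(* Multipliers with an index beyond [T] do not enter the bootstrap sample, so they
   serve as the additional independent normal variables. *)
Definition mult_index (T : nat) (j : nat + ('I_p * 'I_p + 'I_p)) : nat :=
  match j with
  | inl k => k
  | inr u => (T.+1 + enum_rank u)%N
  end.

Lemma mult_index_uniq (T : nat) (s : seq nat) : uniq s ->
  (forall k, k \in s -> (k <= T)%N) -> uniq (map (mult_index T) (@coupled_index p s)).
Proof.
move=> us sT; rewrite /coupled_index map_cat -!map_comp cat_uniq.
rewrite [X in uniq X](_ : _ = s) ?us/=; last by rewrite -[RHS]map_id; exact: eq_map.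
apply/andP; split.
  apply/hasPn => k /mapP[u _ ->] /=; apply/negP => /mapP[k' /sT k'T /= E].
  by move: k'T; rewrite -E -ltn_subRL subnn.
rewrite map_inj_uniq ?index_enum_uniq// => u v /= /addnI h.
exact/enum_rank_inj/val_inj.
Qed.

End MultiplierIndex.

(** * The remainder *)

Section MatrixMeasurability.
Context {d : measure_display} {U : measurableType d} {R : realType}.

Definition mxmeas (m n : nat) (A : U -> 'M[R]_(m, n)) :=
  forall i j, measurable_fun setT (fun u => A u i j).

(** Restricted to members of the list, because the data are known to be measurable at sample times
    only. *)
Lemma measurable_sum_in (I : eqType) (s : seq I) (h : I -> U -> R) :
  (forall i, i \in s -> measurable_fun setT (h i)) ->
  measurable_fun setT (fun u => \sum_(i <- s) h i u).
Proof.
elim: s => [|i s IHs] mh.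
  by under eq_fun do rewrite big_nil; exact: measurable_cst.
under eq_fun do rewrite big_cons; apply: measurable_funD.
  by apply: mh; rewrite mem_head.
by apply: IHs => j js; apply: mh; rewrite inE js orbT.
Qed.

Lemma measurable_sg (f : U -> R) : measurable_fun setT f ->
  measurable_fun setT (fun u => Num.sg (f u)).
Proof.
move=> mf; have -> : (fun u => Num.sg (f u)) =
    fun u => \1_[set u | 0 < f u] u - \1_[set u | 0 < - f u] u.
  apply/funext => u; rewrite !indicE.
  have i1 : (u \in [set u | 0 < f u]) = (0 < f u).
    by apply/idP/idP => [/set_mem//|h]; exact/mem_set.
  have i2 : (u \in [set u | 0 < - f u]) = (f u < 0).
    apply/idP/idP => [/set_mem/=|h]; first by rewrite oppr_gt0.
    by apply/mem_set; rewrite /= oppr_gt0.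
  by rewrite i1 i2; case: sgrP => _; rewrite ?subr0 ?sub0r.
apply: measurable_funB; apply: measurable_indic; apply: measurable_gt_set => //.
exact: measurableT_comp.
Qed.

(** The factorisation respects the convention 0^(-1) = 0, since the sign vanishes there. *)
Lemma measurable_inverse (f : U -> R) : measurable_fun setT f ->
  measurable_fun setT (fun u => (f u)^-1).
Proof.
move=> mf; have -> : (fun u => (f u)^-1) = fun u => Num.sg (f u) * (`|f u| `^ (-1)).
  apply/funext => u; rewrite powR_inv1//; case: sgrP => [->|_|_].
  - by rewrite invr0 mul0r.
  - by rewrite mul1r.
  - by rewrite invrN mulN1r opprK.
apply: measurable_funM; first exact: measurable_sg.
by apply: (measurableT_comp (measurable_powR (-1))); exact: measurableT_comp.
Qed.

Lemma mxmeas_cst (m n : nat) (A : 'M[R]_(m, n)) : mxmeas (fun=> A).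
Proof. by move=> i j; exact: measurable_cst. Qed.

Lemma mxmeasD (m n : nat) (A B : U -> 'M[R]_(m, n)) :
  mxmeas A -> mxmeas B -> mxmeas (fun u => A u + B u).
Proof.
by move=> mA mB i j; under eq_fun do rewrite mxE; exact: measurable_funD.
Qed.

Lemma mxmeasN (m n : nat) (A : U -> 'M[R]_(m, n)) : mxmeas A -> mxmeas (fun u => - A u).
Proof.
by move=> mA i j; under eq_fun do rewrite mxE; exact: measurableT_comp.
Qed.

Lemma mxmeasB (m n : nat) (A B : U -> 'M[R]_(m, n)) :
  mxmeas A -> mxmeas B -> mxmeas (fun u => A u - B u).
Proof. by move=> mA mB; apply: mxmeasD => //; exact: mxmeasN. Qed.

Lemma mxmeasZ (m n : nat) (c : U -> R) (A : U -> 'M[R]_(m, n)) :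
  measurable_fun setT c -> mxmeas A -> mxmeas (fun u => c u *: A u).
Proof.
by move=> mc mA i j; under eq_fun do rewrite mxE; exact: measurable_funM.
Qed.

Lemma mxmeasM (m n k : nat) (A : U -> 'M[R]_(m, n)) (B : U -> 'M[R]_(n, k)) :
  mxmeas A -> mxmeas B -> mxmeas (fun u => A u *m B u).
Proof.
move=> mA mB i j; under eq_fun do rewrite mxE.
by apply: measurable_sum => l; exact: measurable_funM.
Qed.

Lemma mxmeasT (m n : nat) (A : U -> 'M[R]_(m, n)) : mxmeas A -> mxmeas (fun u => (A u)^T).
Proof. by move=> mA i j; under eq_fun do rewrite mxE; exact: mA. Qed.

Lemma mxmeas_sum (I : eqType) (s : seq I) (m n : nat) (A : I -> U -> 'M[R]_(m, n)) :
  (forall i, i \in s -> mxmeas (A i)) -> mxmeas (fun u => \sum_(i <- s) A i u).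
Proof.
move=> mA i j; under eq_fun do rewrite summxE.
by apply: measurable_sum_in => l ls; exact: mA.
Qed.

Lemma measurable_det (n : nat) (A : U -> 'M[R]_n) : mxmeas A ->
  measurable_fun setT (fun u => \det (A u)).
Proof.
move=> mA; apply: measurable_sum => s.
apply: measurable_funM => //; apply: measurable_prod => i _; exact: mA.
Qed.

Lemma measurable_norm1 (m n : nat) (A : U -> 'M[R]_(m, n)) : mxmeas A ->
  measurable_fun setT (fun u => norm1 (A u)).
Proof.
by move=> mA; do 2 (apply: measurable_sum => ?); apply: measurableT_comp.
Qed.


(** Cramer's rule where the determinant is nonzero; elsewhere [invmx] returns its argument, which is
    measurable as well. *)
Lemma mxmeas_inv (n : nat) (A : U -> 'M[R]_n) : mxmeas A -> mxmeas (fun u => invmx (A u)).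
Proof.
move=> mA i j.
have -> : (fun u => invmx (A u) i j) = fun u =>
    if \det (A u) == 0 then A u i j else (\det (A u))^-1 * cofactor (A u) j i.
  apply/funext => u; rewrite /invmx unitmxE unitfE.
  by case: eqVneq => //= _; rewrite !mxE.
have md := measurable_det mA.
apply: measurable_fun_ifT => //.
  by apply: measurable_fun_eqr => //; exact: measurable_cst.
apply: measurable_funM; first exact: measurable_inverse.
apply: measurable_funM => //; apply: measurable_det => k l.
by under eq_fun do rewrite !mxE; exact: mA.
Qed.

End MatrixMeasurability.

Section RemainderDefinition.
Context {R : realType} {p : nat}.
Variables (K : R -> R) (T : nat) (b1 b2 : R) (t : nat) (Om Sg L : 'M[R]_p).
Implicit Types (x : nat -> 'cV[R]_p) (y e : nat -> R).

Definition win : seq nat := window T t (Num.truncn b2).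

(** The scores: their [emp_var] over the window is the conditional covariance of the multiplier sum
    in the bootstrap estimator. *)
Definition acoef x y (k : nat) : 'cV[R]_p :=
  ((Num.sqrt b2)^-1 * (kw K b2 t k * resid K T b1 x y k)) *: x k.

Definition zstar x y e : 'cV[R]_p :=
  \sum_(j <- @coupled_index p win)
    e (mult_index T j) *: coupled Om Sg L win (acoef x y) j.

Definition rstar x y e : 'cV[R]_p :=
  bstar K T b1 b2 x y e t - bhat K T b1 x y t - (Num.sqrt b2)^-1 *: zstar x y e.

Lemma mem_window n k : k \in window T t n -> (1 <= k <= T)%N.
Proof. by rewrite mem_filter => /andP[]. Qed.

End RemainderDefinition.

Section RemainderMeasurability.
Context {d : measure_display} {U : measurableType d} {R : realType} {p : nat}.
Variables (K : R -> R) (T : nat) (b1 b2 : R) (t : nat) (Om Sg L : 'M[R]_p).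
Variables (x : nat -> U -> 'cV[R]_p) (y e : nat -> U -> R).
Hypotheses (mx : forall k, (1 <= k <= T)%N -> mxmeas (x k))
  (my : forall k, (1 <= k <= T)%N -> measurable_fun setT (y k))
  (me : forall k, measurable_fun setT (e k)).
Let xu u k := x k u.
Let yu u k := y k u.
Let eu u k := e k u.

Let mem_sample k : k \in index_iota 1 T.+1 -> (1 <= k <= T)%N.
Proof. by rewrite mem_index_iota ltnS. Qed.

Let mbhat k : mxmeas (fun u => bhat K T b1 (xu u) (yu u) k).
Proof.
apply: mxmeasM; [apply: mxmeas_inv|]; apply: mxmeas_sum => l /mem_sample l1.
  apply: mxmeasZ => //; apply: mxmeasM; first exact: mx.
  exact/mxmeasT/mx.
by apply: mxmeasZ => //; apply: mxmeasZ; [exact: my|exact: mx].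
Qed.

Let mxb k : (1 <= k <= T)%N ->
  measurable_fun setT (fun u => ((xu u k)^T *m bhat K T b1 (xu u) (yu u) k) 0 0).
Proof. by move=> k1; apply: mxmeasM => //; exact/mxmeasT/mx. Qed.

Let mresid k : (1 <= k <= T)%N ->
  measurable_fun setT (fun u => resid K T b1 (xu u) (yu u) k).
Proof. by move=> k1; apply: measurable_funB; [exact: my|exact: mxb]. Qed.

Let macoef k : (1 <= k <= T)%N -> mxmeas (fun u => acoef K T b1 b2 t (xu u) (yu u) k).
Proof.
move=> k1; apply: mxmeasZ; last exact: mx.
by apply: measurable_funM => //; apply: measurable_funM => //; exact: mresid.
Qed.

Let mwhite : mxmeas (fun u => white Sg L (win T b2 t) (acoef K T b1 b2 t (xu u) (yu u))).
Proof.
apply: mxmeasM; last exact: mxmeas_cst.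
apply: mxmeasM; first exact: mxmeas_cst.
apply: mxmeasB; last exact: mxmeas_cst.
apply: mxmeas_sum => k /mem_window k1; apply: mxmeasM; first exact: macoef.
exact/mxmeasT/macoef.
Qed.

Let mdamp : measurable_fun setT
  (fun u => damp Sg L (win T b2 t) (acoef K T b1 b2 t (xu u) (yu u))).
Proof.
apply: measurable_inverse; apply: measurable_sqrt; apply: measurable_funD => //.
exact: measurable_norm1.
Qed.

Let mfill (E : U -> 'M[R]_p) v : mxmeas E -> mxmeas (fun u => fill (E u) v).
Proof.
move=> mE; have mn i j : measurable_fun setT (fun u => `|E u i j|).
  exact: measurableT_comp.
case: v => [[i j]|i] /=.
  apply: mxmeasZ.
    by apply: measurable_sqrt; apply: measurable_funM.
  apply: mxmeasB; first exact: mxmeas_cst.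
  by apply: mxmeasZ; [exact: measurable_sg|exact: mxmeas_cst].
apply: mxmeasZ; last exact: mxmeas_cst.
apply: measurable_sqrt; apply: measurable_funB; first exact: measurable_norm1.
exact: measurable_sum.
Qed.

Lemma mxmeas_rstar : mxmeas (fun u => rstar K T b1 b2 t Om Sg L (xu u) (yu u) (eu u)).
Proof.
apply: mxmeasB; last first.
  apply: mxmeasZ => //; apply: mxmeas_sum => j.
  rewrite mem_cat => /orP[/mapP[k /mem_window k1 ->]|/mapP[v _ ->]].
    apply: mxmeasZ; first exact: me.
    apply: mxmeasZ; first exact: mdamp.
    by apply: mxmeasM; [exact: mxmeas_cst|exact: macoef].
  apply: mxmeasZ; first exact: me.
  apply: mxmeasZ; first exact: mdamp.
  apply: mxmeasM; first exact: mxmeas_cst.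
  by apply: mxmeasM; [exact: mxmeas_cst|exact: mfill].
apply: mxmeasB; last exact: mbhat.
apply: mxmeasM; [apply: mxmeas_inv|]; apply: mxmeas_sum => k /mem_window k1.
  apply: mxmeasZ => //; apply: mxmeasM; first exact: mx.
  exact/mxmeasT/mx.
apply: mxmeasZ => //; apply: mxmeasZ; last exact: mx.
apply: measurable_funD; first exact: mxb.
by apply: measurable_funM; [exact: me|exact: mresid].
Qed.

End RemainderMeasurability.

Section SampleMeasurability.
Context {d d' : measure_display} {W : measurableType d} {W' : measurableType d'}.
Context {R : realType}.
Variables (P : probability W R) (P' : probability W' R) (p : nat).

(** The product type over the generated type carries exactly the sigma-algebra of rectangles
    required by [bootstrap_vector]. *)
Lemma bootstrap_vector_meas (gens : set (set W)) (X : W -> W' -> 'cV[R]_p) :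
  (forall i, measurable_fun [set: g_sigma_algebraType gens * W']
     (fun ww => X ww.1 ww.2 i 0)) ->
  bootstrap_vector (<<s gens >>) X.
Proof.
move=> mX i B mB; have := mX i measurableT B mB; rewrite setTI.
by rewrite measurable_prod_measurableType.
Qed.

(** P* of an event of the product is the measure of its section at w, which is a measurable function
    of w. *)
Lemma measurable_Pstar_le (X : W -> W' -> 'cV[R]_p) (M dl : R) :
  (forall i, measurable_fun [set: W * W'] (fun ww => X ww.1 ww.2 i 0)) ->
  measurable [set w | Pstar P' (fun w w' => M < frob (X w w')) w <= dl].
Proof.
move=> mX; pose A := [set ww : W * W' | M < frob (X ww.1 ww.2)].
have mA : measurable A.
  apply: measurable_gt_set; apply: measurable_frob => i j.
  by rewrite (ord1 j); exact: mX.
have mf := measurable_fun_xsection P' mA.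
have mAw w : measurable (xsection A w) by exact: measurable_xsection.
have -> : [set w | Pstar P' (fun w w' => M < frob (X w w')) w <= dl] =
    [set w | (P' (xsection A w) <= dl%:E)%E].
  apply/seteqP; split => w /=; rewrite /Pstar.
    rewrite (_ : [set w' | _] = xsection A w); last first.
      by apply/seteqP; split => w'; rewrite /xsection /= ?inE.
    by rewrite -lee_fin fineK// fin_num_measure.
  rewrite (_ : [set w' | M < _] = xsection A w); last first.
    by apply/seteqP; split => w'; rewrite /xsection /= ?inE.
  by rewrite -[X in (X <= _)%E](@fineK _ (P' _)) ?lee_fin// fin_num_measure.
rewrite -[X in measurable X]setTI.
exact: (emeasurable_fun_infty_c measurableT mf).
Qed.

End SampleMeasurability.

(** * High probability and kernel weights *)

Section HighProbability.
Context {d : measure_display} {W : measurableType d} {R : realType}.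
Variable P : probability W R.
Implicit Types (A B : nat -> set W) (Y : nat -> W -> R).

(* Inner probability, so that no measurability of [A T] is needed. *)
Definition wp (e : R) A := \forall T \near \oo, exists E : set W,
  [/\ measurable E, (P (~` E) <= e%:E)%E & E `<=` A T].

Definition whp A := forall e : R, 0 < e -> wp e A.

Definition tight Y := forall e : R, 0 < e ->
  exists2 M : R, 0 < M & wp e (fun T => [set w | Y T w <= M]).

Lemma wpS e A B : (\forall T \near \oo, A T `<=` B T) -> wp e A -> wp e B.
Proof.
move=> AB wA; near=> T.
have [E [mE PE EA]] : exists E : set W,
  [/\ measurable E, (P (~` E) <= e%:E)%E & E `<=` A T] by near: T.
exists E; split => //; apply: subset_trans EA _.
by near: T.
Unshelve. all: end_near. Qed.

Lemma wpI e1 e2 A B : wp e1 A -> wp e2 B -> wp (e1 + e2) (fun T => A T `&` B T).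
Proof.
move=> wA wB; near=> T.
have [E [mE PE EA]] : exists E : set W,
  [/\ measurable E, (P (~` E) <= e1%:E)%E & E `<=` A T] by near: T.
have [F [mF PF FB]] : exists E : set W,
  [/\ measurable E, (P (~` E) <= e2%:E)%E & E `<=` B T] by near: T.
exists (E `&` F); split; first exact: measurableI.
  rewrite setCI EFinD; apply: le_trans (leeD PE PF).
  by apply: measureU2; exact: measurableC.
by move=> w [/EA ? /FB ?].
Unshelve. all: end_near. Qed.

Lemma whpI A B : whp A -> whp B -> whp (fun T => A T `&` B T).
Proof.
move=> wA wB e e0; rewrite [e]splitr.
by apply: wpI; [apply: wA|apply: wB]; rewrite divr_gt0.
Qed.

Lemma whpS A B : (\forall T \near \oo, A T `<=` B T) -> whp A -> whp B.
Proof. by move=> AB wA e /wA; exact: wpS. Qed.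

Lemma wp_markov (e dl : R) A : 0 < e -> 0 < dl ->
  (\forall T \near \oo, exists H : W -> R, [/\ itg P H, forall w, 0 <= H w,
    Ex P H <= e * dl & forall w, H w <= dl -> A T w]) -> wp e A.
Proof.
move=> e0 dl0 HA; near=> T.
have [H [iH H0 EH HT]] : exists H : W -> R, [/\ itg P H, forall w, 0 <= H w,
    Ex P H <= e * dl & forall w, H w <= dl -> A T w] by near: T.
exists [set w | H w <= dl]; split.
- exact/measurable_le_set/itg_meas/iH.
- have -> : ~` [set w | H w <= dl] = [set w | dl < H w].
    by apply/seteqP; split => w /=; rewrite ltNge => /negP.
  apply: (le_trans (prob_markov iH H0 dl0)).
  by rewrite lee_fin ler_pdivrMr.
- by move=> w /=; exact: HT.
Unshelve. all: end_near. Qed.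

Lemma whp_L1 (dl : R) A : 0 < dl ->
  (forall e : R, 0 < e -> \forall T \near \oo, exists H : W -> R,
    [/\ itg P H, forall w, 0 <= H w, Ex P H <= e & forall w, H w <= dl -> A T w]) ->
  whp A.
Proof.
by move=> dl0 h e e0; apply: (wp_markov e0 dl0); apply: h; rewrite mulr_gt0.
Qed.

Lemma tight_L1 (C : R) Y : 0 < C ->
  (\forall T \near \oo, [/\ itg P (Y T), forall w, 0 <= Y T w & Ex P (Y T) <= C]) ->
  tight Y.
Proof.
move=> C0 h e e0; exists (C / e); first by rewrite divr_gt0.
apply: (@wp_markov e (C / e)) => //; first by rewrite divr_gt0.
near=> T; have [iY Y0 EY] : [/\ itg P (Y T), forall w, 0 <= Y T w & Ex P (Y T) <= C].
  by near: T.
by exists (Y T); split => //; rewrite mulrC divfK ?gt_eqF.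
Unshelve. all: end_near. Qed.

Let compl_le Y T (c : R) : measurable_fun setT (Y T) ->
  measurable [set w | `|Y T w| <= c] /\ ~` [set w | `|Y T w| <= c] = [set w | c < `|Y T w|].
Proof.
move=> mY; split; first by apply: measurable_le_set; exact: measurableT_comp.
by apply/seteqP; split => w /=; rewrite ltNge => /negP.
Qed.

Lemma is_op_whp Y (b : nat -> R) (M : R) : 0 < M -> is_op P Y b ->
  (\forall T \near \oo, measurable_fun setT (Y T)) ->
  whp (fun T => [set w | `|Y T w| <= M * b T]).
Proof.
move=> M0 /(_ M M0) oY mY e e0.
have /fine_cvgP[fin /cvgrPdist_le/(_ e e0) C] := oY.
near=> T.
have mYT : measurable_fun setT (Y T) by near: T.
have [mE cE] := @compl_le Y T (M * b T) mYT.
exists [set w | `|Y T w| <= M * b T]; split => //; rewrite cE.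
have f1 : P [set w | (M * b T < `|Y T w|)%R] \is a fin_num by near: T; exact: fin.
have f2 : `|0 - fine (P [set w | (M * b T < `|Y T w|)%R])| <= e by near: T; exact: C.
rewrite -(fineK f1) lee_fin; apply: le_trans f2; rewrite sub0r normrN; exact: ler_norm.
Unshelve. all: end_near. Qed.

Lemma is_Op_wp Y (b : nat -> R) : is_Op P Y b ->
  (\forall T \near \oo, measurable_fun setT (Y T)) ->
  forall e, 0 < e -> exists2 M : R, 0 < M & wp e (fun T => [set w | `|Y T w| <= M * b T]).
Proof.
move=> OY mY e e0; have [M [M0 HM]] := OY e e0; exists M => //; near=> T.
have mYT : measurable_fun setT (Y T) by near: T.
have [mE cE] := @compl_le Y T (M * b T) mYT.
exists [set w | `|Y T w| <= M * b T]; split => //; rewrite cE.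
by near: T.
Unshelve. all: end_near. Qed.

Lemma wp_ge (e : R) (B : nat -> set W) : (forall T, measurable (B T)) -> wp e B ->
  \forall T \near \oo, ((1 - e)%:E <= P (B T))%E.
Proof.
move=> mB wB; near=> T.
have [E [mE PE EB]] : exists E : set W,
  [/\ measurable E, (P (~` E) <= e%:E)%E & E `<=` B T] by near: T.
apply: (@le_trans _ _ (P E)); last by apply: le_measure; rewrite ?inE.
move: PE; rewrite probability_setC// -(@fineK _ (P E)) ?fin_num_measure//.
by rewrite -EFinB !lee_fin; lra.
Unshelve. all: end_near. Qed.

End HighProbability.

Section Kernel.
Context {R : realType}.
Variable K : R -> R.
Hypothesis hK : cond_K K.

Lemma kernel_lipschitz : exists2 L : R, 0 < L & forall u v, `|K u - K v| <= L * `|u - v|.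
Proof.
have [_ lK _ _] := hK.
have [M [Mr HM]] := lK.
exists (`|M| + 1); first by rewrite ltr_wpDl.
move=> u v; have /= := HM (`|M| + 1) _ (u, v); apply => //.
by rewrite (le_lt_trans (ler_norm _))// ltrDl.
Qed.

(** K vanishes at 2, which is at distance at most 3 from every point of [-1, 1]. *)
Lemma kernel_bound : exists2 M : R, 0 < M & forall u, `|K u| <= M.
Proof.
have [L L0 LK] := kernel_lipschitz; have [_ _ K0 _] := hK.
exists (3 * L); first by rewrite mulr_gt0.
have K2 : K 2 = 0 by apply: K0; rewrite ger0_norm// ltr1n.
move=> u; have [u1|u1] := leP `|u| 1; last by rewrite K0// normr0 mulr_ge0// ltW.
rewrite -[K u]subr0 -{1}K2 (le_trans (LK _ _))// mulrC ler_wpM2r ?(ltW L0)//.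
rewrite (le_trans (ler_normB _ _))// [`|2|]ger0_norm//; lra.
Qed.

Lemma kernel_pos : exists u : R, 0 < K u.
Proof.
have [K0 _ _ KI] := hK; apply: contrapT => h.
have Kz u : K u = 0.
  by apply/eqP; rewrite eq_le K0 andbT leNgt; apply/negP => Ku; apply: h; exists u.
move: KI; under eq_integral do rewrite Kz.
by rewrite integral0 => -[] /eqP; rewrite eq_sym oner_eq0.
Qed.

Lemma kw_out b (i l : nat) : 0 < b -> b < `|i%:R - l%:R| -> kw K b i l = 0.
Proof.
have [_ _ K0 _] := hK; move=> b0 h; apply: K0.
by rewrite normrM [`|b^-1|]gtr0_norm ?invr_gt0// ltr_pdivlMr// mul1r.
Qed.

Lemma kw_ge0 b t i : 0 <= kw K b t i.
Proof. by have [K0 _ _ _] := hK; exact: K0. Qed.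

Lemma kw_far b (i l : nat) : 0 < b ->
  ((i + Num.truncn b < l) || (l + Num.truncn b < i))%N -> kw K b i l = 0.
Proof.
move=> b0 h; apply: kw_out => //.
apply: (lt_le_trans (truncnS_gt b)).
case/orP: h => h.
  rewrite distrC -natrB; last by rewrite (leq_trans _ (ltnW h))// leq_addr.
  by rewrite ger0_norm// ler_nat ltn_subRL.
rewrite -natrB; last by rewrite (leq_trans _ (ltnW h))// leq_addr.
by rewrite ger0_norm// ler_nat ltn_subRL.
Qed.

(** Stated over a module, so that it serves matrices, vectors and numbers alike. *)
Lemma sum_kw_restrict (V : lmodType R) b (i T lo hi : nat) (F : nat -> V) : 0 < b ->
  (1 <= lo)%N -> (hi <= T.+1)%N -> (lo + Num.truncn b <= i)%N ->
  (i + Num.truncn b < hi)%N ->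
  \sum_(1 <= l < T.+1) kw K b i l *: F l = \sum_(lo <= l < hi) kw K b i l *: F l.
Proof.
move=> b0 lo1 hiT loi ihi.
have lohi : (lo <= hi)%N.
  by rewrite (leq_trans _ (ltnW ihi))// (leq_trans _ (leq_addr _ _))// (leq_trans (leq_addr _ _) loi).
rewrite (big_cat_nat (n := lo))//=; last exact: leq_trans hiT.
rewrite big_nat big1 ?add0r; last first.
  move=> l /andP[_ llo]; rewrite kw_far ?scale0r//; apply/orP; right.
  by rewrite (leq_trans _ loi)// ltn_add2r.
rewrite (big_cat_nat (n := hi))//= [X in _ + X]big_nat [X in _ + X]big1 ?addr0//.
move=> l /andP[hil _]; rewrite kw_far ?scale0r//; apply/orP; left.
exact: leq_trans hil.
Qed.

(** By the Lipschitz condition K >= K(u0) / 2 within zt of a point u0 where K is positive. On the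
    scale b this neighbourhood contains at least zt b / 2 integers, which gives k = zt K(u0) / 4. *)
Lemma kernel_sum_ge : exists2 k : R, 0 < k & exists2 b0 : R, 0 < b0 &
  forall (b : R) (i lo hi : nat), b0 <= b -> (1 <= lo)%N ->
  (lo + Num.truncn b <= i)%N -> (i + Num.truncn b < hi)%N ->
  k * b <= \sum_(lo <= l < hi) kw K b i l.
Proof.
have [L L0 LK] := kernel_lipschitz; have [u0 Ku0] := kernel_pos.
have [Kge0 _ Kout _] := hK.
have u01 : `|u0| <= 1.
  by rewrite leNgt; apply/negP => /Kout; move: Ku0 => /[swap] ->; rewrite ltxx.
pose zt := K u0 / (2 * L).
have zt0 : 0 < zt by rewrite divr_gt0// mulr_gt0.
have Knear u : `|u - u0| <= zt -> K u0 / 2 <= K u.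
  move=> h; have := LK u u0 => h1.
  have h2 : L * `|u - u0| <= L * zt by rewrite ler_wpM2l// ltW.
  have h3 : L * zt = K u0 / 2 by rewrite /zt; field; rewrite gt_eqF.
  have := ler_norm (K u0 - K u); rewrite distrC; lra.
exists (zt * K u0 / 4); first by rewrite divr_gt0// mulr_gt0.
exists (2 / zt); first by rewrite divr_gt0.
move=> b i lo hi bb0 lo1 loi ihi.
have b0 : 0 < b by apply: lt_le_trans bb0; rewrite divr_gt0.
have ztb : 2 <= zt * b by rewrite mulrC -ler_pdivrMr.
pose c := i%:R - u0 * b.
have ub : `|u0 * b| <= b by rewrite normrM (gtr0_norm b0) ler_piMl// ltW.
have ib : b <= i%:R.
  rewrite (le_trans (ltW (truncnS_gt b)))// ler_nat.
  by rewrite (leq_trans _ loi)// -add1n leq_add2r.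
have c0 : 0 <= c by rewrite /c subr_ge0 (le_trans (ler_norm _))// (le_trans ub).
have /andP[c1 c2] := truncn_itv c0.
set l0 := Num.truncn c in c1 c2.
have ztb0 : 0 <= zt * b by lra.
have /andP[q1 q2] := truncn_itv ztb0.
set q := Num.truncn _ in q1 q2.
(* The integers counted start at floor(c), where c = i - u0 b is the point with kernel argument u0;
   they stay within zt b of c. *)
have inK l : (l0 <= l < l0 + q)%N -> K u0 / 2 <= kw K b i l.
  move=> /andP[l1 l2]; apply: Knear.
  have -> : (i%:R - l%:R) / b - u0 = (c - l%:R) / b.
    by rewrite /c; field; rewrite gt_eqF.
  rewrite normrM [`|b^-1|]gtr0_norm ?invr_gt0// ler_pdivrMr//.
  have h1 : l0%:R <= l%:R :> R by rewrite ler_nat.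
  have h2 : l%:R + 1 <= l0%:R + q%:R :> R by rewrite -natrD natr1 ler_nat.
  have c2' : c < l0%:R + 1 by rewrite natr1.
  by rewrite ler_norml; apply/andP; split; lra.
(* Their weights are positive, and weights outside [lo, hi) vanish; so these indices do lie in the
   range of summation. *)
have sub l : (l0 <= l < l0 + q)%N -> (lo <= l < hi)%N.
  move=> lq; have Kl := inK l lq; have kpos : 0 < kw K b i l.
    by apply: lt_le_trans Kl; rewrite divr_gt0.
  apply/andP; split; rewrite leqNgt; apply/negP => hl.
    move: kpos; rewrite kw_far ?ltxx//; apply/orP; right.
    by rewrite (leq_trans _ loi)// ltn_add2r.
  move: kpos; rewrite kw_far ?ltxx//; apply/orP; left.
  by rewrite (leq_trans ihi).
have [q0|q0] := posnP q.
  by exfalso; rewrite q0 in q2; lra.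
have lo0 : (lo <= l0)%N by have /andP[] := sub l0 ltac:(by rewrite leqnn -[X in (X < _)%N]addn0 ltn_add2l).
have hi0 : (l0 + q <= hi)%N.
  have /andP[_] := sub (l0 + q).-1 ltac:(by rewrite -ltnS prednK ?addn_gt0 ?q0 ?orbT// -[X in (X < _)%N]addn0 ltn_add2l q0 leqnn).
  by rewrite prednK// addn_gt0 q0 orbT.
rewrite (big_cat_nat (n := l0))//=; last by rewrite (leq_trans (leq_addr q l0)).
rewrite [X in _ + X](big_cat_nat (n := l0 + q))//= ?leq_addr//.
rewrite -[leLHS]add0r lerD ?sumr_ge0//; first by move=> l _; exact: kw_ge0.
rewrite -[leLHS]addr0 lerD ?sumr_ge0//; last by move=> l _; exact: kw_ge0.
apply: (@le_trans _ _ (\sum_(l0 <= l < l0 + q) (K u0 / 2))).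
  rewrite sumr_const_nat addKn -[leRHS]mulr_natl.
  have q3 : zt * b / 2 <= q%:R by rewrite -natr1 in q2; lra.
  have := ler_wpM2r (ltW (divr_gt0 Ku0 (ltr0Sn R 1))) q3.
  by apply: le_trans; rewrite le_eqVlt; apply/orP; left; apply/eqP; field.
by apply: ler_sum_nat => l; exact: inK.
Qed.

End Kernel.

(** * Moments of the data *)

Section ExpectationSums.
Context {d : measure_display} {W : measurableType d} {R : realType}.
Variable P : probability W R.

Lemma Ex_integral0 (f : W -> R) : (\int[P]_w (f w)%:E = 0)%E -> Ex P f = 0.
Proof. by rewrite /Ex /Rintegral => ->. Qed.

Lemma itg_sum_in (I : eqType) (s : seq I) (F : I -> W -> R) :
  (forall i, i \in s -> itg P (F i)) -> itg P (fun w => \sum_(i <- s) F i w).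
Proof.
elim: s => [|i s IHs] iF.
  by under eq_fun do rewrite big_nil; exact: itg_cst.
under eq_fun do rewrite big_cons; apply: itgD; first by apply: iF; rewrite mem_head.
by apply: IHs => j js; apply: iF; rewrite inE js orbT.
Qed.

Lemma Ex_sum_in (I : eqType) (s : seq I) (F : I -> W -> R) :
  (forall i, i \in s -> itg P (F i)) ->
  Ex P (fun w => \sum_(i <- s) F i w) = \sum_(i <- s) Ex P (F i).
Proof.
elim: s => [|i s IHs] iF.
  by rewrite big_nil -[RHS](Ex_cst P); congr (Ex P); apply/funext => w; rewrite big_nil.
have is_ j : j \in s -> itg P (F j) by move=> js; apply: iF; rewrite inE js orbT.
have ii : itg P (F i) by apply: iF; rewrite mem_head.
rewrite big_cons -IHs// -ExD//; last exact: itg_sum_in.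
by congr (Ex P); apply/funext => w; rewrite big_cons.
Qed.

Lemma Ex_orthogonal_sum (s : seq nat) (c : nat -> R) (xi zt : nat -> W -> R) : uniq s ->
  (forall l m, l \in s -> m \in s -> itg P (fun w => xi l w * zt m w)) ->
  (forall l m, l \in s -> m \in s -> l <> m -> Ex P (fun w => xi l w * zt m w) = 0) ->
  itg P (fun w => (\sum_(l <- s) c l * xi l w) * (\sum_(l <- s) c l * zt l w)) /\
  Ex P (fun w => (\sum_(l <- s) c l * xi l w) * (\sum_(l <- s) c l * zt l w)) =
  \sum_(l <- s) c l ^+ 2 * Ex P (fun w => xi l w * zt l w).
Proof.
move=> us ix ort.
have E : (fun w => (\sum_(l <- s) c l * xi l w) * (\sum_(l <- s) c l * zt l w)) =
    fun w => \sum_(l <- s) \sum_(m <- s) (c l * c m) * (xi l w * zt m w).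
  apply/funext => w; rewrite mulr_suml; apply: eq_bigr => l _; rewrite mulr_sumr.
  by apply: eq_bigr => m _; ring.
have i1 l : l \in s -> itg P (fun w => \sum_(m <- s) (c l * c m) * (xi l w * zt m w)).
  by move=> ls; apply: itg_sum_in => m ms; apply: itgZ; exact: ix.
rewrite E; split; first exact: itg_sum_in.
rewrite Ex_sum_in//; apply: eq_big_seq => l ls.
rewrite Ex_sum_in; last by move=> m ms; apply: itgZ; exact: ix.
rewrite (bigD1_seq l)//= big_seq_cond big1 ?addr0; last first.
  move=> m /andP[ms ml]; rewrite ExZ ?ort ?mulr0//; last exact: ix.
  by move=> lm; rewrite lm eqxx in ml.
by rewrite ExZ ?expr2//; exact: ix.
Qed.

End ExpectationSums.

Section Processes.
Context {d dV : measure_display} {W : measurableType d} {SV : measurableType dV}.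
Context {R : realType} {p : nat}.
Variables (P : probability W R) (x : nat -> W -> 'cV[R]_p) (eps : nat -> {RV P >-> R}).
Variables (q : R) (V : int -> {RV P >-> SV}).
Hypotheses (x_rv : forall t, (1 <= t)%N -> random_vector (x t)) (q2 : 2 < q).
Hypothesis nx : forall i, ned_moment V q (fun t w => x t w i 0).
Hypothesis ne : ned_moment V q (fun t w => eps t w).
Hypothesis xq : exists C, forall t, (1 <= t)%N ->
  itg P (fun w => frob (x t w) `^ (2 * q)) /\ Ex P (fun w => frob (x t w) `^ (2 * q)) <= C.
Hypothesis hDb : cond_Db x eps.
Local Notation Ex_of := Ex.
Local Notation Ex := (Ex P).
Local Notation itg := (itg P).

Definition mom4 t w : R := 1 + frob (x t w) ^+ 4 + eps t w ^+ 4.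

Let pow4_le (a : R) : 0 <= a -> a ^+ 4 <= 1 + a `^ (2 * q).
Proof.
move=> a0; have [a1|a1] := leP a 1.
  by apply: (@le_trans _ _ 1); [exact: exprn_ile1|rewrite lerDl powR_ge0].
rewrite -powR_mulrn// (@le_trans _ _ (a `^ (2 * q)))// ?lerDr//.
by apply: ler_powR; [exact: ltW|have := q2; rewrite -(ltr_pM2l (ltr0Sn R 1)) => ?; lra].
Qed.

Lemma measurable_eps t : measurable_fun setT (eps t : W -> R).
Proof. exact: measurable_funPT. Qed.

Lemma measurable_frob_x t : (1 <= t)%N -> measurable_fun setT (fun w => frob (x t w)).
Proof. by move=> t1; apply: measurable_frob => i j; rewrite (ord1 j); exact: x_rv. Qed.

Lemma mom4_bound : exists2 C : R, 0 < C & forall t, (1 <= t)%N ->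
  itg (mom4 t) /\ Ex (mom4 t) <= C.
Proof.
have [Cx Hx] := xq; have [_ [Ce He] _] := ne.
exists (3 + `|Cx| + `|Ce|); first by rewrite ltr_wpDr// ltr_wpDr.
move=> t t1; have [ix ex] := Hx t t1; have [ie ee] := He t t1.
pose D w := (1 + (1 + frob (x t w) `^ (2 * q))) + (1 + `|eps t w| `^ (2 * q)).
have j1 := itgD (itg_cst P 1) ix; have j2 := itgD (itg_cst P 1) j1.
have j3 := itgD (itg_cst P 1) ie.
have iD : itg D := itgD j2 j3.
have mD w : mom4 t w <= D w.
  rewrite /mom4 /D lerD ?lerD2l ?pow4_le ?frob_ge0//.
  have -> : eps t w ^+ 4 = `|eps t w| ^+ 4.
    by rewrite -[RHS]normrX ger0_norm// exprn_even_ge0.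
  exact: pow4_le.
have m0 w : 0 <= mom4 t w.
  by rewrite /mom4 !addr_ge0// exprn_even_ge0.
have im : itg (mom4 t).
  apply: (itg_dom _ iD); last by move=> w; rewrite ger0_norm.
  apply: measurable_funD; last by apply: measurable_funX; exact: measurable_eps.
  by apply: measurable_funD => //; apply: measurable_funX; exact: measurable_frob_x.
split => //; apply: (le_trans (Ex_le im iD mD)).
rewrite /D (ExD j2 j3) (ExD (itg_cst _ _) j1) (ExD (itg_cst _ _) ix) (ExD (itg_cst _ _) ie) !Ex_cst.
have h1 := le_trans ex (ler_norm Cx); have h2 := le_trans ee (ler_norm Ce).
rewrite [leRHS](_ : _ = 1 + (1 + `|Cx|) + (1 + `|Ce|)); last by ring.
by rewrite lerD// lerD2l// lerD2l.
Qed.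

(* Products of four coordinates of the vector (1, x, eps), as in [prod4_ned_L1]. *)
Definition fxx i j t w : R := x t w i 0 * x t w j 0 * 1 * 1.
Definition gx i t w : R := eps t w * x t w i 0 * 1 * 1.
Definition hxx i j t w : R := eps t w * eps t w * x t w i 0 * x t w j 0.

Lemma fxx_ned i j : ned_L1 V (fxx i j).
Proof.
exact: (prod4_ned_L1 q2 (nx i) (nx j) (ned_moment_one V q) (ned_moment_one V q)).
Qed.

Lemma gx_ned i : ned_L1 V (gx i).
Proof.
exact: (prod4_ned_L1 q2 ne (nx i) (ned_moment_one V q) (ned_moment_one V q)).
Qed.

Lemma hxx_ned i j : ned_L1 V (hxx i j).
Proof. exact: (prod4_ned_L1 q2). Qed.

Lemma mean_mxE i j t :
  mean_mx P (fun w => x t w *m (x t w)^T) i j = Ex (fxx i j t).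
Proof.
rewrite mxE unlock; congr fine; apply: eq_integral => w _.
by rewrite /fxx !mulr1 mxE big_ord1 mxE.
Qed.

Lemma Ex_gx i t : (1 <= t)%N -> Ex (gx i t) = 0.
Proof.
move=> t1; have [h _] := hDb; have := h t i t1; rewrite unlock => E.
apply: Ex_integral0; rewrite -[RHS]E.
by apply: eq_integral => w _; rewrite /gx !mulr1.
Qed.

(** The inequality 2 |a b| <= a^2 + b^2, once for the two scores and once for the two factors of
    each squared score. *)
Lemma prod4_mom4 (l m : nat) i j w :
  `|gx i l w * gx j m w| <= mom4 l w + mom4 m w.
Proof.
rewrite /gx /mom4 !mulr1.
have h (a b : R) : `|a * b| <= (a ^+ 2 + b ^+ 2) / 2.
  rewrite normrM -[a ^+ 2]real_normK ?num_real// -[b ^+ 2]real_normK ?num_real//.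
  have := sqr_ge0 (`|a| - `|b|); rewrite sqrrB -mulr_natr => ?; lra.
have xk k n : x n w k 0 ^+ 4 <= frob (x n w) ^+ 4.
  have -> : x n w k 0 ^+ 4 = `|x n w k 0| ^+ 4.
    by rewrite -[RHS]normrX ger0_norm// exprn_even_ge0.
  by rewrite lerXn2r ?nnegrE ?frob_ge0// ler_norm_frob.
have sq k n : (eps n w * x n w k 0) ^+ 2 <= (eps n w ^+ 4 + frob (x n w) ^+ 4) / 2.
  have := h (eps n w ^+ 2) (x n w k 0 ^+ 2); rewrite -exprMn -!exprM ger0_norm ?sqr_ge0//.
  have := xk k n; lra.
have h1 := h (eps l w * x l w i 0) (eps m w * x m w j 0).
have h2 := sq i l; have h3 := sq j m.
have p1 n : 0 <= frob (x n w) ^+ 4 by exact: exprn_even_ge0.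
have p2 n : 0 <= eps n w ^+ 4 by exact: exprn_even_ge0.
have := p1 l; have := p1 m; have := p2 l; have := p2 m; lra.
Qed.

Lemma measurable_gx i t : (1 <= t)%N -> measurable_fun setT (gx i t).
Proof.
move=> t1; do 2 apply: measurable_funM => //.
by apply: measurable_funM; [exact: measurable_eps|exact: x_rv].
Qed.

Lemma itg_gx_prod l m i j : (1 <= l)%N -> (1 <= m)%N ->
  itg (fun w => gx i l w * gx j m w).
Proof.
move=> l1 m1; have [C C0 HC] := mom4_bound.
have [il _] := HC l l1; have [im _] := HC m m1.
apply: (itg_dom _ (itgD il im)); last by move=> w; exact: prod4_mom4.
by apply: measurable_funM; exact: measurable_gx.
Qed.

Lemma Ex_gx_orth l m i j : (1 <= l)%N -> (1 <= m)%N -> l <> m ->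
  Ex (fun w => gx i l w * gx j m w) = 0.
Proof.
move=> l1 m1 lm; have [h0 h] := hDb; have := h l m i j l1 m1 lm.
rewrite unlock /covariance !h0// => E.
apply: Ex_integral0; rewrite -[RHS]E.
rewrite expectation.unlock; apply: eq_integral => w _.
change ((gx i l w * gx j m w)%:E =
  ((eps l w * x l w i 0 - 0) * (eps m w * x m w j 0 - 0))%:E).
by rewrite /gx !mulr1 !subr0.
Qed.

Lemma gx_sqE i j t w : gx i t w * gx j t w = hxx i j t w.
Proof. by rewrite /gx /hxx; ring. Qed.

Lemma itg_gx i t : (1 <= t)%N -> itg (gx i t).
Proof. by move=> t1; have [h _] := gx_ned i; exact: h. Qed.

(** Serial uncorrelatedness removes the cross terms. The remaining sum, with squared weights, is the
    mean of the average to which the law of large numbers for [hxx] applies; this ties Sg to the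
    conditional bootstrap covariance. *)
Lemma var_mxE (s : seq nat) (c : nat -> R) i j : uniq s ->
  (forall l, l \in s -> (1 <= l)%N) ->
  var_mx P (fun w => \sum_(l <- s) c l *: (eps l w *: x l w)) i j =
  \sum_(l <- s) c l ^+ 2 * Ex (hxx i j l).
Proof.
move=> us s1.
have XE k : (fun w => (\sum_(l <- s) c l *: (eps l w *: x l w)) k 0) =
    fun w => \sum_(l <- s) c l * gx k l w.
  apply/funext => w; rewrite summxE; apply: eq_bigr => l _.
  by rewrite !mxE /gx !mulr1.
have E0 k : ('E_P[fun w => (\sum_(l <- s) c l * gx k l w)%R] = 0)%E.
  rewrite unlock EFin_Ex; last by apply: itg_sum_in => l /s1 l1; exact/itgZ/itg_gx.
  rewrite Ex_sum_in; last by move=> l /s1 l1; exact/itgZ/itg_gx.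
  rewrite big_seq big1// => l /s1 l1; rewrite ExZ ?Ex_gx ?mulr0//; exact: itg_gx.
have [_ E] := @Ex_orthogonal_sum _ _ _ P s c (gx i) (gx j) us
   (fun l m ls ms => itg_gx_prod i j (s1 l ls) (s1 m ms))
   (fun l m ls ms => Ex_gx_orth i j (s1 l ls) (s1 m ms)).
transitivity (\sum_(l <- s) c l ^+ 2 * Ex (fun w => gx i l w * gx j l w)); last first.
  by apply: eq_bigr => l _; congr (_ * Ex_of _ _); apply/funext => w; exact: gx_sqE.
rewrite -E mxE !XE unlock /covariance !E0 expectation.unlock; congr fine.
apply: eq_integral => w _ /=.
by congr EFin; congr (_ * _); exact: subr0.
Qed.

End Processes.

(** * Decomposition of the remainder *)

Section BandwidthAlgebra.
Context {R : realType} {p : nat}.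
Variables (K : R -> R) (M0 : R).
Hypothesis KM : forall u, `|K u| <= M0.
Variables (T : nat) (b1 b2 : R) (t : nat).
Variables (x beta : nat -> 'cV[R]_p) (eps y : nat -> R).
Hypothesis model : forall i, (1 <= i <= T)%N -> y i = ((x i)^T *m beta i) 0 0 + eps i.
Hypotheses (b10 : 0 < b1) (b20 : 0 < b2).

Definition gram1 i : 'M[R]_p :=
  b1^-1 *: (\sum_(1 <= l < T.+1) kw K b1 i l *: (x l *m (x l)^T)).
Definition noise i : 'cV[R]_p :=
  b1^-1 *: (\sum_(1 <= l < T.+1) kw K b1 i l *: (eps l *: x l)).
Definition bias i : 'cV[R]_p :=
  b1^-1 *: (\sum_(1 <= l < T.+1) kw K b1 i l *: (x l *m (x l)^T *m (beta l - beta i))).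
Definition gram2 : 'M[R]_p :=
  b2^-1 *: (\sum_(i <- win T b2 t) kw K b2 t i *: (x i *m (x i)^T)).
(** [mom4] at a fixed sample point. The summand 1 makes it dominate |x|^2 too, as used in
    [centre_le]. *)
Definition quartic i : R := 1 + frob (x i) ^+ 4 + eps i ^+ 4.

Local Notation bh := (bhat K T b1 x y).

Lemma mul_rank1 (v w : 'cV[R]_p) : v *m v^T *m w = dotv v w *: v.
Proof.
by rewrite -mulmxA [v^T *m w]mx11_scalar mul_mx_scalar.
Qed.

Lemma dotvBr (u v w : 'cV[R]_p) : dotv u (v - w) = dotv u v - dotv u w.
Proof. by rewrite dotvDr -scaleN1r dotvZr mulN1r. Qed.

Lemma norm1_rank1 (v : 'cV[R]_p) : norm1 (v *m v^T) <= p%:R ^+ 2 * frob v ^+ 2.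
Proof.
apply: (@le_trans _ _ (\sum_(i < p) \sum_(j < p) frob v ^+ 2)).
  apply: ler_sum => i _; apply: ler_sum => j _.
  rewrite mxE big_ord1 mxE normrM expr2 ler_pM ?normr_ge0 ?ler_norm_frob//.
by rewrite !sumr_const !card_ord -mulrnA -[leLHS]mulr_natl natrM -expr2.
Qed.

Lemma invmx_scale (M : 'M[R]_p) (b : R) (v : 'cV[R]_p) : 0 < b ->
  b^-1 *: M \in unitmx -> invmx M *m v = invmx (b^-1 *: M) *m (b^-1 *: v).
Proof.
move=> b0 uM.
by rewrite (invmxZ uM) invrK -scalemxAl -scalemxAr scalerA mulfV ?gt_eqF// scale1r.
Qed.

(** Expanding each y_l around beta_i splits the right-hand side of the normal equations into gram1
    beta_i, bias and noise. *)
Lemma bhat_error i c : (1 <= i <= T)%N -> 0 < c -> coercive (gram1 i) c ->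
  bh i - beta i = invmx (gram1 i) *m (bias i + noise i).
Proof.
move=> iT c0 cG; have uG := coercive_unitmx c0 cG.
rewrite /bhat (invmx_scale _ b10 uG) -/(gram1 i).
have -> : b1^-1 *: (\sum_(1 <= l < T.+1) kw K b1 i l *: (y l *: x l)) =
   bias i + gram1 i *m beta i + noise i.
  rewrite /bias /noise /gram1 -scalemxAl -!scalerDr; congr (_ *: _).
  rewrite mulmx_suml -!big_split/=; apply: eq_big_nat => l lT.
  rewrite model// -scalemxAl -!scalerDr; congr (_ *: _).
  by rewrite mulmxBr subrK scalerDl mul_rank1.
by rewrite addrAC mulmxDr mulKmx// addrK.
Qed.

Lemma bhat_error_le i c B : (1 <= i <= T)%N -> 0 < c -> coercive (gram1 i) c ->
  frob (bias i) <= B -> frob (bh i - beta i) <= c^-1 * (B + frob (noise i)).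
Proof.
move=> iT c0 cG hB; rewrite (bhat_error iT c0 cG).
rewrite (le_trans (coercive_inv _ c0 cG))// ler_wpM2l ?invr_ge0 ?(ltW c0)//.
by rewrite (le_trans (ler_frobD _ _))// lerD2r.
Qed.

Lemma residE i : (1 <= i <= T)%N ->
  resid K T b1 x y i = eps i - dotv (x i) (bh i - beta i).
Proof.
by move=> iT; rewrite /resid model// dotvBr /dotv; ring.
Qed.

(** With u = x'(bhat - beta), the squared residual differs from eps^2 by u (u - 2 eps), where |u| <=
    |x| zt. After multiplication by |x|^2 only |eps| |x|^3 and |x|^4 occur, both below [quartic]. *)
Lemma emp_var_error zt :
  (forall i, i \in win T b2 t -> frob (bh i - beta i) <= zt) ->
  norm1 (emp_var (win T b2 t) (acoef K T b1 b2 t x y) -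
    b2^-1 *: (\sum_(i <- win T b2 t) (kw K b2 t i ^+ 2 * eps i ^+ 2) *: (x i *m (x i)^T)))
  <= M0 ^+ 2 * p%:R ^+ 2 * (2 * zt + zt ^+ 2) *
     (b2^-1 * \sum_(i <- win T b2 t) quartic i).
Proof.
move=> hz.
have -> : emp_var (win T b2 t) (acoef K T b1 b2 t x y) -
    b2^-1 *: (\sum_(i <- win T b2 t) (kw K b2 t i ^+ 2 * eps i ^+ 2) *: (x i *m (x i)^T)) =
   \sum_(i <- win T b2 t) (b2^-1 * (kw K b2 t i ^+ 2 * (resid K T b1 x y i ^+ 2 - eps i ^+ 2)))
      *: (x i *m (x i)^T).
  rewrite /emp_var scaler_sumr -sumrB; apply: eq_bigr => i _.
  rewrite /acoef linearZ/= -scalemxAl -scalemxAr !scalerA -scalerBl; congr (_ *: _).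
  have -> : b2^-1 = (Num.sqrt b2)^-1 ^+ 2 by rewrite exprVn sqr_sqrtr// ltW.
  ring.
have norm1_sum (s : seq nat) (F : nat -> 'M[R]_p) :
    norm1 (\sum_(i <- s) F i) <= \sum_(i <- s) norm1 (F i).
  elim: s => [|i s IHs]; rewrite ?big_nil.
    by rewrite /norm1 big1// => i _; rewrite big1// => j _; rewrite mxE normr0.
  by rewrite !big_cons (le_trans (norm1D _ _))// lerD2l.
have norm1Z (a : R) (F : 'M[R]_p) : norm1 (a *: F) = `|a| * norm1 F.
  rewrite /norm1 mulr_sumr; apply: eq_bigr => i _; rewrite mulr_sumr.
  by apply: eq_bigr => j _; rewrite mxE normrM.
apply: (le_trans (norm1_sum _ _)); rewrite !mulr_sumr.
rewrite big_seq [leRHS]big_seq; apply: ler_sum => i iw; rewrite norm1Z.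
have iT := mem_window iw; have zi := hz i iw.
have zt0 : 0 <= zt := le_trans (frob_ge0 _) zi.
rewrite residE//; set u := dotv _ _.
have hu : `|u| <= frob (x i) * zt.
  by rewrite (le_trans (cauchy_schwarz _ _))// ler_wpM2l ?frob_ge0.
have h1 : `|(eps i - u) ^+ 2 - eps i ^+ 2| <= frob (x i) * zt * (2 * `|eps i| + frob (x i) * zt).
  rewrite (_ : _ - _ = u * (u - 2 * eps i)); last by ring.
  rewrite normrM ler_pM// (le_trans (ler_normB _ _))// normrM ger0_norm// addrC lerD2l.
  exact: hu.
have M00 : 0 <= M0 := le_trans (normr_ge0 _) (KM 0).
have h2 : `|kw K b2 t i ^+ 2| <= M0 ^+ 2.
  by rewrite normrX lerXn2r ?nnegrE//; exact: KM.
rewrite normrM [`|b2^-1|]gtr0_norm ?invr_gt0//.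
rewrite [leRHS]mulrCA -[leLHS]mulrA ler_wpM2l ?invr_ge0 ?(ltW b20)//.
rewrite normrM.
have h3 := norm1_rank1 (x i).
apply: (@le_trans _ _ (M0 ^+ 2 * (frob (x i) * zt * (2 * `|eps i| + frob (x i) * zt)) *
   (p%:R ^+ 2 * frob (x i) ^+ 2))).
  by rewrite ler_pM ?mulr_ge0 ?norm1_ge0// ler_pM.
have -> : M0 ^+ 2 * (frob (x i) * zt * (2 * `|eps i| + frob (x i) * zt)) *
   (p%:R ^+ 2 * frob (x i) ^+ 2) = M0 ^+ 2 * p%:R ^+ 2 *
   (2 * zt * (`|eps i| * frob (x i) ^+ 3) + zt ^+ 2 * frob (x i) ^+ 4) by ring.
rewrite -[leRHS]mulrA ler_wpM2l ?mulr_ge0 ?sqr_ge0//.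
have e4 : `|eps i| ^+ 4 = eps i ^+ 4 by rewrite -normrX ger0_norm// exprn_even_ge0.
have q1 : `|eps i| * frob (x i) ^+ 3 <= quartic i.
  rewrite /quartic -e4; move: (normr_ge0 (eps i)) (frob_ge0 (x i)).
  move: `|eps i| (frob (x i)) => a f a0 f0.
  have h8 := sqr_ge0 (a * f - f ^+ 2); have h4 := sqr_ge0 (a ^+ 2 - f ^+ 2).
  have h5 := exprn_even_ge0 a (isT : ~~ odd 4); have h6 := exprn_even_ge0 f (isT : ~~ odd 4).
  (* Explicit form of a f^3 <= (a^2 f^2 + f^4) / 2 and a^2 f^2 <= (a^4 + f^4) / 2, with the
     discarded squares displayed. *)
  rewrite (_ : a * f ^+ 3 = ((a ^+ 4 + f ^+ 4 - (a ^+ 2 - f ^+ 2) ^+ 2) / 2 + f ^+ 4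
    - (a * f - f ^+ 2) ^+ 2) / 2); last by field.
  move: h8 h4 h5 h6; move: ((a * f - f ^+ 2) ^+ 2) ((a ^+ 2 - f ^+ 2) ^+ 2) (a ^+ 4) (f ^+ 4) => u1 u2 u3 u4.
  lra.
have q2 : frob (x i) ^+ 4 <= quartic i.
  by rewrite /quartic -addrA addrCA lerDl addr_ge0// exprn_even_ge0.
by rewrite [leRHS]mulrDl lerD// ler_wpM2l ?sqr_ge0// mulr_ge0.
Qed.

Variables (Om Sg L : 'M[R]_p) (e : nat -> R).

(** The part of sqrt(b2) R* free of multipliers, that is its conditional mean given the data. *)
Definition centre : 'cV[R]_p := invmx gram2 *m
  (b2^-1 *: (\sum_(i <- win T b2 t) kw K b2 t i *:
     (x i *m (x i)^T *m (Num.sqrt b2 *: (bh i - bh t))))).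

(** Writing bhat_t as gram2^(-1) gram2 bhat_t puts it under the same weighted sum as the bootstrap
    responses, so only differences bhat_i - bhat_t remain besides the multiplier terms. *)
Lemma rstar_decomp c : 0 < c -> coercive gram2 c ->
  Num.sqrt b2 *: rstar K T b1 b2 t Om Sg L x y e = centre +
   \sum_(j <- coupled_index (win T b2 t)) e (mult_index T j) *:
     coupling_resid Om Sg L gram2 (win T b2 t) (acoef K T b1 b2 t x y) j.
Proof.
move=> c0 cG; have uG := coercive_unitmx c0 cG.
have sb : 0 < Num.sqrt b2 by rewrite sqrtr_gt0.
rewrite /rstar scalerBr scalerA divff ?gt_eqF// scale1r.
have -> : \sum_(j <- coupled_index (win T b2 t)) e (mult_index T j) *:
     coupling_resid Om Sg L gram2 (win T b2 t) (acoef K T b1 b2 t x y) j =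
   (\sum_(i <- win T b2 t) e i *: (invmx gram2 *m acoef K T b1 b2 t x y i)) -
   zstar K T b1 b2 t Om Sg L x y e.
  rewrite /zstar /coupled_index !big_cat/= !big_map opprD addrA -sumrB -sumrN.
  by congr (_ + _); apply: eq_bigr => i _; rewrite ?scalerBr ?scalerN.
rewrite addrA; congr (_ - _).
have -> : bstar K T b1 b2 x y e t = invmx gram2 *m (b2^-1 *:
    (\sum_(i <- win T b2 t) kw K b2 t i *: (ystar K T b1 x y e i *: x i))).
  by rewrite /bstar (invmx_scale _ b20 uG).
have -> : bh t = invmx gram2 *m (b2^-1 *:
    (\sum_(i <- win T b2 t) kw K b2 t i *: (x i *m (x i)^T *m bh t))).
  have -> : b2^-1 *: (\sum_(i <- win T b2 t) kw K b2 t i *: (x i *m (x i)^T *m bh t)) =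
     gram2 *m bh t.
    rewrite /gram2 -scalemxAl mulmx_suml; congr (_ *: _).
    by apply: eq_bigr => i _; rewrite -scalemxAl.
  by rewrite mulKmx.
rewrite -mulmxBr -scalerBr -sumrB /centre scalemxAr.
have -> : \sum_(i <- win T b2 t) e i *: (invmx gram2 *m acoef K T b1 b2 t x y i) =
   invmx gram2 *m (\sum_(i <- win T b2 t) e i *: acoef K T b1 b2 t x y i).
  by rewrite mulmx_sumr; apply: eq_bigr => i _; rewrite scalemxAr.
rewrite -mulmxDr; congr (_ *m _).
rewrite !scaler_sumr -big_split/=; apply: eq_bigr => i _.
rewrite /ystar /acoef -scalemxAr !mul_rank1 -/(dotv (x i) (bh i)) dotvBr.
rewrite !scalerA -scalerBl !scalerA -scalerDl; congr (_ *: _).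
have -> : b2^-1 = (Num.sqrt b2)^-1 ^+ 2 by rewrite exprVn sqr_sqrtr// ltW.
by field; rewrite gt_eqF.
Qed.

End BandwidthAlgebra.

Section CentreBound.
Context {R : realType} {p : nat}.
Variables (K : R -> R) (M0 : R).
Hypothesis KM : forall u, `|K u| <= M0.
Variables (T : nat) (b1 b2 : R) (t : nat).
Variables (x beta : nat -> 'cV[R]_p) (eps y : nat -> R).
Hypothesis model : forall i, (1 <= i <= T)%N -> y i = ((x i)^T *m beta i) 0 0 + eps i.
Hypotheses (b10 : 0 < b1) (b20 : 0 < b2).
Local Notation bh := (bhat K T b1 x y).
Local Notation noise := (noise K T b1 x eps).
Local Notation gram1 := (gram1 K T b1 x).
Local Notation gram2 := (gram2 K T b2 t x).
Local Notation bias := (bias K T b1 x beta).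

(** The total contribution of the estimation noise to the centre: averaged over the window, plus the
    noise at t. It is the only part that fails to vanish when gamma2 = gamma1. *)
Definition noise_load : R :=
  b2^-1 * (\sum_(i <- win T b2 t) frob (x i) ^+ 2 * (Num.sqrt b2 * frob (noise i))) +
  Num.sqrt b2 * frob (noise t).

(** [D] bounds bias and drift together: the factor 2 / c1 + 1 counts the biases at i and at t and
    one drift. The noise is kept apart in [noise_load], so that D can later be taken small
    independently of it. *)
Lemma centre_le (c1 c2 D M4 : R) : 0 < c1 -> 0 < c2 -> coercive gram2 c2 ->
  (1 <= t <= T)%N ->
  (forall i, i \in win T b2 t -> [/\ coercive (gram1 i) c1,
     Num.sqrt b2 * frob (bias i) <= D & Num.sqrt b2 * frob (beta i - beta t) <= D]) ->
  coercive (gram1 t) c1 -> Num.sqrt b2 * frob (bias t) <= D ->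
  b2^-1 * (\sum_(i <- win T b2 t) quartic x eps i) <= M4 ->
  frob (centre K T b1 b2 t x y) <= c2^-1 * M0 *
    ((2 * c1^-1 + 1) * D * M4 + c1^-1 * (1 + M4) * noise_load).
Proof.
move=> c10 c20 cG2 tT hwin cGt bt hM4.
have sb : 0 < Num.sqrt b2 by rewrite sqrtr_gt0.
have M00 : 0 <= M0 := le_trans (normr_ge0 _) (KM 0).
have D0 : 0 <= D by rewrite (le_trans _ bt)// mulr_ge0 ?frob_ge0// ltW.
pose F i := frob (x i) ^+ 2.
have F4 i : F i <= quartic x eps i.
  rewrite /F /quartic; have h1 := sqr_ge0 (frob (x i) ^+ 2 - 1).
  have h2 : 0 <= eps i ^+ 4 by exact: exprn_even_ge0.
  have -> : frob (x i) ^+ 4 = (frob (x i) ^+ 2) ^+ 2 by rewrite -exprM.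
  move: h1 h2 (sqr_ge0 (frob (x i))); move: (frob (x i) ^+ 2) (eps i ^+ 4) => u v h1 h2 h3.
  by rewrite sqrrB expr1n mulr1 in h1; move: h1; move: (u ^+ 2) => u2 h1; lra.
have errw i : (1 <= i <= T)%N -> coercive (gram1 i) c1 ->
    Num.sqrt b2 * frob (bias i) <= D ->
    Num.sqrt b2 * frob (bh i - beta i) <= c1^-1 * (D + Num.sqrt b2 * frob (noise i)).
  move=> iT ci bi; have := bhat_error_le model b10 iT c10 ci (lexx _).
  move=> /(ler_wpM2l (ltW sb)) /le_trans; apply.
  by rewrite mulrCA ler_wpM2l ?invr_ge0 ?(ltW c10)// mulrDr lerD2r.
have st := errw t tT cGt bt.
have dif i : i \in win T b2 t -> Num.sqrt b2 * frob (bh i - bh t) <=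
    (2 * c1^-1 + 1) * D + c1^-1 * (Num.sqrt b2 * frob (noise t)) +
    c1^-1 * (Num.sqrt b2 * frob (noise i)).
  move=> iw; have [ci bi di] := hwin i iw; have si := errw i (mem_window iw) ci bi.
  (* Estimation error at i, minus estimation error at t, plus parameter drift. *)
  have -> : bh i - bh t = (bh i - beta i) + (- (bh t - beta t)) + (beta i - beta t).
    by apply/matrixP => k l; rewrite !mxE; ring.
  have h := ler_wpM2l (ltW sb) (ler_frobD (bh i - beta i + - (bh t - beta t)) (beta i - beta t)).
  have h' := ler_wpM2l (ltW sb) (ler_frobD (bh i - beta i) (- (bh t - beta t))).
  apply: (le_trans h); rewrite mulrDr frobN mulrDr in h' *; lra.
rewrite /centre; apply: (le_trans (coercive_inv _ c20 cG2)).
rewrite -[leRHS]mulrA ler_wpM2l ?invr_ge0 ?(ltW c20)//.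
rewrite frobZ gtr0_norm ?invr_gt0//.
have S0 : b2^-1 * \sum_(i <- win T b2 t) F i <= M4.
  apply: le_trans hM4; rewrite ler_wpM2l ?invr_ge0 ?(ltW b20)//.
  exact: ler_sum.
have nt0 : 0 <= Num.sqrt b2 * frob (noise t) by rewrite mulr_ge0 ?frob_ge0// ltW.
set A := (2 * c1^-1 + 1) * D + c1^-1 * (Num.sqrt b2 * frob (noise t)) in dif.
have A0 : 0 <= A.
  have ic : 0 <= c1^-1 by rewrite invr_ge0 ltW.
  by apply: addr_ge0; apply: mulr_ge0 => //; apply: addr_ge0 => //; apply: mulr_ge0.
apply: (@le_trans _ _ (b2^-1 * \sum_(i <- win T b2 t)
    (M0 * (A * F i + c1^-1 * (F i * (Num.sqrt b2 * frob (noise i))))))).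
  rewrite ler_wpM2l ?invr_ge0 ?(ltW b20)// (le_trans (ler_frob_sum _ _))//.
  rewrite big_seq [leRHS]big_seq; apply: ler_sum => i iw.
  rewrite frobZ mul_rank1 frobZ dotvZr normrM (gtr0_norm sb).
  rewrite ler_pM ?mulr_ge0 ?frob_ge0 ?(ltW sb)//; first exact: KM.
  apply: (@le_trans _ _ (F i * (Num.sqrt b2 * frob (bh i - bh t)))).
    rewrite [leRHS](_ : _ = Num.sqrt b2 * (frob (x i) * frob (bh i - bh t)) * frob (x i)).
      by rewrite ler_wpM2r ?frob_ge0// ler_wpM2l ?(ltW sb)// cauchy_schwarz.
    by rewrite /F; ring.
  have := ler_wpM2l (sqr_ge0 (frob (x i))) (dif i iw); rewrite -/(F i); lra.
rewrite -mulr_sumr mulrCA ler_wpM2l// big_split/= -!mulr_sumr /noise_load.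
set N := \sum_(i <- _) _ * (_ * _).
have h1 := ler_wpM2l A0 S0.
have N0 : 0 <= N.
  by apply: sumr_ge0 => i _; rewrite !mulr_ge0 ?frob_ge0 ?sqr_ge0 ?(ltW sb).
have c1N : 0 <= c1^-1 * (b2^-1 * N) by rewrite !mulr_ge0 ?invr_ge0 ?(ltW c10) ?(ltW b20).
have M40 : 0 <= M4.
  by apply: le_trans S0; rewrite mulr_ge0 ?invr_ge0 ?(ltW b20)// sumr_ge0// => i _; exact: sqr_ge0.
have c1n : 0 <= c1^-1 * (Num.sqrt b2 * frob (noise t)) by rewrite mulr_ge0 ?invr_ge0 ?(ltW c10).
have h2 := mulr_ge0 c1N M40.
rewrite mulrDr [b2^-1 * (A * _)]mulrCA [b2^-1 * (c1^-1 * _)]mulrCA.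
apply: (le_trans (lerD h1 (lexx _))); rewrite /A.
move: c1N c1n h2; move: (c1^-1) (b2^-1 * N) (Num.sqrt b2 * frob (noise t)) => u v w0.
move=> h3 h4 h5; lra.
Qed.

End CentreBound.

Section Tail.
Context {d' : measure_display} {W' : measurableType d'} {R : realType} {p : nat}.
Variables (P' : probability W' R) (eta : nat -> {RV P' >-> R}).
Hypotheses (eta_iid : iid_std_normal eta) (p_gt0 : (0 < p)%N).

(** A union bound: each coordinate gets probability dl / p, and p coordinates below c tau give a
    norm below p c tau. *)
Lemma gauss_vector_tail (dl : R) : 0 < dl -> exists2 c : R, 0 < c &
  forall (J : eqType) (phi : J -> nat) (s : seq J) (z : J -> 'cV[R]_p) (m : 'cV[R]_p)
    (tau B : R), uniq (map phi s) -> 0 < tau -> frob m <= B ->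
  (forall i, \sum_(j <- s) z j i 0 ^+ 2 <= tau ^+ 2) ->
  fine (P' [set w' | B + c * tau < frob (m + \sum_(j <- s) eta (phi j) w' *: z j)]) <= dl.
Proof.
move=> dl0; have p0 : 0 < p%:R :> R by rewrite ltr0n.
have dp0 : 0 < dl / p%:R by rewrite divr_gt0.
have [c c0 Hc] := gauss_tail eta_iid dp0.
exists (p%:R * c); first by rewrite mulr_gt0.
move=> J phi s z m tau B us tau0 mB zt.
pose E (i : 'I_p) := [set w' | c * tau < `|\sum_(j <- s) z j i 0 * eta (phi j) w'|].
have mE i : measurable (E i).
  apply: measurable_gt_set; apply: measurableT_comp => //.
  by apply: measurable_sum => j; apply: measurable_funM.
set A := [set w' | _]; have mA : measurable A.
  apply: measurable_gt_set; apply: measurable_frob => i j.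
  under eq_fun do rewrite mxE summxE; apply: measurable_funD => //.
  apply: measurable_sum => k; under eq_fun do rewrite mxE.
  by apply: measurable_funM => //; exact: measurable_funPT.
have AE w' : \1_A w' <= \sum_(i < p) \1_(E i) w' :> R.
  rewrite !indicE; have [|_] := boolP (w' \in A); last by apply: sumr_ge0 => i _.
  rewrite inE => Aw; rewrite leNgt; apply/negP => h.
  have nE i : ~ E i w'.
    move=> Ei; move: h; rewrite (bigD1 i)//= indicE mem_set//= ltNge lerDl.
    by rewrite sumr_ge0.
  move: Aw; apply/negP; rewrite -leNgt.
  rewrite (le_trans (ler_frobD _ _))// lerD// (le_trans (frob_le_sum _))//.
  apply: (@le_trans _ _ (\sum_(i < p) c * tau)).
    apply: ler_sum => i _; rewrite summxE leNgt; apply/negP => hi; apply: (nE i).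
    rewrite /E/=; move: hi; congr (_ < `|_|).
    by apply: eq_bigr => j _; rewrite mxE mulrC.
  by rewrite sumr_const card_ord -[leLHS]mulr_natl mulrA.
rewrite -(Ex_indic P' mA).
have iE i : itg P' (\1_(E i) : W' -> R) by exact: itg_indic.
apply: (le_trans (Ex_le (itg_indic P' mA) (itg_sum (index_enum 'I_p) iE) AE)).
rewrite Ex_sum//; apply: (@le_trans _ _ (\sum_(i < p) dl / p%:R)).
  apply: ler_sum => i _; rewrite Ex_indic//.
  exact: Hc us tau0 (zt i).
by rewrite sumr_const card_ord -[leLHS]mulr_natl mulrCA mulfV ?gt_eqF// mulr1.
Qed.

End Tail.

(** * Bandwidth asymptotics *)

Section Bandwidths.
Context {R : realType}.
Implicit Types (g e M r : R) (T : nat).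

Lemma bandwidthE g T : (0 < T)%N -> bandwidth g T = T%:R `^ (1 + g).
Proof.
move=> T0; rewrite powRD ?powRr1//; apply/implyP => _.
by rewrite pnatr_eq0 -lt0n.
Qed.

Lemma bandwidth_ge g M : -1 < g -> \forall T \near \oo, M <= bandwidth g T.
Proof.
move=> g1; have s0 : 0 < 1 + g by rewrite addrC -ltrBlDr sub0r.
near=> T; rewrite bandwidthE; last by near: T; exact: nbhs_infty_gt.
by near: T; exact: near_powR_ge.
Unshelve. all: end_near. Qed.

Lemma bandwidth_le g e : g < 0 -> 0 < e -> \forall T \near \oo, bandwidth g T <= e * T%:R.
Proof.
move=> g0 e0; have s0 : 0 < - g by rewrite oppr_gt0.
near=> T; rewrite /bandwidth mulrC ler_wpM2r// -[g]opprK.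
by near: T; exact: near_powR_le.
Unshelve. all: end_near. Qed.

Lemma bandwidth_mono (g2 g1 : R) T : g2 <= g1 -> (0 < T)%N -> bandwidth g2 T <= bandwidth g1 T.
Proof. by move=> g21 T0; rewrite ler_wpM2l// ler_powR// ler1n. Qed.

Lemma bandwidth_gt0 g T : (0 < T)%N -> 0 < bandwidth g T.
Proof. by move=> T0; rewrite mulr_gt0 ?powR_gt0 ?ltr0n. Qed.

Lemma bandwidth_ratio (g2 g1 e : R) : g2 < g1 -> 0 < e ->
  \forall T \near \oo, bandwidth g2 T <= e * bandwidth g1 T.
Proof.
move=> g21 e0; have s0 : 0 < g1 - g2 by rewrite subr_gt0.
near=> T; have T0 : (0 < T)%N by near: T; exact: nbhs_infty_gt.
have -> : g2 = - (g1 - g2) + g1 by rewrite opprB subrK.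
rewrite /bandwidth powRD; last by apply/implyP => _; rewrite pnatr_eq0 -lt0n.
rewrite [X in X <= _]mulrCA ler_wpM2r ?mulr_ge0 ?powR_ge0//.
by near: T; exact: near_powR_le.
Unshelve. all: end_near. Qed.

Lemma fracpt_interior g r : g < 0 -> 0 < r < 1 -> \forall T \near \oo,
  (2 * Num.truncn (bandwidth g T) < fracpt r T)%N /\
  (fracpt r T + 2 * Num.truncn (bandwidth g T) <= T)%N.
Proof.
(* With b <= e T the radius 2 b is at most half the distance from T r to either end; T > 2 / r
   absorbs the rounding of T r. *)
move=> g0 /andP[r0 r1]; pose e := Num.min r (1 - r) / 4.
have e0 : 0 < e by rewrite divr_gt0// lt_min r0 subr_gt0.
have er : e <= r / 4 by rewrite ler_wpM2r// ge_min lexx.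
have er1 : e <= (1 - r) / 4 by rewrite ler_wpM2r// ge_min lexx orbT.
near=> T; have T0 : (0 < T)%N by near: T; exact: nbhs_infty_gt.
have bT : bandwidth g T <= e * T%:R by near: T; exact: bandwidth_le.
have rT : 2 / r < T%:R by near: T; exact: nbhs_infty_gtr.
have b0 := bandwidth_gt0 g T0.
have /andP[n1 _] := truncn_itv (ltW b0); set n := Num.truncn (bandwidth g T) in n1 *.
have Tr0 : 0 <= T%:R * r by rewrite mulr_ge0// ltW.
have /andP[t1 t2] := truncn_itv Tr0; rewrite -/(fracpt r T) in t1 t2.
have T0R : 0 <= T%:R :> R by [].
have h1 := ler_wpM2r T0R er; have h2 := ler_wpM2r T0R er1.
rewrite ltr_pdivrMr// in rT.
split.
  rewrite -(ltr_nat R) natrM; rewrite -natr1 in t2; lra.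
rewrite -(ler_nat R) natrD natrM; nra.
Unshelve. all: end_near. Qed.

Lemma bandwidth_cvg0 g : g < 0 -> T%:R `^ g @[T --> \oo] --> (0 : R).
Proof.
move=> g0; apply/cvgrPdist_le => e e0; near=> T.
rewrite sub0r normrN ger0_norm ?powR_ge0// -[g]opprK.
by near: T; apply: near_powR_le; rewrite ?oppr_gt0.
Unshelve. all: end_near. Qed.

Lemma bandwidth_cvgy g : -1 < g -> T%:R * T%:R `^ g @[T --> \oo] --> +oo.
Proof.
move=> g1; apply/cvgryPge => M; near=> T.
by rewrite -/(bandwidth g T); near: T; exact: bandwidth_ge.
Unshelve. all: end_near. Qed.

Lemma window_interior T t n : (n < t)%N -> (t + n <= T)%N ->
  window T t n = index_iota (t - n) (t + n).+1.
Proof.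
move=> nt tn; apply/all_filterP/allP => i; rewrite mem_index_iota => /andP[i1 i2].
by apply/andP; split; [rewrite (leq_trans _ i1)// subn_gt0|rewrite (leq_trans _ tn)].
Qed.

End Bandwidths.

Section FiniteIntersections.
Context {d : measure_display} {W : measurableType d} {R : realType}.
Variable P : probability W R.

Lemma whp_near (A : nat -> set W) : (\forall T \near \oo, forall w, A T w) -> whp P A.
Proof.
move=> hA e e0; near=> T; exists setT; split => //.
  by rewrite setCT measure0 lee_fin ltW.
by move=> w _; move: w; near: T.
Unshelve. all: end_near. Qed.

Lemma near_forall_fin (I : finType) (A : I -> nat -> Prop) :
  (forall i, \forall T \near \oo, A i T) -> \forall T \near \oo, forall i, A i T.
Proof. by move=> hA; apply: filter_forall. Qed.

Lemma whp_forall (I : finType) (A : I -> nat -> set W) :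
  (forall i, whp P (A i)) -> whp P (fun T => [set w | forall i, A i T w]).
Proof.
move=> hA.
have h (s : seq I) : whp P (fun T => [set w | forall i, i \in s -> A i T w]).
  elim: s => [|i s IHs]; first by apply: whp_near; apply: nearW.
  apply: whpS (whpI (hA i) IHs); apply: nearW => T w [Ai As] j.
  by rewrite inE => /orP[/eqP ->|]; [|exact: As].
apply: whpS (h (enum I)); apply: nearW => T w hw i; apply: hw.
exact: mem_enum.
Qed.

End FiniteIntersections.

Section LocalAverages.
Context {d dV : measure_display} {W : measurableType d} {SV : measurableType dV}.
Context {R : realType}.
Variables (P : probability W R) (V : int -> {RV P >-> SV}) (K : R -> R).
Variables (gamma1 gamma2 r : R).
Hypothesis mix : mixing_coef V m @[m --> \oo] --> (0 : R).
Hypotheses (hK : cond_K K) (g2 : -1 < gamma2) (g21 : gamma2 <= gamma1).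
Hypotheses (g1 : gamma1 < 0) (r01 : 0 < r < 1).
Local Notation b1 := (bandwidth gamma1).
Local Notation b2 := (bandwidth gamma2).
Local Notation t := (fracpt r).
Local Notation n1 T := (Num.truncn (bandwidth gamma1 T)).
Local Notation n2 T := (Num.truncn (bandwidth gamma2 T)).

(** The margin 2 n1 keeps in the sample the kernel supports of radius n1 around all centres within
    n1 of t. *)
Lemma near_geometry : \forall T \near \oo, [/\ (0 < T)%N, (2 * n1 T < t T)%N,
  (t T + 2 * n1 T <= T)%N, 1 <= b2 T & b2 T <= b1 T].
Proof.
near=> T; have T0 : (0 < T)%N by near: T; exact: nbhs_infty_gt.
have [h1 h2] : (2 * n1 T < t T)%N /\ (t T + 2 * n1 T <= T)%N.
  by near: T; exact: fracpt_interior.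
split => //; first by near: T; exact: bandwidth_ge.
exact: bandwidth_mono.
Unshelve. all: end_near. Qed.

Lemma truncn_bandwidth T : b2 T <= b1 T -> (n2 T <= n1 T)%N.
Proof. exact: le_truncn. Qed.

Lemma win_interior T : (2 * n1 T < t T)%N -> (t T + 2 * n1 T <= T)%N ->
  b2 T <= b1 T -> win T (b2 T) (t T) = index_iota (t T - n2 T) (t T + n2 T).+1.
Proof.
move=> h1 h2 /truncn_bandwidth n21; apply: window_interior.
  by apply: leq_ltn_trans h1; rewrite mul2n -addnn (leq_trans n21)// leq_addr.
by apply: leq_trans h2; rewrite leq_add2l mul2n -addnn (leq_trans n21)// leq_addr.
Qed.

Lemma size_win T : (2 * n1 T < t T)%N -> (t T + 2 * n1 T <= T)%N ->
  1 <= b2 T -> b2 T <= b1 T -> (size (win T (b2 T) (t T)))%:R <= 5 * b2 T.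
Proof.
move=> h1 h2 b21 h; rewrite (win_interior h1 h2 h) size_iota.
have -> : ((t T + n2 T).+1 - (t T - n2 T) = (2 * n2 T).+1)%N.
  have := truncn_bandwidth h; move: h1; clear; lia.
rewrite -natr1 natrM.
have /andP[] := truncn_itv (le_trans ler01 b21); lra.
Qed.

Lemma whp_uniform (f : nat -> W -> R) (dl : R) : 0 < dl -> ned_L1 V f ->
  whp P (fun T => [set w | forall i, (t T - n1 T <= i <= t T + n1 T)%N ->
    `|(b1 T)^-1 * \sum_(t T - 2 * n1 T <= l < (t T + 2 * n1 T).+1)
        kw K (b1 T) i l * centered P f l w| <= dl]).
Proof.
move=> dl0 fN; have [L L0 LK] := kernel_lipschitz hK.
have [M M0 KM] := kernel_bound hK.
apply: (whp_L1 dl0) => e e0.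
have [b0 b00 Hb] := ned_uniform_lln mix L0 LK M0 KM e0 fN.
near=> T.
have [T0 h1 h2 b21 b12] : [/\ (0 < T)%N, (2 * n1 T < t T)%N,
  (t T + 2 * n1 T <= T)%N, 1 <= b2 T & b2 T <= b1 T].
  by near: T; exact: near_geometry.
have bT : b0 <= b1 T by near: T; apply: bandwidth_ge; exact: lt_le_trans g21.
have [H [iH H0 EH HH]] := Hb (b1 T) (t T) bT h1.
exists H; split => // w Hw i it; exact: le_trans (HH i w it) Hw.
Unshelve. all: end_near. Qed.

(** k = 1 serves the Gram matrix and k = 2 the variance, where the kernel enters squared. *)
Lemma whp_local (k : nat) (f : nat -> W -> R) (dl : R) : 0 < dl -> ned_L1 V f ->
  whp P (fun T => [set w | `|(b2 T)^-1 * \sum_(l <- win T (b2 T) (t T))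
        kw K (b2 T) (t T) l ^+ k * centered P f l w| <= dl]).
Proof.
move=> dl0 fN; have [M M0 KM] := kernel_bound hK.
apply: (whp_L1 dl0) => e e0.
have Mk : 0 < M ^+ k by rewrite exprn_gt0.
have [b0 b00 Hb] := ned_lln mix Mk e0 fN.
near=> T.
have [T0 h1 h2 b21 b12] : [/\ (0 < T)%N, (2 * n1 T < t T)%N,
  (t T + 2 * n1 T <= T)%N, 1 <= b2 T & b2 T <= b1 T].
  by near: T; exact: near_geometry.
have bT : b0 <= b2 T by near: T; exact: bandwidth_ge.
have bp := bandwidth_gt0 gamma2 T0.
have E w : (b2 T)^-1 * \sum_(l <- win T (b2 T) (t T))
        kw K (b2 T) (t T) l ^+ k * centered P f l w =
   \sum_(l <- win T (b2 T) (t T)) ((b2 T)^-1 * kw K (b2 T) (t T) l ^+ k) * centered P f l w.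
  by rewrite mulr_sumr; apply: eq_bigr => l _; rewrite mulrA.
have [iF _] := fN.
exists (fun w => `|(b2 T)^-1 * \sum_(l <- win T (b2 T) (t T))
        kw K (b2 T) (t T) l ^+ k * centered P f l w|); split => //.
- apply: itg_norm; apply: itgZ; apply: itg_sum_in => l /mem_window/andP[l1 _].
  by apply/itgZ/itgB; [exact: iF|exact: itg_cst].
- under eq_fun do rewrite E; apply: (Hb (b2 T)) => //.
  + by rewrite filter_uniq// iota_uniq.
  + by move=> l /mem_window/andP[].
  + exact: (size_win h1 h2 b21 b12).
  + move=> l; rewrite normrM gtr0_norm ?invr_gt0// mulrC ler_wpM2r ?invr_ge0 ?(ltW bp)//.
    by rewrite normrX lerXn2r ?nnegrE ?(ltW M0)//; exact: KM.
Unshelve. all: end_near. Qed.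

End LocalAverages.

(** * Limits of the data averages *)

Section MatrixEntries.
Context {R : realType} {p : nat}.

Lemma norm1_le_entries (M : 'M[R]_p) (dl : R) : 0 < dl ->
  (forall i j, `|M i j| <= dl / (p%:R ^+ 2 + 1)) -> norm1 M <= dl.
Proof.
move=> dl0 h; have p0 : 0 < p%:R ^+ 2 + 1 :> R by rewrite ltr_wpDl ?sqr_ge0.
apply: (@le_trans _ _ (\sum_(i < p) \sum_(j < p) dl / (p%:R ^+ 2 + 1))).
  by apply: ler_sum => i _; apply: ler_sum => j _.
rewrite !sumr_const !card_ord -mulrnA -[leLHS]mulr_natl natrM -expr2 mulrA.
by rewrite ler_pdivrMr// mulrC ler_wpM2l ?(ltW dl0)// lerDl.
Qed.

Lemma cvg_mx_entry (F : nat -> 'M[R]_p) (S : 'M[R]_p) i j (dl : R) : 0 < dl ->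
  F n @[n --> \oo] --> S -> \forall n \near \oo, `|F n i j - S i j| <= dl.
Proof.
move=> dl0 FS; have C : F n i j @[n --> \oo] --> S i j.
  exact: (cvg_comp _ _ FS (@coord_continuous R p p i j S)).
move/cvgrPdist_le: C => /(_ dl dl0) C; near=> n.
by rewrite distrC; near: n.
Unshelve. all: end_near. Qed.

End MatrixEntries.

Section MatrixLimits.
Context {d dV : measure_display} {W : measurableType d} {SV : measurableType dV}.
Context {R : realType} {p : nat}.
Variables (P : probability W R) (x : nat -> W -> 'cV[R]_p) (eps : nat -> {RV P >-> R}).
Variables (q : R) (V : int -> {RV P >-> SV}) (K : R -> R).
Variables (gamma1 gamma2 r : R) (Om Sg : R -> 'M[R]_p).
Hypothesis mix : mixing_coef V m @[m --> \oo] --> (0 : R).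
Hypotheses (x_rv : forall t, (1 <= t)%N -> random_vector (x t)) (q2 : 2 < q).
Hypothesis nx : forall i, ned_moment V q (fun t w => x t w i 0).
Hypothesis ne : ned_moment V q (fun t w => eps t w).
Hypothesis xq : exists C, forall t, (1 <= t)%N ->
  itg P (fun w => frob (x t w) `^ (2 * q)) /\ Ex P (fun w => frob (x t w) `^ (2 * q)) <= C.
Hypotheses (hDb : cond_Db x eps) (hDc : cond_Dc K x eps Om Sg) (hE : cond_E P x).
Hypotheses (hK : cond_K K) (g2 : -1 < gamma2) (g21 : gamma2 <= gamma1).
Hypotheses (g1 : gamma1 < 0) (r01 : 0 < r < 1).
Local Notation b1 := (bandwidth gamma1).
Local Notation b2 := (bandwidth gamma2).
Local Notation t := (fracpt r).
Local Notation n1 T := (Num.truncn (bandwidth gamma1 T)).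
Local Notation n2 T := (Num.truncn (bandwidth gamma2 T)).
Local Notation geometry T := [/\ (0 < T)%N, (2 * n1 T < t T)%N,
  (t T + 2 * n1 T <= T)%N, 1 <= b2 T & b2 T <= b1 T].

Let geo : \forall T \near \oo, geometry T.
Proof. exact: near_geometry. Qed.

Let restrict1 (U : lmodType R) T i (F : nat -> U) : geometry T ->
  (t T - n1 T <= i <= t T + n1 T)%N ->
  \sum_(1 <= l < T.+1) kw K (b1 T) i l *: F l =
  \sum_(t T - 2 * n1 T <= l < (t T + 2 * n1 T).+1) kw K (b1 T) i l *: F l.
Proof.
move=> [T0 h1 h2 _ _] /andP[i1 i2].
have bp := bandwidth_gt0 gamma1 T0.
apply: sum_kw_restrict => //; move: h1 h2 i1 i2; clear; lia.
Qed.

Let restrict2 (U : lmodType R) T (F : nat -> U) : geometry T ->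
  \sum_(1 <= l < T.+1) kw K (b2 T) (t T) l *: F l =
  \sum_(l <- win T (b2 T) (t T)) kw K (b2 T) (t T) l *: F l.
Proof.
move=> [T0 h1 h2 b21 b12].
have bp := bandwidth_gt0 gamma2 T0; have n21 := truncn_bandwidth b12.
rewrite (win_interior h1 h2 b12).
apply: sum_kw_restrict => //; move: h1 h2 n21; clear; lia.
Qed.

(** Condition [hDc] speaks of t itself, not of its neighbours i. For these, [hE] bounds each E[x x']
    below by rho and [kernel_sum_ge] bounds the kernel mass by k b1; the uniform law of large
    numbers costs half of rho k. *)
Lemma gram1_coercive : exists2 c : R, 0 < c & whp P (fun T => [set w | forall i,
  (t T - n1 T <= i <= t T + n1 T)%N -> coercive (gram1 K T (b1 T) (x^~ w) i) c]).
Proof.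
have [rho [rho0 Hrho]] := hE; have [k k0 [b0 b00 Hk]] := kernel_sum_ge hK.
have c0 : 0 < rho * k by rewrite mulr_gt0.
exists (rho * k / 2); first by rewrite divr_gt0.
pose dl := rho * k / 2 / (p%:R ^+ 2 + 1).
have dl0 : 0 < dl by rewrite divr_gt0 ?divr_gt0// ltr_wpDl ?sqr_ge0.
have A (ab : 'I_p * 'I_p) := whp_uniform mix hK g2 g21 g1 r01 dl0
  (fxx_ned q2 nx ab.1 ab.2).
apply: whpS (whp_forall A); near=> T => w /= Hw i it.
have gT : geometry T by near: T; exact: geo.
have [T0 h1 h2 b21 b12] := gT.
have bb0 : b0 <= b1 T by near: T; apply: bandwidth_ge; exact: lt_le_trans g21.
have bp := bandwidth_gt0 gamma1 T0.
pose S := (b1 T)^-1 *: (\sum_(t T - 2 * n1 T <= l < (t T + 2 * n1 T).+1)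
  kw K (b1 T) i l *: mean_mx P (fun w => x l w *m (x l w)^T)).
have lo1 l : (t T - 2 * n1 T <= l < (t T + 2 * n1 T).+1)%N -> (1 <= l)%N.
  by move=> /andP[+ _]; apply: leq_trans; rewrite subn_gt0.
apply: (@coercive_perturb _ _ _ S).
  move=> u; rewrite /S -scalemxAl dotvZr mulmx_suml dotv_sumr.
  apply: (@le_trans _ _ ((b1 T)^-1 * \sum_(t T - 2 * n1 T <= l < (t T + 2 * n1 T).+1)
      kw K (b1 T) i l * (rho * frob u ^+ 2))).
    rewrite -mulr_suml [leRHS](_ : _ = (rho * frob u ^+ 2) * ((b1 T)^-1 *
      \sum_(t T - 2 * n1 T <= l < (t T + 2 * n1 T).+1) kw K (b1 T) i l)); last by ring.
    rewrite mulrAC ler_wpM2l ?mulr_ge0 ?frob_ge0 ?(ltW rho0)//.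
    rewrite mulrC ler_pdivlMr//; apply: Hk => //; move: it h1; clear; lia.
  rewrite ler_wpM2l ?invr_ge0 ?(ltW bp)//; apply: ler_sum_nat => l /lo1 l1.
  rewrite -scalemxAl dotvZr ler_wpM2l ?kw_ge0//.
  have [->|u0] := eqVneq u 0; first by rewrite frob0 expr0n mulr0 mulmx0 /dotv mulmx0 mxE.
  by rewrite /dotv mulmxA; exact: Hrho.
apply: norm1_le_entries => [|a b]; first by rewrite divr_gt0.
have := Hw (a, b) i it; rewrite -/dl; congr (`|_| <= _) => /=.
rewrite /gram1 (restrict1 _ gT it) /S !mxE !summxE -mulrBr -sumrB.
congr (_ * _); apply: eq_bigr => l _.
by rewrite !mxE big_ord1 mxE -mulrBr /centered -mean_mxE mxE /fxx !mulr1.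
Unshelve. all: end_near. Qed.

Lemma noise_small (dl : R) : 0 < dl -> whp P (fun T => [set w | forall i,
  (t T - n1 T <= i <= t T + n1 T)%N ->
    frob (noise K T (b1 T) (x^~ w) (fun i => eps i w) i) <= dl]).
Proof.
move=> dl0; have dp0 : 0 < dl / (p%:R + 1) by rewrite divr_gt0// ltr_wpDl.
have A (a : 'I_p) := whp_uniform mix hK g2 g21 g1 r01 dp0 (gx_ned q2 nx ne a).
apply: whpS (whp_forall A); near=> T => w /= Hw i it.
have gT : geometry T by near: T; exact: geo.
have [T0 h1 h2 b21 b12] := gT.
rewrite /noise (restrict1 _ gT it) (le_trans (frob_le_sum _))//.
apply: (@le_trans _ _ (\sum_(a < p) dl / (p%:R + 1))).
  apply: ler_sum => a _; apply: le_trans (Hw a i it).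
  rewrite mxE summxE le_eqVlt; apply/orP; left; apply/eqP; congr `|_ * _|.
  apply: eq_big_nat => l /andP[l1 _].
  rewrite !mxE /centered Ex_gx//; first by rewrite subr0 /gx !mulr1.
  by rewrite (leq_trans _ l1)// subn_gt0.
rewrite sumr_const card_ord -[leLHS]mulr_natl mulrA ler_pdivrMr ?ltr_wpDl//.
by rewrite mulrC ler_wpM2l ?(ltW dl0)// lerDl.
Unshelve. all: end_near. Qed.

(** Half of the tolerance pays for the law of large numbers, half for [hDc] along h = T^gamma2,
    which is admissible since -1 < gamma2 < 0. *)
Lemma gram2_near (dl : R) : 0 < dl -> whp P (fun T => [set w |
  norm1 (gram2 K T (b2 T) (t T) (x^~ w) - Om r) <= dl]).
Proof.
move=> dl0; pose dp := dl / (p%:R ^+ 2 + 1).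
have dp0 : 0 < dp by rewrite divr_gt0// ltr_wpDl ?sqr_ge0.
have dp20 : 0 < dp / 2 by rewrite divr_gt0.
have A (ab : 'I_p * 'I_p) := whp_local mix hK g2 g21 g1 r01 1 dp20
  (fxx_ned q2 nx ab.1 ab.2).
have [_ _ HD] := hDc r01.
have [HO _] := HD (fun T => T%:R `^ gamma2) (bandwidth_cvg0 (le_lt_trans g21 g1))
  (bandwidth_cvgy g2).
have B (ab : 'I_p * 'I_p) := cvg_mx_entry ab.1 ab.2 dp20 HO.
have B' := near_forall_fin B.
apply: whpS (whp_forall A); near=> T => w /= Hw.
have gT : geometry T by near: T; exact: geo.
have HB : forall ab : 'I_p * 'I_p, `|((T%:R * T%:R `^ gamma2)^-1 *:
      (\sum_(1 <= i < T.+1) kw K (T%:R * T%:R `^ gamma2) (t T) i *: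
          mean_mx P (fun w => x i w *m (x i w)^T))) ab.1 ab.2 - Om r ab.1 ab.2| <= dp / 2.
  by near: T.
apply: norm1_le_entries => // a b; rewrite -/dp [dp]splitr.
have h1 := Hw (a, b); have h2 := HB (a, b); apply: le_trans (lerD h1 h2).
rewrite -/(bandwidth gamma2 T) (restrict2 _ gT).
apply: le_trans (ler_normD _ _) => /=.
rewrite le_eqVlt; apply/orP; left; apply/eqP; congr `|_|.
rewrite addrA /gram2 !mxE !summxE; congr (_ - _).
rewrite -mulrDr; congr (_ * _); rewrite -big_split/=; apply: eq_bigr => l _.
by rewrite !mxE big_ord1 mxE expr1 -mulrDr /centered -mean_mxE mxE /fxx !mulr1 subrK.
Unshelve. all: end_near. Qed.

Lemma var2_near (dl : R) : 0 < dl -> whp P (fun T => [set w |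
  norm1 ((b2 T)^-1 *: (\sum_(i <- win T (b2 T) (t T))
     (kw K (b2 T) (t T) i ^+ 2 * eps i w ^+ 2) *: (x i w *m (x i w)^T)) - Sg r) <= dl]).
Proof.
move=> dl0; pose dp := dl / (p%:R ^+ 2 + 1).
have dp0 : 0 < dp by rewrite divr_gt0// ltr_wpDl ?sqr_ge0.
have dp20 : 0 < dp / 2 by rewrite divr_gt0.
have A (ab : 'I_p * 'I_p) := whp_local mix hK g2 g21 g1 r01 2 dp20
  (hxx_ned q2 nx ne ab.1 ab.2).
have [_ _ HD] := hDc r01.
have [_ HO] := HD (fun T => T%:R `^ gamma2) (bandwidth_cvg0 (le_lt_trans g21 g1))
  (bandwidth_cvgy g2).
have B (ab : 'I_p * 'I_p) := cvg_mx_entry ab.1 ab.2 dp20 HO.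
have B' := near_forall_fin B.
apply: whpS (whp_forall A); near=> T => w /= Hw.
have gT : geometry T by near: T; exact: geo.
have HB : forall ab : 'I_p * 'I_p, `|var_mx P (fun w => (Num.sqrt (b2 T))^-1 *:
      (\sum_(1 <= i < T.+1) kw K (b2 T) (t T) i *:
          (eps i w *: x i w))) ab.1 ab.2 - Sg r ab.1 ab.2| <= dp / 2.
  by near: T.
apply: norm1_le_entries => // a b; rewrite -/dp [dp]splitr.
have h1 := Hw (a, b); have h2 := HB (a, b); apply: le_trans (lerD h1 h2).
have -> : var_mx P (fun w => (Num.sqrt (b2 T))^-1 *:
      (\sum_(1 <= i < T.+1) kw K (b2 T) (t T) i *: (eps i w *: x i w))) a b =
    (b2 T)^-1 * \sum_(l <- win T (b2 T) (t T)) kw K (b2 T) (t T) l ^+ 2 * Ex P (hxx x eps a b l).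
  have -> : (fun w => (Num.sqrt (b2 T))^-1 *:
      (\sum_(1 <= i < T.+1) kw K (b2 T) (t T) i *: (eps i w *: x i w))) =
    fun w => \sum_(1 <= i < T.+1) ((Num.sqrt (b2 T))^-1 * kw K (b2 T) (t T) i) *:
      (eps i w *: x i w).
    apply/funext => w'; rewrite scaler_sumr; apply: eq_bigr => l _.
    by rewrite !scalerA mulrA.
  rewrite (var_mxE x_rv q2 nx ne xq hDb) ?iota_uniq//; last first.
    by move=> l; rewrite mem_index_iota => /andP[].
  have [T0 _ _ _ _] := gT; have bp := bandwidth_gt0 gamma2 T0.
  have E2 : (Num.sqrt (b2 T))^-1 ^+ 2 = (b2 T)^-1 by rewrite exprVn sqr_sqrtr// ltW.
  (* One kernel factor acts as the scalar and the other joins the summand, so that [restrict2]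
     applies to squared weights. *)
  transitivity ((b2 T)^-1 * \sum_(1 <= l < T.+1) kw K (b2 T) (t T) l *:
     (kw K (b2 T) (t T) l * Ex P (hxx x eps a b l) : R^o)).
    rewrite mulr_sumr; apply: eq_bigr => l _; rewrite exprMn E2 expr2 /GRing.scale/=; ring.
  rewrite (restrict2 _ gT); congr (_ * _); apply: eq_bigr => l _.
  by rewrite /GRing.scale/= mulrA expr2.
apply: le_trans (ler_normD _ _) => /=.
rewrite le_eqVlt; apply/orP; left; apply/eqP; congr `|_|.
rewrite addrA !mxE !summxE; congr (_ - _).
rewrite -mulrDr; congr (_ * _); rewrite -big_split/=; apply: eq_bigr => l _.
rewrite !mxE big_ord1 mxE -mulrDr /centered subrK /hxx; ring.
Unshelve. all: end_near. Qed.

End MatrixLimits.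

(** * Bias and parameter drift *)

Section SmallTerms.
Context {d dV : measure_display} {W : measurableType d} {SV : measurableType dV}.
Context {R : realType} {p : nat}.
Variables (P : probability W R) (x : nat -> W -> 'cV[R]_p) (eps : nat -> {RV P >-> R}).
Variables (beta : nat -> nat -> W -> 'cV[R]_p).
Variables (q : R) (V : int -> {RV P >-> SV}) (K : R -> R).
Variables (gamma1 gamma2 r alpha : R).
Hypotheses (x_rv : forall t, (1 <= t)%N -> random_vector (x t)) (q2 : 2 < q).
Hypothesis beta_rv : forall T t, (1 <= t <= T)%N -> random_vector (beta T t).
Hypothesis nx : forall i, ned_moment V q (fun t w => x t w i 0).
Hypothesis ne : ned_moment V q (fun t w => eps t w).
Hypothesis xq : exists C, forall t, (1 <= t)%N ->
  itg P (fun w => frob (x t w) `^ (2 * q)) /\ Ex P (fun w => frob (x t w) `^ (2 * q)) <= C.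
Hypotheses (hDb : cond_Db x eps).
Hypotheses (hK : cond_K K) (g2 : -1 < gamma2) (g21 : gamma2 <= gamma1).
Hypotheses (g1 : gamma1 < 0) (r01 : 0 < r < 1).
Hypothesis hneg : negligible_bias P K gamma1 gamma2 x beta (fracpt r).
Hypotheses (alpha_gt0 : 0 < alpha) (hTVP : TVP_a P beta alpha).
Hypothesis hGamma : gamma1 < - (2 * alpha + 1)^-1.
Local Notation b1 := (bandwidth gamma1).
Local Notation b2 := (bandwidth gamma2).
Local Notation t := (fracpt r).
Local Notation n1 T := (Num.truncn (bandwidth gamma1 T)).
Local Notation n2 T := (Num.truncn (bandwidth gamma2 T)).
Local Notation geometry T := [/\ (0 < T)%N, (2 * n1 T < t T)%N,
  (t T + 2 * n1 T <= T)%N, 1 <= b2 T & b2 T <= b1 T].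

Let geo : \forall T \near \oo, geometry T.
Proof. exact: near_geometry. Qed.

Lemma mem_win_bounds T i : geometry T -> i \in win T (b2 T) (t T) ->
  (t T - n1 T <= i <= t T + n1 T)%N.
Proof.
move=> [T0 h1 h2 b21 b12]; rewrite (win_interior h1 h2 b12) mem_index_iota.
have := truncn_bandwidth b12; clear; lia.
Qed.

Lemma mem_win_centre T : geometry T -> t T \in win T (b2 T) (t T).
Proof.
move=> [T0 h1 h2 b21 b12]; rewrite (win_interior h1 h2 b12) mem_index_iota.
by rewrite leq_subr ltnS leq_addr.
Qed.

Lemma measurable_bigmax (I : eqType) (s : seq I) (F : I -> W -> R) :
  (forall i, i \in s -> measurable_fun setT (F i)) ->
  measurable_fun setT (fun w => \big[Num.max/0]_(i <- s) F i w).
Proof.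
elim: s => [|i s IHs] mF.
  by under eq_fun do rewrite big_nil; exact: measurable_cst.
under eq_fun do rewrite big_cons; apply: measurable_maxr.
  by apply: mF; rewrite mem_head.
by apply: IHs => j js; apply: mF; rewrite inE js orbT.
Qed.

Let mxmeas_rv (X : W -> 'cV[R]_p) : random_vector X -> mxmeas X.
Proof. by move=> mX i j; rewrite (ord1 j); exact: mX. Qed.

Lemma bias_small (dl : R) : 0 < dl -> whp P (fun T => [set w |
  forall i, i \in win T (b2 T) (t T) ->
    Num.sqrt (b2 T) * frob (bias K T (b1 T) (x^~ w) (beta T ^~ w) i) <= dl]).
Proof.
move=> dl0; have mY : \forall T \near \oo, measurable_fun setT (fun w =>
   \big[Num.max/0]_(k <- window T (t T) (Num.truncn (b2 T)))
     frob (bias K T (b1 T) (x^~ w) (beta T ^~ w) k)).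
  apply: nearW => T; apply: measurable_bigmax => k /mem_window k1.
  apply: measurable_frob; apply: mxmeasZ => //.
  apply: mxmeas_sum => l; rewrite mem_index_iota ltnS => l1.
  apply: mxmeasZ => //.
  have mxl : mxmeas (x l) by apply/mxmeas_rv/x_rv; case/andP: l1.
  apply: mxmeasM; first by apply: mxmeasM => //; exact: mxmeasT.
  by apply: mxmeasB; apply/mxmeas_rv/beta_rv.
apply: whpS (is_op_whp dl0 hneg mY); near=> T => w /= Hw i iw.
have [T0 _ _ b21 _] : geometry T by near: T; exact: geo.
have sb : 0 < Num.sqrt (b2 T) by rewrite sqrtr_gt0 bandwidth_gt0.
rewrite mulrC -ler_pdivlMr//; apply: le_trans (le_trans (ler_norm _) Hw).
exact: (le_bigmax_seq 0 i xpredT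
  (fun k => frob (bias K T (b1 T) (x^~ w) (beta T ^~ w) k)) iw isT).
Unshelve. all: end_near. Qed.

(** The scaled drift sqrt(b2) (b2 / T)^alpha is T to the power (1 + gamma2) / 2 + gamma2 alpha,
    which is negative when gamma2 < - 1 / (2 alpha + 1). This is the role of the range of gamma1. *)
Lemma exponent_lt0 : 0 < - ((1 + gamma2) / 2 + gamma2 * alpha).
Proof.
have a0 : 0 < 2 * alpha + 1 by rewrite addr_gt0// mulr_gt0.
have h := le_lt_trans g21 hGamma.
have h2 : gamma2 * (2 * alpha + 1) < -1.
  by rewrite -ltr_pdivlMr// mulN1r.
have -> : (1 + gamma2) / 2 + gamma2 * alpha = (1 + gamma2 * (2 * alpha + 1)) / 2 by field.
lra.
Qed.

Lemma beta_small (dl : R) : 0 < dl -> whp P (fun T => [set w |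
  forall i, i \in win T (b2 T) (t T) ->
    Num.sqrt (b2 T) * frob (beta T i w - beta T (t T) w) <= dl]).
Proof.
(* [TVP_a] demands positive radii for every T; the maximum with 1 ensures this and equals n2 once b2
   >= 1. *)
move=> dl0; pose a T := maxn 1 (n2 T).
have a1 T : (0 < a T)%N by rewrite /a leq_max.
have aoo : a T @[T --> \oo] --> \oo.
  apply/cvgnyPge => N; near=> T; rewrite /a leq_max; apply/orP; right.
  have b0 : 0 <= b2 T by rewrite mulr_ge0 ?powR_ge0.
  by rewrite truncn_ge_nat//; near: T; exact: bandwidth_ge.
have le_a T : 1 <= b2 T -> (a T)%:R <= b2 T /\ a T = n2 T.
  move=> b21; have b0 : 0 <= b2 T := le_trans ler01 b21.
  have -> : a T = n2 T by apply/maxn_idPr; rewrite truncn_ge_nat.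
  by split => //; rewrite truncn_le.
have aT0 : ((a T)%:R / T%:R : R) @[T --> \oo] --> (0 : R).
  apply/cvgrPdist_le => e e0; near=> T.
  have [T0 _ _ b21 _] : geometry T by near: T; exact: geo.
  have [aT _] := le_a T b21.
  rewrite sub0r normrN ger0_norm ?divr_ge0// ler_pdivrMr ?ltr0n//.
  apply: le_trans aT _; near: T; apply: bandwidth_le => //; exact: le_lt_trans g1.
have samp : in_sample t.
  near=> T; have [T0 h1 h2 _ _] : geometry T by near: T; exact: geo.
  by rewrite (leq_ltn_trans _ h1)// (leq_trans _ h2)// leq_addr.
have [_ H] := hTVP; have {}H := H a t a1 aoo aT0 samp.
have mY : \forall T \near \oo, measurable_fun setT (fun w =>
   \big[Num.max/0]_(j <- window T (t T) (a T)) frob (beta T (t T) w - beta T j w)).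
  near=> T; have /andP[t1 t2] : (1 <= t T <= T)%N by near: T; exact: samp.
  apply: measurable_bigmax => k /mem_window k1; apply: measurable_frob.
  by apply: mxmeasB; apply/mxmeas_rv/beta_rv; rewrite ?t1.
move=> e e0; have [M M0 HM] := is_Op_wp H mY e0.
apply: wpS HM; near=> T => w /= Hw i iw.
have [T0 _ _ b21 _] : geometry T by near: T; exact: geo.
have [aT aE] := le_a T b21.
have T0R : 0 < T%:R :> R by rewrite ltr0n.
have sb : 0 <= Num.sqrt (b2 T) by exact: sqrtr_ge0.
have h1 : frob (beta T i w - beta T (t T) w) <= M * ((a T)%:R / T%:R) `^ alpha.
  rewrite -opprB frobN; apply: le_trans (le_trans (ler_norm _) Hw).
  apply: (le_bigmax_seq 0 i xpredT
    (fun k => frob (beta T (t T) w - beta T k w))) => //.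
  by rewrite aE.
have h2 : ((a T)%:R / T%:R) `^ alpha <= T%:R `^ (gamma2 * alpha).
  rewrite powRrM; apply: ge0_ler_powR; rewrite ?nnegrE ?divr_ge0 ?powR_ge0 ?(ltW alpha_gt0)//.
  by rewrite ler_pdivrMr// mulrC.
have h3 : Num.sqrt (b2 T) = T%:R `^ ((1 + gamma2) / 2).
  by rewrite bandwidthE// powRrM -powR12_sqrt ?powR_ge0.
have h4 : T%:R `^ (- - ((1 + gamma2) / 2 + gamma2 * alpha)) <= dl / M.
  by near: T; apply: near_powR_le; [exact: exponent_lt0|rewrite divr_gt0].
apply: (le_trans (ler_wpM2l sb (le_trans h1 (ler_wpM2l (ltW M0) h2)))).
rewrite mulrCA -ler_pdivlMl// [leRHS]mulrC; apply: le_trans h4.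
rewrite opprK powRD; first by rewrite h3.
by apply/implyP => _; rewrite gt_eqF.
Unshelve. all: end_near. Qed.

End SmallTerms.

(** * Moments of the estimation noise *)

Section MomentBounds.
Context {d dV : measure_display} {W : measurableType d} {SV : measurableType dV}.
Context {R : realType} {p : nat}.
Variables (P : probability W R) (x : nat -> W -> 'cV[R]_p) (eps : nat -> {RV P >-> R}).
Variables (q : R) (V : int -> {RV P >-> SV}) (K : R -> R).
Variables (gamma1 gamma2 r : R).
Hypotheses (x_rv : forall t, (1 <= t)%N -> random_vector (x t)) (q2 : 2 < q).
Hypothesis nx : forall i, ned_moment V q (fun t w => x t w i 0).
Hypothesis ne : ned_moment V q (fun t w => eps t w).
Hypothesis xq : exists C, forall t, (1 <= t)%N ->
  itg P (fun w => frob (x t w) `^ (2 * q)) /\ Ex P (fun w => frob (x t w) `^ (2 * q)) <= C.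
Hypotheses (hDb : cond_Db x eps).
Hypotheses (hK : cond_K K) (g2 : -1 < gamma2) (g21 : gamma2 <= gamma1).
Hypotheses (g1 : gamma1 < 0) (r01 : 0 < r < 1).
Local Notation b1 := (bandwidth gamma1).
Local Notation b2 := (bandwidth gamma2).
Local Notation t := (fracpt r).
Local Notation n1 T := (Num.truncn (bandwidth gamma1 T)).
Local Notation n2 T := (Num.truncn (bandwidth gamma2 T)).
Local Notation geometry T := [/\ (0 < T)%N, (2 * n1 T < t T)%N,
  (t T + 2 * n1 T <= T)%N, 1 <= b2 T & b2 T <= b1 T].
Local Notation nz T w := (noise K T (b1 T) (x^~ w) (fun i => eps i w)).
Local Notation mom4 := (mom4 x eps).
Local Notation gx := (gx x eps).

Let geo : \forall T \near \oo, geometry T.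
Proof. exact: near_geometry. Qed.

Lemma win_average_Ex (F : nat -> W -> R) (C : R) T : geometry T -> 0 <= C ->
  (forall l, l \in win T (b2 T) (t T) -> itg P (F l) /\ Ex P (F l) <= C) ->
  itg P (fun w => (b2 T)^-1 * \sum_(l <- win T (b2 T) (t T)) F l w) /\
  Ex P (fun w => (b2 T)^-1 * \sum_(l <- win T (b2 T) (t T)) F l w) <= 5 * C.
Proof.
move=> [T0 h1 h2 b21 b12] C0 hF.
have bp := bandwidth_gt0 gamma2 T0.
have iS : itg P (fun w => \sum_(l <- win T (b2 T) (t T)) F l w).
  by apply: itg_sum_in => l /hF[].
split; first exact: itgZ.
rewrite ExZ// Ex_sum_in; last by move=> l /hF[].
rewrite mulrC ler_pdivrMr//.
apply: (@le_trans _ _ (\sum_(l <- win T (b2 T) (t T)) C)).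
  by rewrite big_seq [leRHS]big_seq; apply: ler_sum => l /hF[].
rewrite big_const_seq count_predT iter_addr_0 -[leLHS]mulr_natr [leRHS]mulrAC mulrC.
by rewrite ler_wpM2r//; exact: (size_win h1 h2 b21 b12).
Qed.

Lemma quartic_tight : tight P (fun T w =>
  (b2 T)^-1 * \sum_(l <- win T (b2 T) (t T)) quartic (x^~ w) (fun i => eps i w) l).
Proof.
have [C C0 HC] := mom4_bound x_rv q2 ne xq.
apply: (@tight_L1 _ _ _ _ (5 * C)); first by rewrite mulr_gt0.
near=> T; have gT : geometry T by near: T; exact: geo.
have [T0 _ _ _ _] := gT.
have [i1 e1] := @win_average_Ex mom4 C T gT (ltW C0)
  (fun l lw => HC l (proj1 (andP (mem_window lw)))).
split => // w; rewrite mulr_ge0 ?invr_ge0 ?(ltW (bandwidth_gt0 _ _))//.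
by apply: sumr_ge0 => l _; rewrite /quartic !addr_ge0 ?exprn_even_ge0.
Unshelve. all: end_near. Qed.

Lemma noise_entryE T i w a : geometry T -> (t T - n1 T <= i <= t T + n1 T)%N ->
  nz T w i a 0 = (b1 T)^-1 *
    \sum_(t T - 2 * n1 T <= l < (t T + 2 * n1 T).+1) kw K (b1 T) i l * gx a l w.
Proof.
move=> [T0 h1 h2 _ _] /andP[i1 i2]; have bp := bandwidth_gt0 gamma1 T0.
rewrite /noise (sum_kw_restrict hK (lo := (t T - 2 * n1 T)%N) (hi := (t T + 2 * n1 T).+1))//;
  try by move: h1 h2 i1 i2; clear; lia.
by rewrite mxE summxE; congr (_ * _); apply: eq_bigr => l _; rewrite !mxE /gx !mulr1.
Qed.

(** Serial uncorrelatedness leaves only the diagonal: b1 E[noise_a^2] is b1^(-1) times a sum of at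
    most 5 b1 terms, each below M^2 (2 C); hence the constant 10 per coordinate. *)
Lemma noise_sq_bound : exists2 C : R, 0 < C & \forall T \near \oo, forall i,
  (t T - n1 T <= i <= t T + n1 T)%N ->
  itg P (fun w => b1 T * frob (nz T w i) ^+ 2) /\
  Ex P (fun w => b1 T * frob (nz T w i) ^+ 2) <= C.
Proof.
have [C C0 HC] := mom4_bound x_rv q2 ne xq; have [M M0 KM] := kernel_bound hK.
have C10 : 0 < 10 * (M ^+ 2 * C) by rewrite !mulr_gt0// exprn_gt0.
exists (p%:R * (10 * (M ^+ 2 * C)) + 1).
  by rewrite ltr_wpDl// mulr_ge0// ltW.
near=> T => i it; have gT : geometry T by near: T; exact: geo.
have [T0 h1 h2 b21 b12] := gT; have bp := bandwidth_gt0 gamma1 T0.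
pose s := index_iota (t T - 2 * n1 T) (t T + 2 * n1 T).+1.
have s1 l : l \in s -> (1 <= l)%N.
  rewrite mem_index_iota => /andP[+ _]; apply: leq_trans.
  by rewrite subn_gt0.
have entry (a : 'I_p) :
    itg P (fun w => b1 T * nz T w i a 0 ^+ 2) /\
    Ex P (fun w => b1 T * nz T w i a 0 ^+ 2) <= 10 * (M ^+ 2 * C).
  have [j1 j2] := @Ex_orthogonal_sum _ _ _ P s (kw K (b1 T) i) (gx a) (gx a) (iota_uniq _ _)
   (fun l m ls ms => itg_gx_prod x_rv q2 ne xq a a (s1 l ls) (s1 m ms))
   (fun l m ls ms => Ex_gx_orth hDb a a (s1 l ls) (s1 m ms)).
  have E : (fun w => b1 T * nz T w i a 0 ^+ 2) = fun w => (b1 T)^-1 *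
    ((\sum_(l <- s) kw K (b1 T) i l * gx a l w) * (\sum_(l <- s) kw K (b1 T) i l * gx a l w)).
    apply/funext => w; rewrite (noise_entryE _ _ gT it) -/s.
    by move: (\sum_(l <- s) _) => S; field; rewrite gt_eqF.
  rewrite E; split; first exact: itgZ.
  rewrite ExZ// j2 mulrC ler_pdivrMr//.
  apply: (@le_trans _ _ (\sum_(l <- s) 2 * (M ^+ 2 * C))).
    rewrite big_seq [leRHS]big_seq; apply: ler_sum => l /s1 l1.
    have K2 : kw K (b1 T) i l ^+ 2 <= M ^+ 2.
      by rewrite -[leLHS]real_normK ?num_real// lerXn2r ?nnegrE ?(ltW M0)//; exact: KM.
    have [im em] := HC l l1.
    have ig := itg_gx_prod x_rv q2 ne xq a a l1 l1.
    have e2 : Ex P (fun w => gx a l w * gx a l w) <= 2 * C.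
      apply: (@le_trans _ _ (Ex P (fun w => mom4 l w + mom4 l w))).
        apply: Ex_le => //; first exact: itgD.
        by move=> w; rewrite (le_trans (ler_norm _))//; exact: prod4_mom4.
      rewrite ExD//; lra.
    have e0 : 0 <= Ex P (fun w => gx a l w * gx a l w).
      by apply: Ex_ge0 => w; rewrite -expr2 sqr_ge0.
    rewrite mulrCA; apply: ler_pM => //; exact: sqr_ge0.
  rewrite big_const_seq count_predT iter_addr_0 -[leLHS]mulr_natr size_iota.
  have -> : ((t T + 2 * n1 T).+1 - (t T - 2 * n1 T) = (4 * n1 T).+1)%N.
    by move: h1; clear; lia.
  have h3 : (4 * n1 T).+1%:R <= 5 * b1 T.
    rewrite -natr1 natrM; have /andP[] := truncn_itv (ltW bp).
    have : 1 <= b1 T by exact: le_trans b12.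
    lra.
  have := ler_wpM2l (ltW (mulr_gt0 (ltr0Sn R 1) (mulr_gt0 (exprn_gt0 2 M0) C0))) h3.
  by move=> /le_trans; apply; rewrite le_eqVlt; apply/orP; left; apply/eqP; ring.
have E : (fun w => b1 T * frob (nz T w i) ^+ 2) =
    fun w => \sum_(a < p) b1 T * nz T w i a 0 ^+ 2.
  by apply/funext => w; rewrite frob_cV_sqr mulr_sumr.
rewrite E; split; first by apply: itg_sum => a; case: (entry a).
rewrite Ex_sum; last by move=> a; case: (entry a).
apply: (@le_trans _ _ (\sum_(a < p) 10 * (M ^+ 2 * C))).
  by apply: ler_sum => a _; case: (entry a).
by rewrite sumr_const card_ord -[leLHS]mulr_natl lerDl.
Unshelve. all: end_near. Qed.

Local Notation load T w := (noise_load K T (b1 T) (b2 T) (t T) (x^~ w) (fun i => eps i w)).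

(** The inequality 2 a b <= a^2 + b^2, applied after pulling out sqrt(b2 / b1), replaces |x|^2
    |noise| by fourth moments of the data and second moments of the noise. The envelope thus has
    bounded mean, and the order of the load is the extracted factor. *)
Definition load_envelope T w : R :=
  2^-1 * ((b2 T)^-1 * (\sum_(l <- win T (b2 T) (t T))
     (mom4 l w + b1 T * frob (nz T w l) ^+ 2))) +
  2^-1 * (1 + b1 T * frob (nz T w (t T)) ^+ 2).

Lemma load_le_envelope T w : geometry T ->
  load T w <= Num.sqrt (b2 T / b1 T) * load_envelope T w.
Proof.
move=> [T0 h1 h2 b21 b12].
have bp1 := bandwidth_gt0 gamma1 T0; have bp2 := bandwidth_gt0 gamma2 T0.
set u := Num.sqrt (b2 T / b1 T); have u0 : 0 <= u by exact: sqrtr_ge0.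
have E : Num.sqrt (b2 T) = u * Num.sqrt (b1 T).
  by rewrite /u -sqrtrM ?divr_ge0 ?(ltW bp1) ?(ltW bp2)// divfK ?gt_eqF.
have amgm (a nu : R) : a * (Num.sqrt (b2 T) * nu) <= u * (2^-1 * (a ^+ 2 + b1 T * nu ^+ 2)).
  rewrite E [leLHS](_ : _ = u * (a * (Num.sqrt (b1 T) * nu))); last by ring.
  rewrite ler_wpM2l// -{2}[b1 T]sqr_sqrtr ?(ltW bp1)//.
  have := sqr_ge0 (a - Num.sqrt (b1 T) * nu); lra.
rewrite /noise_load /load_envelope mulrDr; apply: lerD; last first.
  by rewrite -[X in X <= _]mul1r (le_trans (amgm 1 _))// expr1n.
rewrite [leRHS](_ : _ = (b2 T)^-1 * \sum_(l <- win T (b2 T) (t T))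
   u * (2^-1 * (mom4 l w + b1 T * frob (nz T w l) ^+ 2))); last first.
  by rewrite -!mulr_sumr; ring.
rewrite ler_wpM2l ?invr_ge0 ?(ltW bp2)//; apply: ler_sum => l _.
apply: (le_trans (amgm _ _)); rewrite ler_wpM2l// ler_wpM2l// lerD2r.
by rewrite -exprM /mom4 addrAC lerDr addr_ge0// exprn_even_ge0.
Qed.

Lemma load_envelope_tight : tight P load_envelope.
Proof.
have [C C0 HC] := mom4_bound x_rv q2 ne xq; have [D D0 HD] := noise_sq_bound.
apply: (@tight_L1 _ _ _ _ (2^-1 * (5 * (C + D)) + 2^-1 * (1 + D))).
  by rewrite addr_gt0// !mulr_gt0// ?addr_gt0.
near=> T; have gT : geometry T by near: T; exact: geo.
have [T0 _ _ _ _] := gT; have bp2 := bandwidth_gt0 gamma2 T0.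
have bp1 := bandwidth_gt0 gamma1 T0.
have HT : forall i, (t T - n1 T <= i <= t T + n1 T)%N ->
  itg P (fun w => b1 T * frob (nz T w i) ^+ 2) /\
  Ex P (fun w => b1 T * frob (nz T w i) ^+ 2) <= D by near: T.
have [i1 e1] := @win_average_Ex (fun l w => mom4 l w + b1 T * frob (nz T w l) ^+ 2)
  (C + D) T gT (ltW (addr_gt0 C0 D0)) ltac:(move=> l lw;
    have [a1 a2] := HC l (proj1 (andP (mem_window lw)));
    have [c1 c2] := HT l (mem_win_bounds gT lw);
    by split; [exact: itgD|rewrite ExD// lerD]).
have [i2 e2] := HT (t T) ltac:(by rewrite leq_subr leq_addr).
have i3 := itgD (itg_cst P 1) i2.
split.
- by apply: itgD; exact: itgZ.
- move=> w; rewrite /load_envelope.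
  have n0 l : 0 <= b1 T * frob (nz T w l) ^+ 2 by rewrite mulr_ge0 ?sqr_ge0// ltW.
  apply: addr_ge0; apply: mulr_ge0 => //; last exact: addr_ge0.
  apply: mulr_ge0; first by rewrite invr_ge0 ltW.
  by apply: sumr_ge0 => l _; rewrite addr_ge0// /mom4 !addr_ge0 ?exprn_even_ge0.
rewrite (ExD (itgZ _ i1) (itgZ _ i3)) (ExZ _ i1) (ExZ _ i3) (ExD (itg_cst _ _) i2) Ex_cst.
by rewrite lerD// ler_wpM2l// lerD2l.
Unshelve. all: end_near. Qed.

Lemma load_tight : tight P (fun T w => load T w).
Proof.
move=> e e0; have [M M0 HM] := load_envelope_tight e0.
exists M => //; apply: wpS HM; near=> T => w /= Hw.
have gT : geometry T by near: T; exact: geo.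
have [T0 _ _ b21 b12] := gT; have bp1 := bandwidth_gt0 gamma1 T0.
apply: (le_trans (load_le_envelope w gT)).
have u1 : Num.sqrt (b2 T / b1 T) <= 1.
  by rewrite -sqrtr1 ler_wsqrtr// ler_pdivrMr// mul1r.
have u0 := sqrtr_ge0 (b2 T / b1 T).
apply: (le_trans (ler_wpM2l u0 Hw)).
by rewrite ler_piMl// ltW.
Unshelve. all: end_near. Qed.

Lemma load_small (dl : R) : gamma2 < gamma1 -> 0 < dl ->
  whp P (fun T => [set w | load T w <= dl]).
Proof.
move=> g12 dl0 e e0; have [M M0 HM] := load_envelope_tight e0.
have dM : 0 < dl / M by rewrite divr_gt0.
apply: wpS HM; near=> T => w /= Hw.
have gT : geometry T by near: T; exact: geo.
have [T0 _ _ b21 b12] := gT; have bp1 := bandwidth_gt0 gamma1 T0.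
apply: (le_trans (load_le_envelope w gT)).
have u0 := sqrtr_ge0 (b2 T / b1 T).
apply: (le_trans (ler_wpM2l u0 Hw)); rewrite -ler_pdivlMr//.
rewrite -[leRHS]gtr0_norm// -sqrtr_sqr ler_wsqrtr// ler_pdivrMr//.
by near: T; apply: bandwidth_ratio => //; rewrite exprn_gt0.
Unshelve. all: end_near. Qed.

End MomentBounds.

(** * The bootstrap approximation *)

Section RemainderTail.
Context {d dV d' : measure_display} {W : measurableType d} {SV : measurableType dV}.
Context {W' : measurableType d'} {R : realType} {p : nat}.
Variables (P : probability W R) (P' : probability W' R).
Variables (x : nat -> W -> 'cV[R]_p) (eps : nat -> {RV P >-> R}).
Variables (beta : nat -> nat -> W -> 'cV[R]_p) (y : nat -> nat -> W -> R).
Variables (eta : nat -> {RV P' >-> R}).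
Variables (q : R) (V : int -> {RV P >-> SV}) (K : R -> R) (Om Sg : R -> 'M[R]_p).
Variables (gamma1 gamma2 r alpha : R) (L : 'M[R]_p).
Hypothesis p_gt0 : (0 < p)%N.
Hypothesis mix : mixing_coef V m @[m --> \oo] --> (0 : R).
Hypotheses (x_rv : forall t, (1 <= t)%N -> random_vector (x t)) (q2 : 2 < q).
Hypothesis beta_rv : forall T t, (1 <= t <= T)%N -> random_vector (beta T t).
Hypothesis model : forall T t w, (1 <= t <= T)%N ->
  y T t w = ((x t w)^T *m beta T t w) 0 0 + eps t w.
Hypothesis eta_iid : iid_std_normal eta.
Hypothesis nx : forall i, ned_moment V q (fun t w => x t w i 0).
Hypothesis ne : ned_moment V q (fun t w => eps t w).
Hypothesis xq : exists C, forall t, (1 <= t)%N ->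
  itg P (fun w => frob (x t w) `^ (2 * q)) /\ Ex P (fun w => frob (x t w) `^ (2 * q)) <= C.
Hypotheses (hDb : cond_Db x eps) (hDc : cond_Dc K x eps Om Sg) (hE : cond_E P x).
Hypotheses (hK : cond_K K) (g2 : -1 < gamma2) (g21 : gamma2 <= gamma1).
Hypotheses (g1 : gamma1 < 0) (r01 : 0 < r < 1).
Hypothesis hneg : negligible_bias P K gamma1 gamma2 x beta (fracpt r).
Hypotheses (alpha_gt0 : 0 < alpha) (hTVP : TVP_a P beta alpha).
Hypothesis hGamma : gamma1 < - (2 * alpha + 1)^-1.
Hypothesis SgL : Sg r = L *m L^T.
Local Notation b1 := (bandwidth gamma1).
Local Notation b2 := (bandwidth gamma2).
Local Notation t := (fracpt r).
Local Notation n1 T := (Num.truncn (bandwidth gamma1 T)).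
Local Notation n2 T := (Num.truncn (bandwidth gamma2 T)).
Local Notation geometry T := [/\ (0 < T)%N, (2 * n1 T < t T)%N,
  (t T + 2 * n1 T <= T)%N, 1 <= b2 T & b2 T <= b1 T].
Local Notation load T w := (noise_load K T (b1 T) (b2 T) (t T) (x^~ w) (fun i => eps i w)).

Definition remainder T w w' : 'cV[R]_p :=
  rstar K T (b1 T) (b2 T) (t T) (Om r) (Sg r) L (x^~ w) (y T ^~ w) (eta^~ w').

(* The constant [C] depends on [e] only through the bound on the quartic averages,
   and it multiplies the noise load alone: this makes the remainder o(1) as soon as
   the load is. *)
Lemma remainder_tail (e : R) : 0 < e -> exists2 C : R, 0 < C &
  forall dl tau N eN : R, 0 < dl -> 0 < tau -> 0 < N ->
  wp P eN (fun T => [set w | load T w <= N]) ->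
  wp P (e + eN) (fun T => [set w | Pstar P' (fun w w' =>
    (C * N + tau) * (Num.sqrt (b2 T))^-1 < frob (remainder T w w')) w <= dl]).
Proof.
move=> e0; have e20 : 0 < e / 2 by rewrite divr_gt0.
have [pOm _ _] := hDc r01.
have [c0 c00 cOm] := posdef_coercive pOm.
pose c2 := c0 / 2; have c20 : 0 < c2 by rewrite divr_gt0.
have [c1 c10 Hgram1] := gram1_coercive mix q2 nx hE hK g2 g21 g1 r01.
have [M0 M00 KM] := kernel_bound hK.
have [M4 M40 HM4] := quartic_tight x_rv q2 ne xq g2 g21 g1 r01 e20.
pose C := c2^-1 * M0 * (c1^-1 * (1 + M4)).
have C0 : 0 < C.
  by rewrite /C; do ![apply: mulr_gt0 => //]; rewrite ?invr_gt0// addr_gt0.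
exists C => // dl tau N eN dl0 tau0 N0 Hload.
have [c cc0 Hc] := gauss_vector_tail eta_iid p_gt0 dl0.
(* Half of tau goes to the Gaussian part, whose coordinates get standard deviation at most tau1 with
   c tau1 = tau / 2; the other half goes to bias and drift in the centre. *)
pose tau1 := tau / 2 / c; have tau10 : 0 < tau1 by rewrite !divr_gt0.
have [dl1 dl10 Hcoup] := coupling_error pOm SgL (exprn_gt0 2 tau10).
(* For zt <= 1 the factor 2 zt + zt^2 of [emp_var_error] is at most 3 zt, whence the 3. *)
pose A := M0 ^+ 2 * p%:R ^+ 2 * 3 * M4 + 1.
have A0 : 0 < A.
  by rewrite ltr_wpDl// !mulr_ge0 ?sqr_ge0// ltW.
pose zt := Num.min 1 (dl1 / 2 / A).
have zt0 : 0 < zt by rewrite lt_min ltr01 !divr_gt0.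
have zt1 : zt <= 1 by rewrite ge_min lexx.
have ztA : zt * A <= dl1 / 2 by rewrite -ler_pdivlMr// ge_min lexx orbT.
pose B := c2^-1 * M0 * ((2 / c1 + 1) * M4).
have B0 : 0 < B.
  rewrite /B; do ![apply: mulr_gt0 => //]; rewrite ?invr_gt0// addr_gt0// divr_gt0//.
(* [D] has two duties: B D <= tau / 2 in [centre_le], and, with noise below c1 zt / 2, an estimation
   error of at most (D + c1 zt / 2) / c1 <= zt. *)
pose D := Num.min (tau / 2 / B) (c1 * zt / 2).
have D0 : 0 < D by rewrite lt_min !divr_gt0// mulr_gt0.
have DB : B * D <= tau / 2 by rewrite mulrC -ler_pdivlMr// ge_min lexx.
have Dz : D <= c1 * zt / 2 by rewrite ge_min lexx orbT.
have d20 : 0 < dl1 / 2 by rewrite divr_gt0.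
have m0 : 0 < Num.min dl1 (c0 / 2) by rewrite lt_min dl10.
have cz0 : 0 < c1 * zt / 2 by rewrite divr_gt0// mulr_gt0.
have Hn := noise_small mix q2 nx ne hDb hK g2 g21 g1 r01 cz0.
have Hg2 := gram2_near mix q2 nx hDc hK g2 g21 g1 r01 m0.
have Hv2 := var2_near mix x_rv q2 nx ne xq hDb hDc hK g2 g21 g1 r01 d20.
have Hbi := bias_small x_rv beta_rv g2 g21 g1 r01 hneg D0.
have Hbe := beta_small beta_rv g2 g21 g1 r01 alpha_gt0 hTVP hGamma D0.
have Hall := wpI (wpI (whpI (whpI Hgram1 Hn) (whpI (whpI Hg2 Hv2) (whpI Hbi Hbe)) e20)
  HM4) Hload.
rewrite -splitr in Hall; apply: wpS Hall; near=> T.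
have gT : geometry T by near: T; exact: near_geometry.
move=> w [[[[HG HN] [[HG2 HV2] [HBi HBe]]] HQ] HL] /=.
have [T0 h1 h2 b21 b12] := gT.
have bp1 := bandwidth_gt0 gamma1 T0; have bp2 := bandwidth_gt0 gamma2 T0.
have sb : 0 < Num.sqrt (b2 T) by rewrite sqrtr_gt0.
have sb1 : 1 <= Num.sqrt (b2 T) by rewrite -sqrtr1 ler_wsqrtr.
have tw := mem_win_centre gT.
have mT i : (1 <= i <= T)%N -> y T i w = ((x i w)^T *m beta T i w) 0 0 + eps i w := model w.
move: HG2; rewrite /= le_min => /andP[HG2 HG2'].
have cG2 : coercive (gram2 K T (b2 T) (t T) (x^~ w)) c2 := coercive_perturb cOm HG2'.
set a := acoef K T (b1 T) (b2 T) (t T) (x^~ w) (y T ^~ w).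
have HA : norm1 (emp_var (win T (b2 T) (t T)) a - Sg r) <= dl1.
  have err i : i \in win T (b2 T) (t T) ->
      frob (bhat K T (b1 T) (x^~ w) (y T ^~ w) i - beta T i w) <= zt.
    move=> iw; have ib := mem_win_bounds gT iw.
    have bD : frob (bias K T (b1 T) (x^~ w) (beta T ^~ w) i) <= D.
      apply: le_trans (HBi i iw); rewrite ler_peMl ?frob_ge0//.
    apply: (le_trans (bhat_error_le mT bp1 (mem_window iw) c10 (HG i ib) bD)).
    rewrite mulrC ler_pdivrMr// mulrC [c1 * zt]splitr.
    by apply: lerD; [exact: Dz|exact: HN].
  have := emp_var_error KM mT bp2 err; rewrite -/a => h3.
  rewrite -(subrKA ((b2 T)^-1 *: (\sum_(i <- win T (b2 T) (t T))
     (kw K (b2 T) (t T) i ^+ 2 * eps i w ^+ 2) *: (x i w *m (x i w)^T)))).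
  rewrite (le_trans (norm1D _ _))// [dl1]splitr lerD//.
  apply: (le_trans h3); apply: le_trans ztA; rewrite /A [leRHS]mulrDr mulr1.
  apply: (@le_trans _ _ (M0 ^+ 2 * p%:R ^+ 2 * (3 * zt) * M4)); last first.
    by rewrite [leLHS](_ : _ = zt * (M0 ^+ 2 * p%:R ^+ 2 * 3 * M4)) ?lerDl ?(ltW zt0)//; ring.
  have z3 : 2 * zt + zt ^+ 2 <= 3 * zt.
    rewrite [leRHS](_ : _ = 2 * zt + zt * 1); last by ring.
    by rewrite expr2 lerD2l ler_wpM2l// ltW.
  have MM : 0 <= M0 ^+ 2 * p%:R ^+ 2 :> R by rewrite mulr_ge0 ?sqr_ge0.
  apply: ler_pM => //.
  - by apply: mulr_ge0 => //; apply: addr_ge0; [rewrite mulr_ge0// ltW|exact: sqr_ge0].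
  - rewrite mulr_ge0 ?invr_ge0 ?(ltW bp2)// sumr_ge0// => i _.
    by rewrite /quartic !addr_ge0 ?exprn_even_ge0.
  - exact: ler_wpM2l.
have hcentre : frob (centre K T (b1 T) (b2 T) (t T) (x^~ w) (y T ^~ w)) <= C * N + tau / 2.
  have tb : (t T - n1 T <= t T <= t T + n1 T)%N by rewrite leq_subr leq_addr.
  have := @centre_le _ _ _ _ KM T (b1 T) (b2 T) (t T) (x^~ w) (beta T ^~ w)
    (fun i => eps i w) (y T ^~ w) mT bp1 bp2 c1 c2 D M4 c10 c20 cG2 (mem_window tw)
    ltac:(by move=> i iw; split; [exact: HG (mem_win_bounds gT iw)|exact: HBi|exact: HBe])
    (HG _ tb) (HBi _ tw) HQ.
  move=> /le_trans; apply.
  rewrite mulrDr addrC lerD//.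
    by rewrite [leLHS]mulrA ler_wpM2l ?(ltW C0)//; exact: HL.
  by apply: le_trans DB; rewrite /B le_eqVlt; apply/orP; left; apply/eqP; ring.
have hsq := Hcoup _ _ _ HG2 HA.
have us : uniq [seq mult_index T i | i <- @coupled_index p (win T (b2 T) (t T))].
  apply: mult_index_uniq; first by rewrite filter_uniq// iota_uniq.
  by move=> k /mem_window/andP[].
have := Hc _ (mult_index T) _ _ _ tau1 _ us tau10 hcentre hsq; apply: le_trans.
rewrite /Pstar le_eqVlt; apply/orP; left; apply/eqP; congr (fine (P' _)).
apply/funext => w'; apply/propext => /=.
have := rstar_decomp (b1 T) (y T ^~ w) bp2 (Om r) (Sg r) L (eta^~ w') c20 cG2.
rewrite -/a => <-; rewrite frobZ gtr0_norm// -/(remainder T w w').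
have -> : C * N + tau / 2 + c * tau1 = C * N + tau.
  by rewrite -addrA; congr (_ + _); rewrite /tau1; field; rewrite gt_eqF.
by rewrite ltr_pdivrMr// [frob _ * _]mulrC.
Unshelve. all: end_near. Qed.

End RemainderTail.

Lemma posdef_sandwich (R : realType) (p : nat) (Om Sg : 'M[R]_p) : posdef Om -> posdef Sg ->
  posdef (invmx Om *m Sg *m invmx Om).
Proof.
move=> pOm [sSg pSg]; have uOm := posdef_unitmx pOm; have [sOm _] := pOm.
have sI : (invmx Om)^T = invmx Om by rewrite trmx_inv sOm.
split; first by rewrite !trmx_mul sI sSg mulmxA.
move=> v v0; have Iv : invmx Om *m v != 0.
  by apply: contraNneq v0 => h; rewrite -[v](mulKVmx uOm) h mulmx0.
by have := pSg _ Iv; rewrite trmx_mul sI !mulmxA.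
Qed.

Section RemainderMeasurable.
Context {d d' dU : measure_display} {W : measurableType d} {W' : measurableType d'}.
Context {U : measurableType dU} {R : realType} {p : nat}.
Variables (P : probability W R) (P' : probability W' R).
Variables (x : nat -> W -> 'cV[R]_p) (eps : nat -> {RV P >-> R}).
Variables (beta : nat -> nat -> W -> 'cV[R]_p) (y : nat -> nat -> W -> R).
Variables (eta : nat -> {RV P' >-> R}) (K : R -> R) (Om Sg : R -> 'M[R]_p).
Variables (gamma1 gamma2 r : R) (L : 'M[R]_p).
Hypothesis model : forall T t w, (1 <= t <= T)%N ->
  y T t w = ((x t w)^T *m beta T t w) 0 0 + eps t w.

(** The abstract domain [U] allows two uses: with the ambient product sigma-algebra for
    probabilities of events, and with the sigma-algebra of the sample for [bootstrap_vector]. *)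
Lemma mxmeas_remainder (T : nat) (f : U -> W) (g : U -> W') :
  (forall k i, (1 <= k <= T)%N -> measurable_fun setT (fun u => x k (f u) i 0)) ->
  (forall k i, (1 <= k <= T)%N -> measurable_fun setT (fun u => beta T k (f u) i 0)) ->
  (forall k, (1 <= k <= T)%N -> measurable_fun setT (fun u => eps k (f u))) ->
  (forall k, measurable_fun setT (fun u => eta k (g u))) ->
  mxmeas (fun u => remainder x y eta K Om Sg gamma1 gamma2 r L T (f u) (g u)).
Proof.
move=> mx mb me mg.
apply: (@mxmeas_rstar _ _ _ _ K T _ _ _ _ _ _ (fun k u => x k (f u))
  (fun k u => y T k (f u)) (fun k u => eta k (g u))) => //.
- by move=> k k1 i j; rewrite (ord1 j); exact: mx.
move=> k k1; have -> : (fun u => y T k (f u)) =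
    fun u => \sum_(i < p) x k (f u) i 0 * beta T k (f u) i 0 + eps k (f u).
  by apply/funext => u; rewrite model// -/(dotv _ _) dotvE.
apply: measurable_funD; last exact: me.
by apply: measurable_sum => i; apply: measurable_funM; [exact: mx|exact: mb].
Qed.

End RemainderMeasurable.

Lemma measurable_generated (d : measure_display) (W : measurableType d) (R : realType)
    (gens : set (set W)) (h : W -> R) :
  preimage_set_system setT h measurable `<=` gens ->
  measurable_fun (setT : set (g_sigma_algebraType gens)) h.
Proof. by move=> hg _ B mB; apply: sub_sigma_algebra; apply: hg; exists B. Qed.

Theorem theorem3 (R : realType) (p : nat)
  (d d' : measure_display) (W : measurableType d) (W' : measurableType d')
  (P : probability W R) (P' : probability W' R)
  (x : nat -> W -> 'cV[R]_p) (eps : nat -> {RV P >-> R})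
  (beta : nat -> nat -> W -> 'cV[R]_p) (y : nat -> nat -> W -> R)
  (eta : nat -> {RV P' >-> R})
  (K : R -> R) (Om Sg : R -> 'M[R]_p)
  (alpha gamma_low gamma1 gamma2 : R)
  (p_gt0 : (0 < p)%N)
  (x_rv : forall t, (1 <= t)%N -> random_vector (x t))
  (beta_rv : forall T t, (1 <= t <= T)%N -> random_vector (beta T t))
  (model : forall T t w, (1 <= t <= T)%N ->
     y T t w = ((x t w)^T *m beta T t w) 0 0 + eps t w)
  (eta_iid : iid_std_normal eta)
  (hgamma : [/\ -1 < gamma_low, gamma_low <= gamma2, gamma2 <= gamma1 & gamma1 < 0])
  (hK : cond_K K)
  (hDa : cond_Da x eps) (hDb : cond_Db x eps) (hDc : cond_Dc K x eps Om Sg)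
  (hE : cond_E P x)
  (hneg : forall r : R, 0 < r < 1 ->
     negligible_bias P K gamma1 gamma2 x beta (fracpt r))
  (alpha_gt0 : 0 < alpha) (hTVP : TVP_a P beta alpha)
  (hGamma : -1 < gamma1 < - (2 * alpha + 1)^-1) :
  forall r : R, 0 < r < 1 ->
  exists Rst : nat -> W -> W' -> 'cV[R]_p,
  let t := fracpt r in
  let b1 := bandwidth gamma1 in
  let b2 := bandwidth gamma2 in
  [/\ forall T, bootstrap_vector (sigma_sample x eps beta T) (Rst T),
      forall (dZ : measure_display) (WZ : measurableType dZ)
        (Q : probability WZ R) (Z : WZ -> 'cV[R]_p),
        gaussian_vector Q Z (invmx (Om r) *m Sg r *m invmx (Om r)) ->
        cvg_prob0 P (fun T w =>
          sup [set `| Pstar P' (fun w w' =>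
                        vle (Num.sqrt (b2 T) *:
                               (bstar K T (b1 T) (b2 T) (x^~ w) (y T ^~ w)
                                   (eta^~ w') (t T)
                                - bhat K T (b1 T) (x^~ w) (y T ^~ w) (t T)
                                - Rst T w w')) v) w
                      - fine (Q [set z | vle (Z z) v]) |
              | v in [set: 'cV[R]_p]]),
      gamma2 = gamma1 -> is_Op_star P P' Rst (fun T => (Num.sqrt (b2 T))^-1) &
      gamma2 < gamma1 -> is_op_star P P' Rst (fun T => (Num.sqrt (b2 T))^-1) ].
Proof.
move=> r r01; have [gl g2 g21 g1] := hgamma.
have g2' : -1 < gamma2 := lt_le_trans gl g2.
have [_ hG] := andP hGamma.
have [q [q2 [dV [SV [V [mix nx ne xq]]]]]] := cond_Da_ned x_rv hDa.
have [pOm pSg _] := hDc _ r01.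
have [L uL SgL] := posdef_cholesky pSg.
pose Rst := remainder x y eta K Om Sg gamma1 gamma2 r L.
exists Rst => t b1 b2.
have mR T : mxmeas (fun ww : W * W' => Rst T ww.1 ww.2).
  apply: (mxmeas_remainder _ _ _ _ _ _ _ model).
  - move=> k i /andP[k1 _]; apply: (measurableT_comp (f := fun w => x k w i 0)) => //.
    exact: x_rv.
  - move=> k i k1; apply: (measurableT_comp (f := fun w => beta T k w i 0)) => //.
    exact: beta_rv.
  - by move=> k _; apply: (measurableT_comp (f := eps k)).
  - by move=> k; apply: (measurableT_comp (f := eta k)).
have tailR := remainder_tail p_gt0 mix x_rv q2 beta_rv model eta_iid nx ne xq hDb hDc hE hK
  g2' g21 g1 r01 (hneg _ r01) alpha_gt0 hTVP hG SgL.
have mset (M dl : R) T : measurable [set w | Pstar P' (fun w w' =>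
    M * (Num.sqrt (b2 T))^-1 < frob (Rst T w w')) w <= dl].
  by apply: measurable_Pstar_le => i; exact: mR.
split.
- move=> T; apply: bootstrap_vector_meas => i.
  set gens := \bigcup_(_ in _) _.
  have sub k (h : W -> R) : (1 <= k <= T)%N ->
      preimage_set_system setT h measurable `<=`
        (preimage_set_system setT (eps k) measurable `|` \bigcup_(j in [set: 'I_p])
         (preimage_set_system setT (fun w => x k w j 0) measurable `|`
          preimage_set_system setT (fun w => beta T k w j 0) measurable)) ->
      measurable_fun setT (fun ww : g_sigma_algebraType gens * W' => h ww.1).
    move=> k1 hk; apply: (measurableT_comp (f := h : g_sigma_algebraType gens -> R)) => //.
    by apply: measurable_generated => A /hk; exists k.
  have mS := @mxmeas_remainder _ _ _ _ _ (g_sigma_algebraType gens * W')%type _ _ P P'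
    x eps beta y eta K Om Sg gamma1 gamma2 r L model T fst snd.
  apply: mS.
  + by move=> k j k1; apply: (sub k (fun w => x k w j 0)) => // A ?; right; exists j => //; left.
  + by move=> k j k1; apply: (sub k (fun w => beta T k w j 0)) => // A ?; right; exists j => //; right.
  + by move=> k k1; apply: (sub k (eps k)) => // A ?; left.
  + by move=> k; apply: (measurableT_comp (f := eta k)).
- move=> dZ WZ Q Z HZ.
  have pV := posdef_sandwich pOm pSg.
  (* Holds for every sample point and every v, not only in the limit; T > 0 ensures that b2 is
     nonzero. *)
  have exact_law T w v : (0 < T)%N -> Pstar P' (fun w w' =>
      vle (Num.sqrt (b2 T) *: (bstar K T (b1 T) (b2 T) (x^~ w) (y T ^~ w) (eta^~ w') (t T)
        - bhat K T (b1 T) (x^~ w) (y T ^~ w) (t T) - Rst T w w')) v) w =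
      fine (Q [set z | vle (Z z) v]).
    move=> T0; have sb : 0 < Num.sqrt (b2 T) by rewrite sqrtr_gt0 bandwidth_gt0.
    set a := acoef K T (b1 T) (b2 T) (t T) (x^~ w) (y T ^~ w).
    have us : uniq [seq mult_index T i | i <- @coupled_index p (win T (b2 T) (t T))].
      apply: mult_index_uniq; first by rewrite filter_uniq// iota_uniq.
      by move=> k /mem_window/andP[].
    have [sOm _] := pOm.
    rewrite -(gauss_comb_law eta_iid v pV HZ us
      (coupled_quad sOm uL SgL (win T (b2 T) (t T)) a)).
    rewrite /Pstar; congr (fine (P' _)); apply/funext => w'; congr (vle _ v).
    by rewrite /Rst /remainder /rstar subKr scalerA divff ?gt_eqF// scale1r.
  move=> e e0; apply: cvg_near_cst; near=> T.
  have T0 : (0 < T)%N by near: T; exact: nbhs_infty_gt.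
  (* All differences are 0, so the supremum is that of the singleton {0} and never exceeds e. *)
  rewrite (_ : [set w | _] = set0) ?measure0//.
  apply/seteqP; split => // w /=; rewrite (_ : [set _ | _ in _] = [set 0]).
    by rewrite sup1 normr0 ltNge (ltW e0).
  apply/seteqP; split => [z [v _ <-]|z ->] /=.
    by rewrite exact_law// subrr normr0.
  by exists 0 => //; rewrite exact_law// subrr normr0.
- move=> g12 e dl e0 dl0; have e20 : 0 < e / 2 by rewrite divr_gt0.
  have [C C0 HC] := tailR _ e20.
  have [N N0 HN] := load_tight x_rv q2 ne xq hDb hK g2' g21 g1 r01 e20.
  (* The noise load is merely tight here, with bound N; any fixed tau will do, and tau = 1 is
     taken. *)
  exists (C * N + 1); split; first by rewrite addr_gt0// mulr_gt0.
  apply: wp_ge; first exact: mset.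
  have := HC dl 1 N (e / 2) dl0 ltr01 N0 HN; by rewrite -splitr.
- move=> g12 e dl M e0 dl0 M0; have e20 : 0 < e / 2 by rewrite divr_gt0.
  have [C C0 HC] := tailR _ e20.
  (* The load is now eventually below any level: with N = M / (2 C) and tau = M / 2, the threshold C
     N + tau equals M. *)
  have N0 : 0 < M / 2 / C by rewrite !divr_gt0.
  have HN := load_small x_rv q2 ne xq hDb hK g2' g21 g1 r01 g12 N0 e20.
  apply: wp_ge; first exact: mset.
  have M20 : 0 < M / 2 by rewrite divr_gt0.
  have := HC dl (M / 2) _ (e / 2) dl0 M20 N0 HN.
  by rewrite -splitr mulrC divfK ?gt_eqF// -splitr.
Unshelve. all: end_near. Qed.
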